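(* Let $r\ge 2$ be an integer. For $s_1,\dots,s_{r-1}\in\mathbb{C}$ and $l\in\mathbb{N}_0$, we have $$\zeta_{r-1}^{\rm des}(s_1,\dots,s_{r-1})\,\zeta_1^{\rm des}(-l)=\sum_{i+j=l}(-1)^i\binom{l}{i}\,\zeta_r^{\rm des}(s_1,\dots,s_{r-2},s_{r-1}-i,-j),$$ where the sum runs over all $i,j\in\mathbb{N}_0$ with $i+j=l$.
   Context: $\mathbb{N}=\{1,2,\dots\}$ and $\mathbb{N}_0=\{0,1,2,\dots\}$. Desingularized multiple zeta-function: for $r\in\mathbb{N}$ and $c\in\mathbb{R}$ put $$\tilde{\mathfrak{H}}_r(t_1,\dots,t_r;c):=\prod_{j=1}^r\left(\frac{1}{\exp\left(\sum_{k=j}^r t_k\right)-1}-\frac{c}{\exp\left(c\sum_{k=j}^r t_k\right)-1}\right).$$ For non-integral complex numbers $s_1,\dots,s_r$, define $$\zeta_r^{\rm des}(s_1,\dots,s_r):=\lim_{\substack{c\to1\\ c\in\mathbb{R}\setminus\{1\}}}\frac{1}{(1-c)^r}\prod_{k=1}^r\frac{1}{(e^{2\pi i s_k}-1)\Gamma(s_k)}\int_{\mathcal{C}^r}\tilde{\mathfrak{H}}_r(t_1,\dots,t_r;c)\prod_{k=1}^r t_k^{s_k-1}\,dt_k,$$ where $\mathcal{C}$ is the path consisting of the positive real axis (top side), a circle around the origin of sufficiently small radius $\varepsilon$, and the positive real axis (bottom side). It is known (Furusho–Komori–Matsumoto–Tsumura) that $\zeta_r^{\rm des}$ continues analytically to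 an entire function on $\mathbb{C}^r$, also denoted $\zeta_r^{\rm des}$; values at arbitrary points of $\mathbb{C}^r$ refer to this entire function. *)

(* Defs.v *)
From HB Require Import structures.
From mathcomp Require Export all_boot all_order all_algebra.
From mathcomp Require Export complex.
From mathcomp Require Export all_classical all_reals all_analysis.

Set Implicit Arguments.
Unset Strict Implicit.
Unset Printing Implicit Defensive.

Export Order.TTheory GRing.Theory Num.Theory.
Export numFieldNormedType.Exports.

Local Open Scope classical_set_scope.
Local Open Scope complex_scope.
Local Open Scope ring_scope.

(* R[i] carries the topology of its modulus, as a normed space over itself;
   differentiability of maps between normed spaces over R[i] is therefore
   complex differentiability. *)
#[export, non_forgetful_inheritance, warnings="-redundant-canonical-projection"]
HB.instance Definition _ (R : realType) := PseudoPointedMetric.copy R[i] R[i]^o.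
#[export, non_forgetful_inheritance, warnings="-redundant-canonical-projection"]
HB.instance Definition _ (R : realType) := Vector.copy R[i] R[i]^o.
#[export, non_forgetful_inheritance, warnings="-redundant-canonical-projection"]
HB.instance Definition _ (R : realType) := NormedModule.copy R[i] R[i]^o.

Section Complex_functions.
Context {R : realType}.

Definition cexp (z : R[i]) : R[i] :=
  (expR (complex.Re z) * cos (complex.Im z))
    +i* (expR (complex.Re z) * sin (complex.Im z)).

(* Euler's Gamma function on all of C minus the non-positive integers, by
   Gauss's product formula lim n! n^s / (s (s + 1) ... (s + n)). *)
Definition cGamma (s : R[i]) : R[i] :=
  lim ((n`!%:R * cexp (s * (ln n%:R)%:C) / \prod_(k < n.+1) (s + k%:R))
         @[n --> \oo]).

Definition cintegral (D : set R) (f : R -> R[i]) : R[i] :=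
  (\int[lebesgue_measure]_(x in D) complex.Re (f x))
    +i* (\int[lebesgue_measure]_(x in D) complex.Im (f x)).

Definition entire r (F : 'rV[R[i]]_r -> R[i]) : Prop :=
  forall s, differentiable F s.

End Complex_functions.

Section Hankel_contour.
Context {R : realType}.

(* The integral of g over the contour C of radius e. Since t ^ (s - 1) is
   multivalued, the integrand is given as a function g of w = log t, with
   t = cexp w and arg t = Im w. The contour comes in from +oo with arg t = 0,
   turns once counterclockwise on |t| = e, and goes back to +oo with
   arg t = 2 pi. The integral is with respect to dt (not dw). *)
Definition hankel (e : R) (g : R[i] -> R[i]) : R[i] :=
  - cintegral `]e, +oo[ (fun x => g (ln x +i* 0))
  + cintegral `[0, 2 * pi]
      (fun th => g (ln e +i* th) * (0 +i* e * cexp (0 +i* th)))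
  + cintegral `]e, +oo[ (fun x => g (ln x +i* (2 * pi))).

(* Iterated integral over C ^ r; the first coordinate is the outermost one. *)
Fixpoint hankel_iter (e : R) (r : nat) : ('rV[R[i]]_r -> R[i]) -> R[i] :=
  match r with
  | 0%N => fun G => G 0
  | r'.+1 => fun G =>
      hankel e (fun w =>
        hankel_iter e (fun v : 'rV_r' => G (row_mx (w%:M : 'rV_1) v)))
  end.

End Hankel_contour.

Section Desingularized_zeta.
Context {R : realType}.

Definition frakH r (c : R) (t : 'rV[R[i]]_r) : R[i] :=
  \prod_(j < r)
    let T := \sum_(k < r | (j <= k)%N) t 0 k in
    ((cexp T - 1)^-1 - c%:C / (cexp (c%:C * T) - 1)).

(* The expression whose limit as c --> 1 defines zeta_r^des, with contour
   radius e. *)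
Definition zeta_des_approx r (e c : R) (s : 'rV[R[i]]_r) : R[i] :=
  ((1 - c) ^+ r)^-1%:C
  * (\prod_(k < r) ((cexp ((0 +i* (2 * pi)) * s 0 k) - 1) * cGamma (s 0 k))^-1)
  * hankel_iter e (fun w =>
      frakH c (map_mx cexp w) * \prod_(k < r) cexp ((s 0 k - 1) * w 0 k)).

Definition nonintegral r (s : 'rV[R[i]]_r) : Prop :=
  forall (k : 'I_r) (m : int), s 0 k <> m%:~R.

(* Z is the entire function zeta_r^des: it is determined by this predicate,
   the points with non-integral coordinates being dense. *)
Definition is_zeta_des r (Z : 'rV[R[i]]_r -> R[i]) : Prop :=
  entire Z /\
  forall s : 'rV[R[i]]_r, nonintegral s ->
    \forall e \near (0 : R)^'+,
      zeta_des_approx e c s @[c --> (1 : R)^'] --> Z s.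

End Desingularized_zeta.

(* Main.v *)
Require Import Defs.
From mathcomp Require Import ring lra measurable_realfun.
Import ComplexField.Normc.

Set Implicit Arguments.
Unset Strict Implicit.
Unset Printing Implicit Defensive.

Local Open Scope classical_set_scope.
Local Open Scope ring_scope.

(** Write b(z) = z / (exp z - 1) and g = b'. The argument turns zeta^des into a
    composition of operators in one variable, and the identity into Leibniz'
    rule for derivatives at 0.

    - Separation. The j-th factor of frakH depends on t only through
      T_j = t_j + ... + t_r. Hence the iterated contour integral is obtained
      from the constant function 1 by applying, for s = s_1, ..., s_r in this
      order, the operator that sends phi to the function
      z |-> int_C h (t + z) phi (t + z) t^(s - 1) dt, and by evaluating the
      result at 0; here h is the function of T_j in frakH. This is Fubini's
      theorem, in hankel_iter_fold.

    - The limit c -> 1. The function h is (1 - c) times the slope of b between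
      T and c T. Dominated convergence replaces h / (1 - c) by g, and
      zeta^des becomes the same composition with h = g (is_zeta_desE).

    - Shrinking the contour. Each integration by parts replaces s by s + 1 and
      differentiates g phi. After enough of them Re (s + m) > 1, the contour
      can be shrunk to the positive axis, and the operator attached to s,
      together with its factor 1 / ((exp (2 i pi s) - 1) Gamma (s)), becomes
        K_s phi (x) = (-1)^m / Gamma (s + m)
           * int_0^oo (g phi)^(m) (t + x) t^(s + m - 1) dt,
      for every m with Re (s + m) > 1 (zeta_mellin).

    Two properties of K_s can be read off this formula. Taking m + i instead
    of m for s - i shows that K_(s - i) phi = (-1)^i (K_s phi)^(i)
    (mellin_jet_shift). At s = -j, taking m = j + 1 leaves the integral of a
    derivative, so that K_(-j) phi (0) = (-1)^j (g phi)^(j) (0)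
    (zeta_at_neg). Since K_(-j) is reached as the limit of K_(x - j) for
    x -> 0+, a factor lam = lim 1 / Gamma (1 + x) appears; it occurs once on
    each side of the identity, and its existence follows from the value of
    zeta_1^des at 1 (inv_gamma_limit).

    With phi = K_(s_(r-1)) ... K_(s_1) 1, the right-hand side is therefore lam
    times the sum over i + j = l of
      (-1)^i C(l, i) (-1)^j (-1)^i (g phi^(i))^(j) (0),
    which Leibniz' rule collapses to (-1)^l g^(l) (0) phi (0)
    (alternating_leibniz), that is, to the product of
    zeta_(r-1)^des (s_1, ..., s_(r-1)) and zeta_1^des (-l). All of this assumes
    s_1, ..., s_(r-1) non-integral; the general case follows by continuity, by
    moving every s_k off the real axis.

    Limits are taken along sequences throughout: continuity, derivatives and
    dominated convergence are all used in sequential form. *)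

(** * Complex numbers and convergent sequences *)

Arguments cexp : simpl never.
Arguments normc : simpl never.
Notation re := (@complex.Re _).
Notation im := (@complex.Im _).

Section ComplexBasics.
Context {R : realType}.
Implicit Types (x y z w : R[i]) (a b : R).

Lemma complex_ext x y : re x = re y -> im x = im y -> x = y.
Proof. by case: x y => [a b] [c d] /= -> ->. Qed.

Lemma reD x y : re (x + y) = re x + re y. Proof. by case: x y => [? ?] []. Qed.
Lemma imD x y : im (x + y) = im x + im y. Proof. by case: x y => [? ?] []. Qed.
Lemma reN x : re (- x) = - re x. Proof. by case: x. Qed.
Lemma imN x : im (- x) = - im x. Proof. by case: x. Qed.
Lemma reB x y : re (x - y) = re x - re y. Proof. by rewrite reD reN. Qed.
Lemma imB x y : im (x - y) = im x - im y. Proof. by rewrite imD imN. Qed.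
Lemma reM x y : re (x * y) = re x * re y - im x * im y.
Proof. by case: x y => [? ?] []. Qed.
Lemma imM x y : im (x * y) = re x * im y + im x * re y.
Proof. by case: x y => [? ?] []. Qed.
Lemma re_real a : re (a%:C)%C = a. Proof. by []. Qed.
Lemma im_real a : im (a%:C)%C = 0. Proof. by []. Qed.
Lemma re_nat n : re (n%:R : R[i]) = n%:R.
Proof. by rewrite -(rmorph_nat (real_complex R)). Qed.
Lemma im_nat n : im (n%:R : R[i]) = 0.
Proof. by rewrite -(rmorph_nat (real_complex R)). Qed.

Lemma reV x : re x^-1 = re x / (re x ^+ 2 + im x ^+ 2).
Proof. by case: x. Qed.
Lemma imV x : im x^-1 = - im x / (re x ^+ 2 + im x ^+ 2).
Proof. by case: x => a b /=; rewrite mulNr. Qed.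

Lemma normcE0 x : normc x = Num.sqrt (re x ^+ 2 + im x ^+ 2).
Proof. by case: x. Qed.
Lemma normc_ge0 x : 0 <= normc x.
Proof. by rewrite normcE0 sqrtr_ge0. Qed.
Lemma normc_sqr x : normc x ^+ 2 = re x ^+ 2 + im x ^+ 2.
Proof. by rewrite normcE0 sqr_sqrtr// addr_ge0 ?sqr_ge0. Qed.
Lemma normc_eq0 x : (normc x == 0) = (x == 0).
Proof. by apply/eqP/eqP => [/eq0_normc//|->]; exact: normc0. Qed.
Lemma normc_gt0 x : (0 < normc x) = (x != 0).
Proof. by rewrite lt_neqAle normc_ge0 andbT eq_sym normc_eq0. Qed.
Lemma normc_real a : normc (a%:C)%C = `|a|.
Proof. by rewrite normcE0/= expr0n addr0 sqrtr_sqr. Qed.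
Lemma ler_normcD x y : normc (x + y) <= normc x + normc y.
Proof. exact: le_normcD. Qed.
Lemma normc_opp x : normc (- x) = normc x.
Proof. exact: normcN. Qed.
Lemma ler_normcB x y : normc (x - y) <= normc x + normc y.
Proof. by rewrite (le_trans (ler_normcD _ _))// normc_opp. Qed.
Lemma ger_re_normc x : `|re x| <= normc x.
Proof. by rewrite -sqrtr_sqr normcE0 ler_wsqrtr// lerDl sqr_ge0. Qed.
Lemma ger_im_normc x : `|im x| <= normc x.
Proof. by rewrite -sqrtr_sqr normcE0 ler_wsqrtr// lerDr sqr_ge0. Qed.
Lemma normc_le_sum x : normc x <= `|re x| + `|im x|.
Proof.
rewrite -(ler_pXn2r (n:=2))// ?nnegrE ?addr_ge0 ?normc_ge0//.
rewrite normc_sqr sqrrD !real_normK ?num_real//.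
by rewrite addrAC lerDl mulrn_wge0// mulr_ge0.
Qed.
Lemma normcX x n : normc (x ^+ n) = normc x ^+ n.
Proof. by elim: n => [|n IH]; rewrite ?expr0 ?normc1// !exprS normcM IH. Qed.
Lemma normc_sum (I : Type) (r : seq I) (P : pred I) (F : I -> R[i]) :
  normc (\sum_(i <- r | P i) F i) <= \sum_(i <- r | P i) normc (F i).
Proof.
elim/big_rec2: _ => [|i a b _ H]; first by rewrite normc0.
by rewrite (le_trans (ler_normcD _ _))// lerD2l.
Qed.

Lemma normcE x : `|x| = ((normc x)%:C)%C.
Proof. by case: x. Qed.

Lemma cexpD x y : cexp (x + y) = cexp x * cexp y.
Proof.
apply: complex_ext; rewrite ?reM ?imM /cexp /= reD imD expRD ?cosD ?sinD; ring.
Qed.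
Lemma cexp0 : cexp (0 : R[i]) = 1.
Proof.
by apply: complex_ext; rewrite /cexp /= expR0 ?cos0 ?sin0 ?mulr0 ?mulr1.
Qed.
Lemma normc_cexp x : normc (cexp x) = expR (re x).
Proof.
rewrite normcE0 /cexp /= !exprMn -mulrDr cos2Dsin2 mulr1 sqrtr_sqr ger0_norm// expR_ge0.
Qed.
Lemma cexp_neq0 x : cexp x != 0.
Proof. by rewrite -normc_gt0 normc_cexp expR_gt0. Qed.
Lemma cexpN x : cexp (- x) = (cexp x)^-1.
Proof.
by apply: (mulIf (cexp_neq0 x)); rewrite -cexpD addNr cexp0 mulVf ?cexp_neq0.
Qed.
Lemma cexp_real a : cexp (a%:C)%C = ((expR a)%:C)%C.
Proof. by apply: complex_ext; rewrite /cexp /= ?cos0 ?sin0 ?mulr1 ?mulr0. Qed.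
End ComplexBasics.

(** Convergence of real and imaginary parts, which gives access to the theorems
    on real limits; cvgC_topP identifies it with convergence in R[i]. The
    modulus normc is used rather than the norm of R[i], because it takes real
    values. *)
Definition cvgC {R : realType} (u : nat -> R[i]) (l : R[i]) : Prop :=
  (re (u n) @[n --> \oo] --> re l) /\ (im (u n) @[n --> \oo] --> im l).
Notation "u ~> l" := (cvgC u l) (at level 70, no associativity).

Section ComplexSequences.
Context {R : realType}.
Implicit Types (u v : nat -> R[i]) (k l : R[i]).

Lemma cvgC_ext u v l : u =1 v -> u ~> l -> v ~> l.
Proof. by move=> /funext ->. Qed.

Lemma cvgC_cst l : (fun=> l) ~> l.
Proof. by split; exact: cvg_cst. Qed.

Lemma cvgC_normP u l : u ~> l <-> (normc (u n - l) @[n --> \oo] --> 0).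
Proof.
split=> [[ur ui]|h].
  apply: (@squeeze_cvgr _ _ _ _ (cst 0)
    (fun n => `|re (u n) - re l| + `|im (u n) - im l|)).
  - apply: nearW => n; rewrite normc_ge0/= (le_trans (normc_le_sum _))//.
    by rewrite reB imB.
  - exact: cvg_cst.
  - rewrite -[0](addr0); apply: cvgD; rewrite -(normr0 R); apply: cvg_norm.
      by apply/subr_cvg0.
    by apply/subr_cvg0.
split; apply/subr_cvg0; apply: norm_cvg0;
  apply: (@squeeze_cvgr _ _ _ _ (cst 0) _ _ _ _ _ h).
- by apply: nearW => n; rewrite normr_ge0/= -reB ger_re_normc.
- exact: cvg_cst.
- by apply: nearW => n; rewrite normr_ge0/= -imB ger_im_normc.
- exact: cvg_cst.
Qed.

Lemma cvgC_squeeze u l (a : nat -> R) :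
  (forall n, normc (u n - l) <= a n) -> a n @[n --> \oo] --> 0 -> u ~> l.
Proof.
move=> ua a0; apply/cvgC_normP.
apply: (@squeeze_cvgr _ _ _ _ (cst 0) _ _ _ _ _ a0); last exact: cvg_cst.
by apply: nearW => n; rewrite normc_ge0/= ua.
Qed.

Lemma cvgCD u v k l : u ~> k -> v ~> l -> (fun n => u n + v n) ~> (k + l).
Proof.
move=> [? ?] [? ?]; split.
  by under eq_fun do rewrite reD; rewrite reD; exact: cvgD.
by under eq_fun do rewrite imD; rewrite imD; exact: cvgD.
Qed.

Lemma cvgCN u k : u ~> k -> (fun n => - u n) ~> (- k).
Proof.
move=> [? ?]; split.
  by under eq_fun do rewrite reN; rewrite reN; exact: cvgN.
by under eq_fun do rewrite imN; rewrite imN; exact: cvgN.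
Qed.

Lemma cvgCB u v k l : u ~> k -> v ~> l -> (fun n => u n - v n) ~> (k - l).
Proof. by move=> ? ?; apply: cvgCD => //; exact: cvgCN. Qed.

Lemma cvgCM u v k l : u ~> k -> v ~> l -> (fun n => u n * v n) ~> (k * l).
Proof.
move=> [? ?] [? ?]; split.
  by under eq_fun do rewrite reM; rewrite reM; apply: cvgB; exact: cvgM.
by under eq_fun do rewrite imM; rewrite imM; apply: cvgD; exact: cvgM.
Qed.

Lemma cvgCV u k : k != 0 -> u ~> k -> (fun n => (u n)^-1) ~> k^-1.
Proof.
move=> k0 [ur ui].
have k0' : re k ^+ 2 + im k ^+ 2 != 0.
  by rewrite -normc_sqr sqrf_eq0 normc_eq0.
have H : (re (u n) ^+ 2 + im (u n) ^+ 2)^-1 @[n --> \oo] -->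
    (re k ^+ 2 + im k ^+ 2)^-1.
  apply: cvgV => //; apply: cvgD; rewrite !expr2; under eq_fun do rewrite expr2;
   exact: cvgM.
split.
  by under eq_fun do rewrite reV; rewrite reV; exact: cvgM.
by under eq_fun do rewrite imV; rewrite imV; apply: cvgM => //; exact: cvgN.
Qed.

Lemma cvgC_sum (I : Type) (r : seq I) (P : pred I) (u : I -> nat -> R[i]) (l : I -> R[i]) :
  (forall i, P i -> u i ~> l i) ->
  (fun n => \sum_(i <- r | P i) u i n) ~> (\sum_(i <- r | P i) l i).
Proof.
move=> H; elim: r => [|i r IH].
  by under eq_fun do rewrite big_nil; rewrite big_nil; exact: cvgC_cst.
under eq_fun do rewrite big_cons; rewrite big_cons.
by case: ifP => Pi //; apply: cvgCD => //; exact: H.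
Qed.

Lemma cvgC_unique u k l : u ~> k -> u ~> l -> k = l.
Proof.
move=> [ur ui] [ur' ui']; apply: complex_ext.
  by have := cvg_unique _ ur ur'; apply.
by have := cvg_unique _ ui ui'; apply.
Qed.

Lemma cvgC_real (a : nat -> R) (b : R) : a n @[n --> \oo] --> b ->
  (fun n => (a n)%:C%C) ~> b%:C%C.
Proof. by move=> ab; split => //; exact: cvg_cst. Qed.

Lemma cvgC_shift N u l : (fun n => u (n + N)%N) ~> l <-> u ~> l.
Proof.
split=> [[]|[]] ? ?; split.
- by rewrite -(cvg_shiftn N).
- by rewrite -(cvg_shiftn N).
- by rewrite (cvg_shiftn N (fun n => re (u n))).
- by rewrite (cvg_shiftn N (fun n => im (u n))).
Qed.

Lemma cvgC_topP u l : u ~> l <-> (u n @[n --> \oo] --> l).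
Proof.
rewrite cvgC_normP; split => [h|h].
  apply/cvgrPdist_lt => e e0.
  have e0' : 0 < re e by move: e0; rewrite ltcE => /andP[].
  have eE : e = ((re e)%:C)%C.
    by move: e0; rewrite ltcE => /andP[/eqP ie _]; apply: complex_ext.
  move/cvgr0_norm_lt: h => /(_ _ e0'); apply: filterS => n.
  rewrite (ger0_norm (normc_ge0 _)) => hn.
  by rewrite eE normcE ltcR -normc_opp opprB.
apply/cvgr0Pnorm_lt => e e0.
have e0' : (0 : R[i]) < e%:C%C by rewrite ltcR.
move/cvgrPdist_lt: h => /(_ _ e0'); apply: filterS => n.
by rewrite (ger0_norm (normc_ge0 _)) normcE ltcR -normc_opp opprB.
Qed.

End ComplexSequences.

(** * Integration of complex-valued functions *)

Section Measurability.
Context {R : realType}.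
Local Notation mu := (@lebesgue_measure R).
Implicit Types (D : set R) (f g : R -> R[i]).

Definition cmeas D f :=
  measurable_fun D (fun x => re (f x)) /\ measurable_fun D (fun x => im (f x)).

(** Sequential continuity relative to D: what is needed for measurability, and
    preserved by composition with the sequential derivatives below. *)
Definition seqcont D f := forall (x : R) (u : nat -> R), D x ->
  (forall n, D (u n)) -> u n @[n --> \oo] --> x -> (fun n => f (u n)) ~> f x.

Lemma seq_continuous_in (D : set R) (g : R -> R) : open D ->
  (forall (x : R) (u : nat -> R), D x -> (forall n, D (u n)) ->
     u n @[n --> \oo] --> x -> g (u n) @[n --> \oo] --> g x) ->
  {in D, continuous g}.
Proof.
move=> oD H x /set_mem Dx; apply/(@cvg_nbhsP _ R^o) => u ux.
have [N _ HN] : \forall n \near \oo, D (u n) by exact: (ux D (open_nbhs_nbhs (conj oD Dx))).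
rewrite -(cvg_shiftn N); apply: (H x (fun n => u (n + N)%N)) => //.
  by move=> n; apply: HN => /=; exact: leq_addl.
by rewrite (cvg_shiftn N u).
Qed.

Lemma seqcont_cmeas D f : open D -> seqcont D f -> cmeas D f.
Proof.
move=> oD cf; split; apply: open_continuous_measurable_fun => //;
  apply: seq_continuous_in => // x u Dx Du ux; by case: (cf x u Dx Du ux).
Qed.

Lemma cmeasS D E f : measurable E -> D `<=` E -> cmeas E f -> cmeas D f.
Proof. by move=> mE DE [? ?]; split; exact: measurable_funS mE DE _. Qed.

Lemma cmeasD D f g : cmeas D f -> cmeas D g -> cmeas D (fun x => f x + g x).
Proof.
move=> [? ?] [? ?]; split.
  by under eq_fun do rewrite reD; exact: measurable_funD.
by under eq_fun do rewrite imD; exact: measurable_funD.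
Qed.

Lemma cmeasM D f g : cmeas D f -> cmeas D g -> cmeas D (fun x => f x * g x).
Proof.
move=> [? ?] [? ?]; split.
  by under eq_fun do rewrite reM; apply: measurable_funB; exact: measurable_funM.
by under eq_fun do rewrite imM; apply: measurable_funD; exact: measurable_funM.
Qed.

Lemma cmeas_cst D (c : R[i]) : cmeas D (fun=> c).
Proof. by split; exact: measurable_cst. Qed.

Lemma cmeasB D f g : cmeas D f -> cmeas D g -> cmeas D (fun x => f x - g x).
Proof.
move=> mf mg; have -> : (fun x => f x - g x) = (fun x => f x + (-1) * g x).
  by apply/funext => x; rewrite mulN1r.
by apply: cmeasD => //; apply: cmeasM => //; exact: cmeas_cst.
Qed.

(** A set open for the maximum distance is a countable union of squares with
    rational centre. *)
Lemma open2_measurable (P : set (R * R)) :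
  (forall x y, P (x, y) -> exists2 e : R, 0 < e &
     forall x' y', `|x - x'| < e -> `|y - y'| < e -> P (x', y')) ->
  measurable P.
Proof.
move=> HP.
have aux1 (a c d : R) : c < a -> a < c + d -> c - d < a < c + d by lra.
have aux2 (a b c d e : R) : b - d < a < b + d -> c < a -> a < c + d ->
  d < e / 2 -> b - e < c < b + e by lra.
pose B (q : (rat * rat) * nat) : set (R * R) :=
  ball (ratr q.1.1 : R) (q.2.+1%:R^-1 : R) `*` ball (ratr q.1.2 : R) (q.2.+1%:R^-1 : R).
have -> : P = \bigcup_(q in [set q | B q `<=` P]) B q.
  apply/seteqP; split => [[x y] Pxy|z [q /= qP] zq]; last exact: qP.
  have [e e0 He] := HP _ _ Pxy.
  have [n Hn] : exists n, n.+1%:R^-1 < e / 2 :> R.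
    have e20 : 0 < e / 2 by rewrite divr_gt0.
    by exists (Num.truncn (e / 2)^-1); rewrite invf_plt ?posrE// truncnS_gt.
  have n0 : 0 < n.+1%:R^-1 :> R by rewrite invr_gt0.
  have [p] := rat_in_itvoo (ltr_pwDr n0 (lexx x)).
  rewrite in_itv /= => /andP[px1 px2].
  have [q] := rat_in_itvoo (ltr_pwDr n0 (lexx y)).
  rewrite in_itv /= => /andP[qy1 qy2].
  exists ((p, q), n) => /=; last first.
    by split; rewrite /ball /= ltr_distl; exact: aux1.
  move=> [x' y'] [] /=; rewrite /ball /= !ltr_distl => px' qy'.
  by apply: He; rewrite ltr_distl; [exact: aux2 px' px1 px2 Hn|exact: aux2 qy' qy1 qy2 Hn].
rewrite bigcup_mkcond; apply: countable_bigcupT_measurable => // q.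
case: ifPn => // _; apply: measurableX; apply: open_measurable; exact: ball_open.
Qed.

Definition seqcont2 (D1 D2 : set R) (f : R -> R -> R[i]) :=
  forall (x y : R) (u v : nat -> R), D1 x -> D2 y ->
  (forall n, D1 (u n)) -> (forall n, D2 (v n)) ->
  u n @[n --> \oo] --> x -> v n @[n --> \oo] --> y ->
  (fun n => f (u n) (v n)) ~> f x y.

(** The preimage of an open interval is open: otherwise there are points
    of D1 x D2 converging to a point of the preimage with values outside the
    interval, against continuity. *)
Lemma seq_continuous2_measurable (D1 D2 : set R) (g : R -> R -> R) :
  open D1 -> open D2 ->
  (forall (x y : R) (u v : nat -> R), D1 x -> D2 y ->
    (forall n, D1 (u n)) -> (forall n, D2 (v n)) ->
    u n @[n --> \oo] --> x -> v n @[n --> \oo] --> y ->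
    g (u n) (v n) @[n --> \oo] --> g x y) ->
  measurable_fun (D1 `*` D2) (fun p : R * R => g p.1 p.2).
Proof.
move=> oD1 oD2 H; apply: (measurability _ (RGenOpens.measurableE R)).
move=> _ [_ [a [b ->] <-]]; apply: open2_measurable => x y [[/= Dx Dy] gxy].
have [e1 /= e10 He1] : nbhs x D1 by exact: open_nbhs_nbhs.
have [e2 /= e20 He2] : nbhs y D2 by exact: open_nbhs_nbhs.
apply: contrapT => nex.
have ex n : exists z : R * R, [/\ D1 z.1, D2 z.2, `|x - z.1| < n.+1%:R^-1,
    `|y - z.2| < n.+1%:R^-1 & ~ `]a, b[%classic (g z.1 z.2)].
  apply: contrapT => nz; apply: nex.
  exists (Num.min n.+1%:R^-1 (Num.min e1 e2)).
    by rewrite !lt_min invr_gt0 e10 e20 ltr0Sn.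
  move=> x' y'; rewrite !lt_min => /and3P[x'n x'1 x'2] /and3P[y'n y'1 y'2].
  have Dx' : D1 x' by exact: He1.
  have Dy' : D2 y' by exact: He2.
  by split => //; apply: contrapT => ng; apply: nz; exists (x', y').
have [z Hz] := choice ex.
have cvginv : (n.+1%:R^-1 : R) @[n --> \oo] --> 0 by exact: cvg_harmonic.
have u1 : (z n).1 @[n --> \oo] --> x.
  apply/cvgrPdist_lt => e e0; move/cvgr0_norm_lt : cvginv => /(_ _ e0).
  apply: filterS => n; rewrite ger0_norm// => hn; have [_ _ h _ _] := Hz n.
  exact: lt_trans hn.
have u2 : (z n).2 @[n --> \oo] --> y.
  apply/cvgrPdist_lt => e e0; move/cvgr0_norm_lt : cvginv => /(_ _ e0).
  apply: filterS => n; rewrite ger0_norm// => hn; have [_ _ _ h _] := Hz n.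
  exact: lt_trans hn.
have Dz1 n : D1 (z n).1 by case: (Hz n).
have Dz2 n : D2 (z n).2 by case: (Hz n).
have := H _ _ _ _ Dx Dy Dz1 Dz2 u1 u2.
move=> /(_ `]a, b[%classic) [].
  by apply: open_nbhs_nbhs; split => //; exact: interval_open.
by move=> N _ /(_ N (leqnn N)) /=; case: (Hz N).
Qed.

Lemma seqcont2_measurable (D1 D2 : set R) (f : R -> R -> R[i]) :
  open D1 -> open D2 -> seqcont2 D1 D2 f ->
  measurable_fun (D1 `*` D2) (fun p : R * R => re (f p.1 p.2)) /\
  measurable_fun (D1 `*` D2) (fun p : R * R => im (f p.1 p.2)).
Proof.
move=> o1 o2 H; split.
  apply: (@seq_continuous2_measurable D1 D2 (fun x y => re (f x y))) => //.
  by move=> x y u v *; case: (H x y u v).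
apply: (@seq_continuous2_measurable D1 D2 (fun x y => im (f x y))) => //.
by move=> x y u v *; case: (H x y u v).
Qed.
End Measurability.

Section RealFubini.
Context {R : realType} d1 d2 (T1 : measurableType d1) (T2 : measurableType d2)
  (m1 : {sigma_finite_measure set T1 -> \bar R})
  (m2 : {sigma_finite_measure set T2 -> \bar R}).

Lemma integrable_dom d (T : measurableType d) (mu : {measure set T -> \bar R})
    (D : set T) (f k : T -> R) : measurable D ->
  measurable_fun D f -> mu.-integrable D (EFin \o k) ->
  (forall x, D x -> `|f x| <= k x) -> mu.-integrable D (EFin \o f).
Proof.
move=> mD mf ik fk; apply: le_integrable ik => //; first exact/measurable_EFinP.
by move=> x Dx /=; rewrite lee_fin (le_trans (fk x Dx))// ler_norm.
Qed.

(** Fubini for a kernel dominated by a product of integrable functions. The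
    kernel is extended by 0 to the whole product space, where the theorem on
    integrable functions of two variables applies. *)
Lemma Rintegral_fubini (D1 : set T1) (D2 : set T2) (f : T1 -> T2 -> R)
    (k1 : T1 -> R) (k2 : T2 -> R) :
  measurable D1 -> measurable D2 ->
  measurable_fun (D1 `*` D2) (fun p : T1 * T2 => f p.1 p.2) ->
  m1.-integrable D1 (EFin \o k1) -> m2.-integrable D2 (EFin \o k2) ->
  (forall x y, D1 x -> D2 y -> `|f x y| <= k1 x * k2 y) ->
  (forall x, D1 x -> measurable_fun D2 (f x)) ->
  (forall y, D2 y -> measurable_fun D1 (f ^~ y)) ->
  \int[m1]_(x in D1) \int[m2]_(y in D2) f x y =
  \int[m2]_(y in D2) \int[m1]_(x in D1) f x y.
Proof.
move=> mD1 mD2 mf ik1 ik2 fk mf1 mf2.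
pose h : T1 * T2 -> \bar R :=
  fun p => ((fun p : T1 * T2 => f p.1 p.2) \_ (D1 `*` D2) p)%:E.
have mh : measurable_fun setT h.
  by apply/measurable_EFinP; apply: (iffLR (measurable_restrictT _ (measurableX mD1 mD2))).
have hE x y : h (x, y) =
    if (x \in D1) && (y \in D2) then (f x y)%:E else 0%E.
  by rewrite /h patchE in_setX/=; case: ifP.
have i1 x : D1 x -> m2.-integrable D2 (EFin \o f x).
  move=> Dx; apply: (@integrable_dom _ _ _ D2 (f x) (fun y => k1 x * k2 y)) => //.
  - exact: mf1.
  - rewrite (_ : EFin \o _ = (fun y => (k1 x)%:E * (EFin \o k2) y)%E)//.
    exact: integrableZl.
  - by move=> y Dy; exact: fk.
have i2 y : D2 y -> m1.-integrable D1 (EFin \o (f ^~ y)).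
  move=> Dy; apply: (@integrable_dom _ _ _ D1 (f ^~ y) (fun x => k1 x * k2 y)) => //.
  - exact: mf2.
  - rewrite (_ : EFin \o _ = (fun x => (EFin \o k1) x * (k2 y)%:E)%E)//.
    exact: integrableZr.
  - by move=> x Dx; exact: fk.
have ih : (m1 \x m2)%E.-integrable setT h.
  apply/integrable12ltyP => //.
  pose c : \bar R := (\int[m2]_(y in D2) `|(k2 y)%:E|)%E.
  have c_fin : c \is a fin_num.
    have /integrableP[_] := ik2; rewrite -/c => cy.
    by rewrite ge0_fin_numE// integral_ge0.
  apply: (@le_lt_trans _ _ (\int[m1]_x ((fun x => `|(k1 x)%:E| * c) \_ D1) x)%E).
    apply: ge0_le_integral => //.
    - by move=> x _; exact: integral_ge0.
    - apply: (measurable_fun_fubini_tonelli_F (abse \o h)) => //=.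
      exact: measurableT_comp.
    - apply: (iffLR (measurable_restrictT _ mD1)); under eq_fun do rewrite muleC; apply/measurable_funeM/measurableT_comp => //.
      by case/integrableP: ik1.
    - move=> x _; rewrite patchE; case: ifPn => Dx; last first.
        by rewrite integral0_eq// => y _; rewrite hE (negbTE Dx)/= normr0.
      rewrite -ge0_integralZl//; last first.
        by case/integrableP: ik2 => ? _; exact: measurableT_comp.
      rewrite [leRHS]integral_mkcond; apply: ge0_le_integral => //.
      + by apply: measurableT_comp => //; exact: (measurable_fun_pair2 x mh).
      + apply: (iffLR (measurable_restrictT _ mD2)); apply/measurable_funeM/measurableT_comp => //.
        by case/integrableP: ik2.
      + move=> y _; rewrite patchE hE Dx/=; case: ifPn => Dy; last by rewrite abse0.
        rewrite /= -EFinM lee_fin (le_trans (fk _ _ _ _)) ?inE//.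
          exact/set_mem. exact/set_mem.
        by rewrite (le_trans (ler_norm _))// normrM.
  rewrite -integral_mkcond ge0_integralZr//; last 2 first.
    by case/integrableP: ik1 => ? _; exact: measurableT_comp.
    exact: integral_ge0.
  case/integrableP: ik1 => _ ik1.
  apply: lte_mul_pinfty => //; first exact: integral_ge0.
    by rewrite ge0_fin_numE// integral_ge0.
  by rewrite -(ge0_fin_numE _)// integral_ge0.
have := Fubini ih.
have e1 : (\int[m1]_x \int[m2]_y h (x, y))%E =
    (\int[m1]_(x in D1) (\int[m2]_(y in D2) f x y)%:E)%E.
  rewrite [RHS]integral_mkcond; apply: eq_integral => x _.
  rewrite patchE; case: ifPn => Dx; last first.
    by rewrite integral0_eq// => y _; rewrite hE (negbTE Dx).
  rewrite /Rintegral fineK; last exact: integrable_fin_num (i1 _ (set_mem Dx)).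
  rewrite [RHS]integral_mkcond; apply: eq_integral => y _.
  by rewrite hE Dx patchE.
have e2 : (\int[m2]_y \int[m1]_x h (x, y))%E =
    (\int[m2]_(y in D2) (\int[m1]_(x in D1) f x y)%:E)%E.
  rewrite [RHS]integral_mkcond; apply: eq_integral => y _.
  rewrite patchE; case: ifPn => Dy; last first.
    by rewrite integral0_eq// => x _; rewrite hE (negbTE Dy) andbF.
  rewrite /Rintegral fineK; last exact: integrable_fin_num (i2 _ (set_mem Dy)).
  rewrite [RHS]integral_mkcond; apply: eq_integral => x _.
  by rewrite hE Dy andbT patchE.
by rewrite e1 e2 => e; exact: (congr1 fine e).
Qed.
End RealFubini.

Section CIntegral.
Context {R : realType}.
Local Notation mu := (@lebesgue_measure R).
Implicit Types (D : set R) (f g : R -> R[i]) (k : R -> R).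

Definition cintg D f := mu.-integrable D (EFin \o (fun x => re (f x))) /\
  mu.-integrable D (EFin \o (fun x => im (f x))).

Lemma integrable_domR D (f k : R -> R) : measurable D -> measurable_fun D f ->
  mu.-integrable D (EFin \o k) -> (forall x, D x -> `|f x| <= k x) ->
  mu.-integrable D (EFin \o f).
Proof. exact: (@integrable_dom R _ _ mu). Qed.

Lemma cintg_dom D f k : measurable D -> cmeas D f ->
  mu.-integrable D (EFin \o k) -> (forall x, D x -> normc (f x) <= k x) ->
  cintg D f.
Proof.
move=> mD [mr mi] ik fk; split; apply: (integrable_domR (k := k)) => // x Dx.
  by rewrite (le_trans (ger_re_normc _))// fk.
by rewrite (le_trans (ger_im_normc _))// fk.
Qed.

Lemma cintgS D E f : measurable D -> measurable E -> E `<=` D -> cintg D f -> cintg E f.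
Proof. by move=> mD mE ED [? ?]; split; exact: (@integrableS _ _ _ mu D). Qed.

Lemma eq_cintegral D f g : (forall x, D x -> f x = g x) ->
  cintegral D f = cintegral D g.
Proof.
move=> fg; rewrite /cintegral; congr Complex;
  by apply: eq_Rintegral => x /set_mem Dx; rewrite fg.
Qed.

Lemma cintegralD D f g : measurable D -> cintg D f -> cintg D g ->
  cintegral D (fun x => f x + g x) = cintegral D f + cintegral D g.
Proof.
move=> mD [? ?] [? ?]; apply: complex_ext; rewrite ?reD ?imD /= -RintegralD//;
  by apply: eq_Rintegral => x _; rewrite ?reD ?imD.
Qed.

Lemma cintegralZl D f (c : R[i]) : measurable D -> cintg D f ->
  cintegral D (fun x => c * f x) = c * cintegral D f.
Proof.
move=> mD [i1 i2].
have iZ (a : R) (h : R -> R) : mu.-integrable D (EFin \o h) ->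
    mu.-integrable D (EFin \o (fun x => a * h x)).
  move=> ih; rewrite (_ : EFin \o _ = (fun x => a%:E * (EFin \o h) x)%E)//.
  exact: integrableZl.
apply: complex_ext; rewrite ?reM ?imM /= -!RintegralZl// -?RintegralB -?RintegralD//;
  try exact: iZ; by apply: eq_Rintegral => x _; rewrite ?reM ?imM.
Qed.

(** The factor 2 comes from bounding real and imaginary parts separately. *)
Lemma cintegral_le D f k : measurable D -> cmeas D f ->
  mu.-integrable D (EFin \o k) -> (forall x, D x -> normc (f x) <= k x) ->
  normc (cintegral D f) <= 2 * \int[mu]_(x in D) k x.
Proof.
move=> mD mf ik fk; have [i1 i2] := cintg_dom mD mf ik fk.
rewrite (le_trans (normc_le_sum _))//= mulr_natl mulr2n.
apply: lerD; rewrite (le_trans (le_normr_Rintegral _ _))//; apply: le_Rintegral => //.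
- exact: integrable_norm.
- by move=> x Dx; rewrite (le_trans (ger_re_normc _))// fk.
- exact: integrable_norm.
- by move=> x Dx; rewrite (le_trans (ger_im_normc _))// fk.
Qed.

Lemma cmeas_cvg D (f_ : nat -> R -> R[i]) f : (forall n, cmeas D (f_ n)) ->
  (forall x, D x -> (fun n => f_ n x) ~> f x) -> cmeas D f.
Proof.
move=> mf ff; split.
  apply: (measurable_fun_cvg (h := fun n x => re (f_ n x))).
    by move=> n; case: (mf n).
  by move=> x Dx; case: (ff x Dx).
apply: (measurable_fun_cvg (h := fun n x => im (f_ n x))).
  by move=> n; case: (mf n).
by move=> x Dx; case: (ff x Dx).
Qed.

Lemma Rintegral_dct D (h_ : nat -> R -> R) (h k : R -> R) : measurable D ->
  (forall n, measurable_fun D (h_ n)) -> mu.-integrable D (EFin \o k) ->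
  (forall x, D x -> h_ n x @[n --> \oo] --> h x) ->
  (forall n x, D x -> `|h_ n x| <= k x) ->
  \int[mu]_(x in D) h_ n x @[n --> \oo] --> \int[mu]_(x in D) h x.
Proof.
move=> mD mh ik hh hk.
apply: fine_cvg; rewrite /Rintegral fineK; last first.
  apply: (@integrable_fin_num _ _ _ mu) => //; apply: (integrable_domR (k := k)) => //.
    exact: (measurable_fun_cvg (h := h_)).
  move=> x Dx; apply: (cvgr_to_le (F := \oo) (f := fun n => `|h_ n x|)).
    by apply: cvg_norm; exact: hh.
  by apply: nearW => n; exact: hk.
apply: (@dominated_cvg _ _ _ mu D mD (fun n x => (h_ n x)%:E) _ (EFin \o k)) => //.
- by move=> n; apply/measurable_EFinP; exact: mh.
- by move=> x Dx; apply: cvg_EFin; [exact: nearW|exact: hh].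
Qed.

Lemma cintegral_dct D (f_ : nat -> R -> R[i]) f k : measurable D ->
  (forall n, cmeas D (f_ n)) -> mu.-integrable D (EFin \o k) ->
  (forall x, D x -> (fun n => f_ n x) ~> f x) ->
  (forall n x, D x -> normc (f_ n x) <= k x) ->
  (fun n => cintegral D (f_ n)) ~> cintegral D f.
Proof.
move=> mD mf ik ff fk; split => /=; apply: (Rintegral_dct (k := k)) => //.
- by move=> n; case: (mf n).
- by move=> x Dx; case: (ff x Dx).
- by move=> n x Dx; rewrite (le_trans (ger_re_normc _))// fk.
- by move=> n; case: (mf n).
- by move=> x Dx; case: (ff x Dx).
- by move=> n x Dx; rewrite (le_trans (ger_im_normc _))// fk.
Qed.

Lemma cintegral_fubini (D1 D2 : set R) (f : R -> R -> R[i]) (k1 k2 : R -> R) :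
  measurable D1 -> measurable D2 ->
  measurable_fun (D1 `*` D2) (fun p : R * R => re (f p.1 p.2)) ->
  measurable_fun (D1 `*` D2) (fun p : R * R => im (f p.1 p.2)) ->
  mu.-integrable D1 (EFin \o k1) -> mu.-integrable D2 (EFin \o k2) ->
  (forall x y, D1 x -> D2 y -> normc (f x y) <= k1 x * k2 y) ->
  (forall x, D1 x -> cmeas D2 (f x)) ->
  (forall y, D2 y -> cmeas D1 (f ^~ y)) ->
  cintegral D1 (fun x => cintegral D2 (f x)) =
  cintegral D2 (fun y => cintegral D1 (f ^~ y)).
Proof.
move=> mD1 mD2 mr mi i1 i2 fk c1 c2; apply: complex_ext.
  apply: (@Rintegral_fubini R _ _ _ _ mu mu D1 D2 (fun x y => re (f x y)) k1 k2) => //.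
  - by move=> x y Dx Dy; rewrite (le_trans (ger_re_normc _))// fk.
  - by move=> x Dx; case: (c1 x Dx).
  - by move=> x Dx; case: (c2 x Dx).
apply: (@Rintegral_fubini R _ _ _ _ mu mu D1 D2 (fun x y => im (f x y)) k1 k2) => //.
- by move=> x y Dx Dy; rewrite (le_trans (ger_im_normc _))// fk.
- by move=> x Dx; case: (c1 x Dx).
- by move=> x Dx; case: (c2 x Dx).
Qed.
End CIntegral.

(** * Complex derivatives *)

Section ComplexDerivative.
Context {R : realType}.
Implicit Types (U V : set R[i]) (F G : R[i] -> R[i]) (z w l k : R[i]).

(** Caratheodory's form of the derivative of F at z relative to U, along
    sequences: the factorization makes sense when u n = z, so that no case has
    to be excluded in sums, products and compositions. *)
Definition cder U F z l := forall u : nat -> R[i], (forall n, U (u n)) ->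
  u ~> z -> exists2 q : nat -> R[i], q ~> l &
  forall n, F (u n) - F z = q n * (u n - z).

Definition cslope F l z w := if w == z then l else (F w - F z) / (w - z).

Lemma cslopeE F l z w : F w - F z = cslope F l z w * (w - z).
Proof.
rewrite /cslope; case: eqP => [->|/eqP wz]; first by rewrite !subrr mulr0.
by rewrite mulfVK// subr_eq0.
Qed.

Lemma cder_slope U F z l u : cder U F z l -> (forall n, U (u n)) -> u ~> z ->
  (fun n => cslope F l z (u n)) ~> l.
Proof.
move=> dF Uu uz; have [q ql Hq] := dF u Uu uz.
apply: (@cvgC_squeeze _ _ _ (fun n => normc (q n - l))); last exact/cvgC_normP.
move=> n; rewrite /cslope; case: eqP => [_|/eqP nz].
  by rewrite subrr normc0 normc_ge0.
by rewrite Hq mulfK// subr_eq0.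
Qed.

Lemma cder_cont U F z l u : cder U F z l -> (forall n, U (u n)) -> u ~> z ->
  (fun n => F (u n)) ~> F z.
Proof.
move=> dF Uu uz; have [q ql Hq] := dF u Uu uz.
have -> : (fun n => F (u n)) = (fun n => q n * (u n - z) + F z).
  by apply/funext => n; rewrite -Hq subrK.
rewrite -[X in _ ~> X]add0r -(mulr0 l) -(subrr z).
by apply: cvgCD (cvgC_cst _); apply: cvgCM => //; exact: cvgCB (cvgC_cst _).
Qed.

Lemma cder_sub U V F z l : V `<=` U -> cder U F z l -> cder V F z l.
Proof. by move=> VU dF u Vu; apply: dF => n; exact: VU. Qed.

Lemma cder_ext U F G z l : U z -> (forall w, U w -> F w = G w) ->
  cder U F z l -> cder U G z l.
Proof.
move=> Uz FG dF u Uu uz; have [q ql Hq] := dF u Uu uz.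
by exists q => // n; rewrite -!FG.
Qed.

Lemma cder_cst U (c : R[i]) z : cder U (fun=> c) z 0.
Proof.
by move=> u _ _; exists (fun=> 0) => [|n]; [exact: cvgC_cst|rewrite subrr mul0r].
Qed.

Lemma cderD U F G z l k : cder U F z l -> cder U G z k ->
  cder U (fun w => F w + G w) z (l + k).
Proof.
move=> dF dG u Uu uz; have [q ql Hq] := dF u Uu uz; have [p pk Hp] := dG u Uu uz.
exists (fun n => q n + p n); first exact: cvgCD.
by move=> n; rewrite mulrDl -Hq -Hp; ring.
Qed.

Lemma cderM U F G z l k : cder U F z l -> cder U G z k ->
  cder U (fun w => F w * G w) z (l * G z + F z * k).
Proof.
move=> dF dG u Uu uz; have [q ql Hq] := dF u Uu uz; have [p pk Hp] := dG u Uu uz.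
exists (fun n => q n * G (u n) + F z * p n).
  apply: cvgCD; first by apply: cvgCM => //; exact: (cder_cont dG).
  by apply: cvgCM => //; exact: cvgC_cst.
move=> n; rewrite mulrDl -mulrA (mulrC (G _)) mulrA -Hq -mulrA -Hp; ring.
Qed.

Lemma cderZ U F z l c : cder U F z l -> cder U (fun w => c * F w) z (c * l).
Proof.
move=> dF; rewrite -[c * l]add0r -(mul0r (F z)).
by apply: cderM => //; exact: cder_cst.
Qed.

Lemma cderV U F z l : U z -> (forall w, U w -> F w != 0) -> cder U F z l ->
  cder U (fun w => (F w)^-1) z (- l * (F z)^-1 * (F z)^-1).
Proof.
move=> Uz F0 dF u Uu uz; have [q ql Hq] := dF u Uu uz.
exists (fun n => - q n * (F (u n))^-1 * (F z)^-1).
  apply: cvgCM (cvgC_cst _); apply: cvgCM; first exact: cvgCN.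
  by apply: cvgCV; [exact: F0|exact: (cder_cont dF)].
move=> n; have -> : - q n / F (u n) / F z * (u n - z) =
   - (q n * (u n - z)) / F (u n) / F z by ring.
rewrite -Hq; have := F0 _ (Uu n); have := F0 _ Uz; move: (F _) (F _) => a b a0 b0.
by field; rewrite a0 b0.
Qed.

Lemma cder_sum U (I : Type) (r : seq I) (P : pred I) (F : I -> R[i] -> R[i])
    (l : I -> R[i]) z : (forall i, P i -> cder U (F i) z (l i)) ->
  cder U (fun w => \sum_(i <- r | P i) F i w) z (\sum_(i <- r | P i) l i).
Proof.
move=> H; elim: r => [|i r IH].
  by under eq_fun do rewrite big_nil; rewrite big_nil; exact: cder_cst.
under eq_fun do rewrite big_cons; rewrite big_cons.
by case: ifP => [Pi|//]; exact: (cderD (H i Pi) IH).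
Qed.

Lemma cder_shift U V F (t : R[i]) z l : (forall w, V w -> U (t + w)) ->
  cder U F (t + z) l -> cder V (fun w => F (t + w)) z l.
Proof.
move=> VU dF u Vu uz.
have [|q ql Hq] := dF (fun n => t + u n) (fun n => VU _ (Vu n)).
  by apply: cvgCD => //; exact: cvgC_cst.
by exists q => // n; rewrite Hq; congr (_ * _); ring.
Qed.
End ComplexDerivative.

Section RealCurves.
Context {R : realType}.
Implicit Types (f g : R -> R).

Lemma is_derive_seq f (x l : R) :
  (forall h : nat -> R, (forall n, h n != 0) -> h n @[n --> \oo] --> 0 ->
    (h n)^-1 * (f (h n + x) - f x) @[n --> \oo] --> l) -> is_derive x 1 f l.
Proof.
move=> H.
have H' : h^-1 *: (f (h *: 1 + x) - f x) @[h --> 0^'] --> (l : R^o).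
  apply/cvgr_dnbhsP => u [u0 uc]; under eq_fun do rewrite [_ *: 1]mulr1.
  exact: H.
apply: DeriveDef; first by apply/cvg_ex; exists l.
exact: cvg_lim H'.
Qed.

Lemma is_derive_seqP f (x l : R) : is_derive x 1 f l ->
  forall h : nat -> R, (forall n, h n != 0) -> h n @[n --> \oo] --> 0 ->
    (h n)^-1 * (f (h n + x) - f x) @[n --> \oo] --> l.
Proof.
move=> [df fl] h h0 hc.
have H : h^-1 *: (f (h *: 1 + x) - f x) @[h --> 0^'] --> (l : R^o).
  by rewrite -fl; exact: df.
move/cvgr_dnbhsP : H => /(_ h (conj h0 hc)).
by under eq_fun do rewrite [_ *: 1]mulr1.
Qed.

Lemma is_derive_cont f (x l : R) : is_derive x 1 f l ->
  forall u : nat -> R, u n @[n --> \oo] --> x -> f (u n) @[n --> \oo] --> f x.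
Proof.
move=> [df _] u ux; apply: continuous_cvg ux.
exact/differentiable_continuous/derivable1_diffP.
Qed.

Definition cderR (c : R -> R[i]) (x : R) (l : R[i]) :=
  is_derive x 1 (fun t => re (c t)) (re l) /\
  is_derive x 1 (fun t => im (c t)) (im l).

Lemma cderR_seq c x l :
  (forall h : nat -> R, (forall n, h n != 0) -> h n @[n --> \oo] --> 0 ->
    (fun n => (h n)^-1%:C%C * (c (h n + x) - c x)) ~> l) -> cderR c x l.
Proof.
move=> H; split; apply: is_derive_seq => h h0 hc; have [Hr Hi] := H h h0 hc.
  by move: Hr; under eq_fun do rewrite reM reB mul0r subr0.
by move: Hi; under eq_fun do rewrite imM imB mul0r addr0.
Qed.

Lemma cderR_seqP c x l : cderR c x l ->
  forall h : nat -> R, (forall n, h n != 0) -> h n @[n --> \oo] --> 0 ->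
    (fun n => (h n)^-1%:C%C * (c (h n + x) - c x)) ~> l.
Proof.
move=> [dr di] h h0 hc; split.
  by under eq_fun do rewrite reM reB mul0r subr0; exact: is_derive_seqP.
by under eq_fun do rewrite imM imB mul0r addr0; exact: is_derive_seqP.
Qed.

Lemma cderR_cont c x l : cderR c x l ->
  forall u : nat -> R, u n @[n --> \oo] --> x -> (fun n => c (u n)) ~> c x.
Proof. by move=> [dr di] u ux; split; apply: is_derive_cont ux. Qed.

(** The first hypothesis says that c x is interior to U: sequences tending to
    c x are eventually in U. *)
Lemma cderR_comp (U : set R[i]) F c x (l k : R[i]) :
  (forall u : nat -> R[i], u ~> c x -> exists N, forall n, U (u (n + N)%N)) ->
  cder U F (c x) l -> cderR c x k -> cderR (fun t => F (c t)) x (l * k).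
Proof.
move=> oU dF dc; apply: cderR_seq => h h0 hc.
have hx : (h n + x) @[n --> \oo] --> x.
  by rewrite -[X in _ --> X]add0r; apply: cvgD => //; exact: cvg_cst.
have cx := cderR_cont dc hx.
have [N UN] := oU _ cx.
apply/(cvgC_shift N).
have [q ql Hq] := dF (fun n => c (h (n + N)%N + x)) UN (proj2 (cvgC_shift N _ _) cx).
apply: (cvgC_ext (u := fun n => q n * ((h (n + N)%N)^-1%:C%C * (c (h (n + N)%N + x) - c x)))).
  by move=> n /=; rewrite Hq; ring.
apply: cvgCM => //.
by apply: (proj2 (cvgC_shift N (fun n => (h n)^-1%:C%C * (c (h n + x) - c x)) _)); exact: cderR_seqP.
Qed.

Lemma cderR_affine (z w : R[i]) (x : R) : cderR (fun t => z + t%:C%C * w) x w.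
Proof.
apply: cderR_seq => h h0 hc; apply: (cvgC_ext (u := fun=> w)); last exact: cvgC_cst.
move=> n /=; have h0' : (h n)%:C%C != 0 :> R[i] by rewrite -normc_gt0 normc_real normr_gt0.
have -> : (h n)^-1%:C%C = (h n)%:C%C^-1 :> R[i] by rewrite fmorphV.
by rewrite rmorphD/=; field.
Qed.

Lemma cderRM c d x l k : cderR c x l -> cderR d x k ->
  cderR (fun t => c t * d t) x (l * d x + c x * k).
Proof.
move=> dc dd; apply: cderR_seq => h h0 hc.
have hx : (h n + x) @[n --> \oo] --> x.
  by rewrite -[X in _ --> X]add0r; apply: cvgD => //; exact: cvg_cst.
apply: (cvgC_ext (u := fun n => (h n)^-1%:C%C * (c (h n + x) - c x) * d (h n + x) +
   c x * ((h n)^-1%:C%C * (d (h n + x) - d x)))); first by move=> n /=; ring.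
apply: cvgCD; apply: cvgCM; try exact: cvgC_cst; try exact: cderR_seqP.
exact: (cderR_cont dd hx).
Qed.
End RealCurves.

Section Strip.
Context {R : realType}.
Implicit Types (F G : R[i] -> R[i]) (z w l k : R[i]) (rho : R).

(** These half-strips are convex neighbourhoods of the positive axis. A
    translation by a point of the Hankel contour of radius e maps the strip of
    width rho - e into the strip of width rho, so each integration costs e. *)
Definition strip rho : set R[i] := [set z | - rho < re z /\ `|im z| < rho].

Lemma cvg_lt_near (u : nat -> R) (l a : R) : u n @[n --> \oo] --> l -> l < a ->
  exists N, forall n, u (n + N)%N < a.
Proof.
move=> ul la; have [N _ HN] := cvgr_lt l ul _ la.
by exists N => n; apply: HN => /=; exact: leq_addl.
Qed.

Lemma strip_open rho z (u : nat -> R[i]) : strip rho z -> u ~> z ->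
  exists N, forall n, strip rho (u (n + N)%N).
Proof.
move=> [z1 z2] [ur ui].
have [N1 H1] : exists N, forall n, - re (u (n + N)%N) < rho.
  by apply: (@cvg_lt_near (fun n => - re (u n)) (- re z)); [exact: cvgN|lra].
have [N2 H2] := cvg_lt_near (cvg_norm ui) z2.
exists (N1 + N2)%N => n; split.
  by have := H1 (n + N2)%N; rewrite -addnA (addnC N2) => ?; lra.
by rewrite addnA; exact: H2.
Qed.

Lemma stripS rho rho' : rho' <= rho -> strip rho' `<=` strip rho.
Proof. by move=> h z [? ?]; split; [lra|exact: lt_le_trans h]. Qed.

Lemma strip_segment rho z w (t : R) : strip rho z -> strip rho w -> 0 <= t <= 1 ->
  strip rho (z + t%:C%C * (w - z)).
Proof.
move=> [z1 z2] [w1 w2] /andP[t0 t1].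
have rE : re (z + t%:C%C * (w - z)) = (1 - t) * re z + t * re w.
  by rewrite reD reM reB imB re_real im_real; ring.
have iE : im (z + t%:C%C * (w - z)) = (1 - t) * im z + t * im w.
  by rewrite imD imM reB imB re_real im_real; ring.
have conv (a x y : R) : a < x -> a < y -> a < (1 - t) * x + t * y.
  move=> ax ay; have h1 : 0 <= (1 - t) * (x - a) by apply: mulr_ge0; lra.
  have [tp|tn] := ltP 0 t; last by rewrite (_ : t = 0); lra.
  have h2 : 0 < t * (y - a) by apply: mulr_gt0; lra.
  by lra.
split; rewrite ?rE ?iE; first exact: conv.
move: z2 w2; rewrite !ltr_norml => /andP[? ?] /andP[? ?].
apply/andP; split; first exact: conv.
have : - rho < (1 - t) * (- im z) + t * (- im w) by apply: conv; lra.
lra.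
Qed.

(** The mean value theorem is applied to the real and imaginary parts, whence 2. *)
Lemma cder_mvt rho F F' (K : R) z w :
  (forall v, strip rho v -> cder (strip rho) F v (F' v)) ->
  strip rho z -> strip rho w ->
  (forall t : R, 0 <= t <= 1 -> normc (F' (z + t%:C%C * (w - z))) <= K) ->
  normc (F w - F z) <= 2 * K * normc (w - z).
Proof.
move=> dF sz sw bF.
pose c t := z + t%:C%C * (w - z).
have dc (t : R) : 0 <= t <= 1 -> cderR (fun t => F (c t)) t (F' (c t) * (w - z)).
  move=> t01; have sc := strip_segment sz sw t01.
  apply: (cderR_comp (U := strip rho)); last exact: cderR_affine.
    by move=> u; exact: strip_open.
  exact: dF.
have bd (t : R) : 0 <= t <= 1 -> normc (F' (c t) * (w - z)) <= K * normc (w - z).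
  by move=> t01; rewrite normcM ler_wpM2r ?normc_ge0// bF.
have mvt (p : R[i] -> R) (p_der : forall t : R, 0 <= t <= 1 ->
    is_derive t 1 (fun t => p (F (c t))) (p (F' (c t) * (w - z)))) :
    (forall y, `|p y| <= normc y) -> `|p (F w) - p (F z)| <= K * normc (w - z).
  move=> pn.
  have [||t t01] := @MVT_segment R (fun t => p (F (c t)))
     (fun t => p (F' (c t) * (w - z))) 0 1 ler01.
  - move=> t /[!in_itv]/= /andP[t0 t1]; apply: p_der; lra.
  - apply: derivable_within_continuous => t /[!in_itv]/= t01.
    by have := p_der t t01 => /@ex_derive.
  have -> : c 1 = w by rewrite /c mul1r addrC subrK.
  have -> : c 0 = z by rewrite /c mul0r addr0.
  rewrite subr0 mulr1 => ->; rewrite (le_trans (pn _))// bd//.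
have H1 : `|re (F w) - re (F z)| <= K * normc (w - z).
  by apply: mvt => [t t01|y]; [case: (dc t t01)|exact: ger_re_normc].
have H2 : `|im (F w) - im (F z)| <= K * normc (w - z).
  by apply: mvt => [t t01|y]; [case: (dc t t01)|exact: ger_im_normc].
by rewrite (le_trans (normc_le_sum _))// reB imB; lra.
Qed.

Lemma cvg_harmonicZ (a : R) : (a * n.+1%:R^-1 : R) @[n --> \oo] --> 0.
Proof.
rewrite -[X in _ --> X](mulr0 a); apply: cvgM; first exact: cvg_cst.
exact: cvg_harmonic.
Qed.

(** Compare both derivatives along a real sequence tending to z. *)
Lemma cder_uniq rho F z l k : strip rho z -> cder (strip rho) F z l ->
  cder (strip rho) F z k -> l = k.
Proof.
move=> sz dl dk.
pose u n : R[i] := z + (1 * n.+1%:R^-1)%:C%C.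
have uz : u ~> z.
  by rewrite -[X in _ ~> X]addr0; apply: cvgCD; [exact: cvgC_cst|exact/cvgC_real/cvg_harmonicZ].
have su n : strip rho (u n).
  case: sz => z1 z2; rewrite /u; split; last by rewrite imD im_real addr0.
  by rewrite reD re_real mul1r ltr_wpDr// invr_ge0.
have [q ql Hq] := dl u su uz; have [p pk Hp] := dk u su uz.
apply: cvgC_unique ql _; apply: cvgC_ext pk => n.
have nz : u n - z != 0.
  by rewrite /u addrC addKr -normc_gt0 normc_real mul1r normr_gt0 invr_eq0.
by apply: (mulIf nz); rewrite -Hq -Hp.
Qed.
End Strip.

(** * The fundamental theorem of calculus and parametric integrals *)

Section FTC.
Context {R : realType}.
Local Notation mu := (@lebesgue_measure R).
Implicit Types (F f : R -> R[i]) (a b : R).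

(** The derivative is assumed on an open set containing [a, b], so that
    one-sided derivatives at the end points need not be considered. *)
Lemma cFTC (O : set R) F f a b : a < b -> open O -> `[a, b]%classic `<=` O ->
  (forall x, O x -> cderR F x (f x)) -> seqcont O f ->
  cintegral `[a, b] f = F b - F a.
Proof.
move=> ab oO abO dF cf.
have key (P f0 : R -> R) : (forall x, O x -> is_derive x 1 P (f0 x)) ->
    {in O, continuous f0} -> \int[mu]_(x in `[a, b]) f0 x = P b - P a.
  move=> dP cf0; rewrite /Rintegral (@continuous_FTC2 _ f0 P)//.
  - apply: (@continuous_in_subspaceT _ _ `[a, b]%classic) => x /set_mem xab.
    by apply: cf0; rewrite inE; exact: abO.
  - have cP x : O x -> {for x, continuous P}.
      move=> Ox; apply/differentiable_continuous/derivable1_diffP.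
      by have := dP x Ox => /@ex_derive.
    split.
    + move=> x xab; have := dP x => /(_ (abO _ _))/@ex_derive; apply.
      exact: subset_itv_oo_cc xab.
    + apply: cvg_at_right_filter; apply: cP; apply: abO => /=.
      by rewrite in_itv/= lexx ltW.
    + apply: cvg_at_left_filter; apply: cP; apply: abO => /=.
      by rewrite in_itv/= lexx ltW.
  - move=> x xab; rewrite derive1E; have := dP x => /(_ (abO _ _))/@derive_val; apply.
    exact: subset_itv_oo_cc xab.
have cfr : {in O, continuous (fun x => re (f x))}.
  by apply: seq_continuous_in => // x u Ox Ou ux; case: (cf x u Ox Ou ux).
have cfi : {in O, continuous (fun x => im (f x))}.
  by apply: seq_continuous_in => // x u Ox Ou ux; case: (cf x u Ox Ou ux).
apply: complex_ext.
  rewrite reB; apply: (key (fun x => re (F x)) (fun x => re (f x))) => // x Ox.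
  by case: (dF x Ox).
rewrite imB; apply: (key (fun x => im (F x)) (fun x => im (f x))) => // x Ox.
by case: (dF x Ox).
Qed.

Lemma cintegral_obnd_cbnd (r : R) (b : itv_bound R) f :
  cintg [set` Interval (BRight r) b] f ->
  cintegral [set` Interval (BRight r) b] f = cintegral [set` Interval (BLeft r) b] f.
Proof.
by move=> [i1 i2]; apply: complex_ext; apply: Rintegral_itv_obnd_cbnd.
Qed.

Lemma cintegral_mkcondr D P f :
  cintegral (D `&` P) f = cintegral D (fun x => if x \in P then f x else 0).
Proof.
by apply: complex_ext; rewrite /= Rintegral_mkcondr; apply: eq_Rintegral => x _;
   rewrite patchE; case: ifP.
Qed.

Lemma cmeas_patch (D B : set R) (f : R -> R[i]) : measurable D -> measurable B ->
  cmeas (D `&` B) f -> cmeas D (fun x => if x \in B then f x else 0).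
Proof.
move=> mD mB [mr mi]; split.
  rewrite (_ : (fun x => _) = ((fun x => re (f x)) \_ B)); last first.
    by apply/funext => x; rewrite patchE; case: ifP.
  by apply/(measurable_restrict _ mB).
rewrite (_ : (fun x => _) = ((fun x => im (f x)) \_ B)); last first.
  by apply/funext => x; rewrite patchE; case: ifP.
by apply/(measurable_restrict _ mB).
Qed.

Lemma cintegralB D f g : measurable D -> cintg D f -> cintg D g ->
  cintegral D (fun x => f x - g x) = cintegral D f - cintegral D g.
Proof.
move=> mD [? ?] [? ?]; apply: complex_ext; rewrite ?reB ?imB /= -RintegralB//;
  by apply: eq_Rintegral => x _; rewrite ?reB ?imB.
Qed.

(** Apply cFTC on [a, a + n + 1] and let n tend to infinity by dominated
    convergence. *)
Lemma cFTCy (O : set R) F f a (k : R -> R) : open O -> `[a, +oo[%classic `<=` O ->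
  (forall x, O x -> cderR F x (f x)) -> seqcont O f ->
  mu.-integrable `]a, +oo[ (EFin \o k) -> (forall x, a < x -> normc (f x) <= k x) ->
  (fun n => F (a + n.+1%:R)) ~> 0 -> cintegral `]a, +oo[ f = - F a.
Proof.
move=> oO aO dF cf ik fk Foo.
have mf : cmeas O f by exact: seqcont_cmeas.
have mO : measurable O by exact: open_measurable.
have mA : measurable (`]a, +oo[%classic : set R) by exact: measurable_itv.
have aO' : `]a, +oo[%classic `<=` O.
  by move=> x /=; rewrite in_itv/= andbT => ax; apply: aO; rewrite /= in_itv/= andbT ltW.
have ax x : `]a, +oo[%classic x -> a < x by rewrite /= in_itv/= andbT.
have mfA : cmeas `]a, +oo[ f by exact: cmeasS mf.
pose B n : set R := `]-oo, a + n.+1%:R]%classic.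
have mB n : measurable (B n) by exact: measurable_itv.
have E n : cintegral `]a, +oo[ (fun x => if x \in B n then f x else 0) =
   F (a + n.+1%:R) - F a.
  rewrite -cintegral_mkcondr.
  have -> : `]a, +oo[%classic `&` B n = `]a, a + n.+1%:R]%classic.
    apply/seteqP; split => x; rewrite /B /= !in_itv/= ?andbT; first by move=> [-> ->].
    by move=> /andP[-> ->].
  have sub : `]a, a + n.+1%:R]%classic `<=` `]a, +oo[%classic.
    by move=> x /=; rewrite !in_itv/= => /andP[-> _].
  have i1 : cintg `]a, +oo[ f.
    by apply: (cintg_dom (k := k)) => // x /ax; exact: fk.
  rewrite cintegral_obnd_cbnd; last first.
    by apply: cintgS i1 => //; exact: measurable_itv.
  apply: (cFTC (O := O)) => //; first by rewrite ltrDl.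
  by move=> x /=; rewrite in_itv/= => /andP[h _]; apply: aO; rewrite /= in_itv/= h.
have H : (fun n => cintegral `]a, +oo[ (fun x => if x \in B n then f x else 0))
    ~> cintegral `]a, +oo[ f.
  apply: (cintegral_dct (k := k)) => //.
  - move=> n; apply: cmeas_patch => //; apply: cmeasS mA _ mfA; exact: subIsetl.
  - move=> x /ax xa; apply/(cvgC_shift (Num.truncn (x - a))).
    apply: (cvgC_ext (u := fun=> f x)); last exact: cvgC_cst.
    move=> n; rewrite mem_set//= /B /= in_itv/=.
    rewrite -lerBlDl (le_trans (ltW (truncnS_gt _)))// ler_nat ltnS leq_addl//.
  - move=> n x /ax xa; case: ifP => _; first exact: fk.
    by rewrite normc0 (le_trans (normc_ge0 _) (fk x xa)).
apply: cvgC_unique H _.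
apply: (cvgC_ext (u := fun n => F (a + n.+1%:R) - F a)) => [n|]; first by rewrite E.
by rewrite -[X in _ ~> X]add0r; apply: cvgCB => //; exact: cvgC_cst.
Qed.
End FTC.

Section ParametricIntegral.
Context {R : realType}.
Local Notation mu := (@lebesgue_measure R).

(** The difference quotients of the integrand are dominated by 2 k, by the mean
    value inequality, so the dominated convergence theorem applies to them. *)
Lemma cder_cintegral (D : set R) (rho : R) (f f' : R -> R[i] -> R[i]) (k : R -> R) :
  measurable D ->
  (forall x z, D x -> strip rho z -> cder (strip rho) (f x) z (f' x z)) ->
  (forall z, strip rho z -> cmeas D (f ^~ z)) ->
  (forall z, strip rho z -> cmeas D (f' ^~ z)) ->
  mu.-integrable D (EFin \o k) ->
  (forall x z, D x -> strip rho z -> normc (f x z) <= k x) ->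
  (forall x z, D x -> strip rho z -> normc (f' x z) <= k x) ->
  forall z, strip rho z ->
    cder (strip rho) (fun z => cintegral D (f ^~ z)) z (cintegral D (f' ^~ z)).
Proof.
move=> mD df mf mf' ik fk f'k z sz u su uz.
pose s n x := cslope (f x) (f' x z) z (u n).
have ms n : cmeas D (s n).
  rewrite /s /cslope; case: eqP => _; first exact: mf'.
  by apply: cmeasM (cmeas_cst _ _); apply: cmeasB; exact: mf.
have sk n x : D x -> normc (s n x) <= 2 * k x.
  move=> Dx; have k0 : 0 <= k x by rewrite (le_trans (normc_ge0 _) (fk x z Dx sz)).
  rewrite /s /cslope; case: eqP => [_|/eqP nz].
    by rewrite (le_trans (f'k x z Dx sz))//; lra.
  have nz' : 0 < normc (u n - z) by rewrite normc_gt0 subr_eq0.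
  rewrite normcM normcV ler_pdivrMr//.
  apply: (cder_mvt (rho := rho) (F' := f' x)) => //; first by move=> v sv; exact: df.
  by move=> t t01; apply: f'k => //; exact: strip_segment.
have ik2 : mu.-integrable D (EFin \o (fun x => 2 * k x)).
  rewrite (_ : EFin \o _ = (fun x => 2%:E * (EFin \o k) x)%E)//.
  exact: integrableZl.
exists (fun n => cintegral D (s n)).
  apply: (cintegral_dct (k := fun x => 2 * k x)) => //.
  by move=> x Dx; apply: cder_slope su uz; exact: df.
move=> n; rewrite -cintegralB//; last 2 first.
  by apply: (cintg_dom (k := k)) => //; [exact: mf|move=> x Dx; exact: fk].
  by apply: (cintg_dom (k := k)) => //; [exact: mf|move=> x Dx; exact: fk].
rewrite mulrC -cintegralZl//; last exact: cintg_dom mD (ms n) ik2 (sk n).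
by apply: eq_cintegral => x Dx; rewrite (cslopeE (f x) (f' x z)) mulrC.
Qed.
End ParametricIntegral.

(** * The exponential function *)

Section ComplexExp.
Context {R : realType}.
Local Notation mu := (@lebesgue_measure R).
Implicit Types (z w : R[i]).

Lemma cvgC_cexp (u : nat -> R[i]) z : u ~> z -> (fun n => cexp (u n)) ~> cexp z.
Proof.
move=> [ur ui]; split; rewrite /cexp /=; apply: cvgM.
- by apply: continuous_cvg ur; exact: continuous_expR.
- by apply: continuous_cvg ui; exact: continuous_cos.
- by apply: continuous_cvg ur; exact: continuous_expR.
- by apply: continuous_cvg ui; exact: continuous_sin.
Qed.

Lemma cderR_cexp (c : R -> R[i]) (x : R) (l : R[i]) : cderR c x l ->
  cderR (fun t => cexp (c t)) x (l * cexp (c x)).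
Proof.
move=> [dr di].
have de := is_derive1_comp (is_derive_expR (re (c x))) dr.
have dcos := is_derive1_comp (is_derive_cos (im (c x))) di.
have dsin := is_derive1_comp (is_derive_sin (im (c x))) di.
split.
- apply: (is_derive_eq (is_deriveM de dcos)).
  by rewrite reM /cexp /= /GRing.scale/=; ring.
- apply: (is_derive_eq (is_deriveM de dsin)).
  by rewrite imM /cexp /= /GRing.scale/=; ring.
Qed.

Lemma integrable_cst_itv (a b c : R) : mu.-integrable `[a, b] (EFin \o cst c).
Proof.
apply: continuous_compact_integrable; first exact: segment_compact.
by apply: continuous_subspaceT => x; exact: cst_continuous.
Qed.

Lemma Rintegral_cst_itv (a b c : R) : a < b ->
  \int[mu]_(x in `[a, b]) (cst c x) = c * (b - a).
Proof.
move=> ab; rewrite Rintegral_cst//; congr (_ * _).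
have /(congr1 fine) := @lebesgue_measure_itv R `[a, b].
by rewrite /= lte_fin ab.
Qed.

(** (cexp z - 1) / z as an average, which makes sense at z = 0. *)
Definition cexp_mean z : R[i] := cintegral `[0, 1] (fun t => cexp (t%:C%C * z)).

Lemma cvgC_comp_line (u : nat -> R) (x : R) z w : u n @[n --> \oo] --> x ->
  (fun n => z + (u n)%:C%C * w) ~> (z + x%:C%C * w).
Proof.
by move=> ux; apply: cvgCD (cvgC_cst _) _; apply: cvgCM (cvgC_cst _); exact: cvgC_real.
Qed.

Lemma seqcont_line D z w : seqcont D (fun t : R => cexp (z + t%:C%C * w)).
Proof. by move=> x u _ _ ux; apply: cvgC_cexp; exact: cvgC_comp_line. Qed.

Lemma cmeas_cexp_line D z : measurable D -> cmeas D (fun t : R => cexp (t%:C%C * z)).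
Proof.
move=> mD; apply: (@cmeasS _ _ setT) => //; apply: seqcont_cmeas; first exact: openT.
by have := @seqcont_line setT 0 z; under eq_fun do rewrite add0r.
Qed.

Lemma cexp_meanE z : cexp z - 1 = cexp_mean z * z.
Proof.
rewrite mulrC /cexp_mean -cintegralZl//; last first.
  apply: (cintg_dom (k := cst (expR `|re z|))) => //; last 2 first.
  - exact: integrable_cst_itv.
  - move=> x; rewrite /= in_itv/= => /andP[x0 x1]; rewrite normc_cexp ler_expR.
    rewrite reM re_real im_real mul0r subr0 (le_trans (ler_norm _))//.
    by rewrite normrM (ger0_norm x0) ler_piMl.
  exact: cmeas_cexp_line.
rewrite (@cFTC _ setT (fun t => cexp (0 + t%:C%C * z)) _ 0 1) ?ltr01//.
- by rewrite !add0r mul1r mul0r cexp0.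
- exact: openT.
- move=> x _; have := cderR_cexp (cderR_affine 0 z x).
  by rewrite add0r.
- move=> x u _ _ ux; apply: cvgCM (cvgC_cst _) _; apply: cvgC_cexp.
  by apply: cvgCM (cvgC_cst _); exact: cvgC_real.
Qed.

Lemma cvgC_cexp_mean (h : nat -> R[i]) : h ~> 0 -> (fun n => cexp_mean (h n)) ~> 1.
Proof.
move=> h0; have [N HN] : exists N, forall n, normc (h (n + N)%N) < 1.
  apply: (@cvg_lt_near _ (fun n => normc (h n)) 0 1) => //.
  by move/cvgC_normP: h0; under eq_fun do rewrite subr0.
apply/(cvgC_shift N).
have -> : 1 = cintegral `[0, 1] (fun=> (1 : R[i])).
  rewrite (@cFTC _ setT (fun t : R => 0 + t%:C%C * 1) _ 0 1) ?ltr01//.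
  - by rewrite !add0r !mulr1 subr0.
  - exact: openT.
  - by move=> x _; exact: cderR_affine.
  - by move=> x u _ _ _; exact: cvgC_cst.
apply: (cintegral_dct (k := cst (expR 1))) => //.
- by move=> n; exact: cmeas_cexp_line.
- exact: integrable_cst_itv.
- move=> x _; rewrite -[X in _ ~> X]cexp0; apply: cvgC_cexp.
  rewrite -(mulr0 x%:C%C); apply: cvgCM (cvgC_cst _) _.
  exact: (proj2 (cvgC_shift N h 0)).
- move=> n x; rewrite /= in_itv/= => /andP[x0 x1]; rewrite normc_cexp ler_expR.
  rewrite reM re_real im_real mul0r subr0 (le_trans (ler_norm _))//.
  rewrite normrM (ger0_norm x0) (le_trans (ler_piMl _ x1))//.
  by rewrite (le_trans (ger_re_normc _))// ltW.
Qed.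

Lemma cder_cexp U (z : R[i]) : cder U cexp z (cexp z).
Proof.
move=> u _ uz; exists (fun n => cexp z * cexp_mean (u n - z)).
  rewrite -[X in _ ~> X]mulr1; apply: cvgCM (cvgC_cst _) _; apply: cvgC_cexp_mean.
  by rewrite -(subrr z); exact: cvgCB (cvgC_cst _).
by move=> n; rewrite -mulrA -cexp_meanE mulrBr mulr1 -cexpD (addrC z) subrK.
Qed.

Lemma cder_cexpM U (a z : R[i]) : cder U (fun z => cexp (a * z)) z (a * cexp (a * z)).
Proof.
move=> u _ uz; have [||q ql Hq] := @cder_cexp setT (a * z) (fun n => a * u n) => //.
  exact: cvgCM (cvgC_cst _) _.
exists (fun n => a * q n); first exact: cvgCM (cvgC_cst _) _.
by move=> n; rewrite Hq; ring.
Qed.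
End ComplexExp.

(** * Smooth functions of exponential decay *)

Section DecayClass.
Context {R : realType}.
Local Notation mu := (@lebesgue_measure R).
Implicit Types (f g : R[i] -> R[i]) (al be : R).

(** Bounds of the form exp (al * re z): decay along the positive axis when al
    is negative. *)
Definition expbound al f :=
  exists M : R, forall z, strip 1 z -> normc (f z) <= M * expR (al * re z).

Fixpoint decays n al f : Prop := expbound al f /\
  if n is m.+1 then
    exists2 f', (forall z, strip 1 z -> cder (strip 1) f z (f' z)) & decays m al f'
  else True.

Lemma decays_bound n al f : decays n al f -> expbound al f.
Proof. by case: n => [[]|n []]. Qed.

Lemma decays_pred n al f : decays n.+1 al f -> decays n al f.
Proof.
elim: n f => [|n IH] f [bf [f' df Hf']]; split => //.
by exists f' => //; exact: IH.
Qed.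

Lemma expbound_ext al f g : (forall z, strip 1 z -> f z = g z) ->
  expbound al f -> expbound al g.
Proof. by move=> fg [M HM]; exists M => z sz; rewrite -fg// HM. Qed.

Lemma decays_ext n al f g : (forall z, strip 1 z -> f z = g z) ->
  decays n al f -> decays n al g.
Proof.
case: n => [|n] fg [bf] => [_|[f' df Hf']]; split => //; try exact: expbound_ext bf.
by exists f' => // z sz; apply: cder_ext (df z sz).
Qed.

Lemma expboundD al f g : expbound al f -> expbound al g ->
  expbound al (fun z => f z + g z).
Proof.
move=> [M HM] [N HN]; exists (M + N) => z sz.
by rewrite (le_trans (ler_normcD _ _))// mulrDl lerD ?HM ?HN.
Qed.

Lemma decaysD n al f g : decays n al f -> decays n al g ->
  decays n al (fun z => f z + g z).
Proof.
elim: n f g => [|n IH] f g; first by move=> [bf _] [bg _]; split => //; exact: expboundD.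
move=> [bf [f' df Hf']] [bg [g' dg Hg']]; split; first exact: expboundD.
exists (fun z => f' z + g' z); last exact: IH.
by move=> z sz; apply: cderD; [exact: df|exact: dg].
Qed.

Lemma expboundM al be f g : expbound al f -> expbound be g ->
  expbound (al + be) (fun z => f z * g z).
Proof.
move=> [M HM] [N HN]; exists (M * N) => z sz.
rewrite normcM mulrDl expRD mulrACA ler_pM ?normc_ge0 ?HM ?HN//.
Qed.

Lemma decaysM n al be f g : decays n al f -> decays n be g ->
  decays n (al + be) (fun z => f z * g z).
Proof.
elim: n f g => [|n IH] f g.
  by move=> [bf _] [bg _]; split => //; exact: expboundM.
move=> Hf Hg; case: (Hf) (Hg) => [bf [f' df Hf']] [bg [g' dg Hg']].
split; first exact: expboundM.
exists (fun z => f' z * g z + f z * g' z).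
  by move=> z sz; apply: cderM; [exact: df|exact: dg].
by apply: decaysD; apply: IH => //; exact: decays_pred.
Qed.

Lemma decaysN n al f : decays n al f -> decays n al (fun z => - f z).
Proof.
elim: n f => [|n IH] f [[M HM]] => [_|[f' df Hf']].
  by split => //; exists M => z sz; rewrite normc_opp HM.
split; first by exists M => z sz; rewrite normc_opp HM.
exists (fun z => - f' z); last exact: IH.
move=> z sz; have := cderZ (-1) (df z sz); rewrite mulN1r => h.
by apply: cder_ext h => // w _; rewrite mulN1r.
Qed.

(** The derivative of 1/f is - f' / f^2, whose exponent is twice that of 1/f.
    The induction therefore descends along al, al / 2, al / 4, ..., which is
    possible because the bound on 1/f holds for every positive exponent. *)
Lemma decays_inv n f : (forall z, strip 1 z -> f z != 0) ->
  (forall m, decays m 0 f) ->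
  (forall al, 0 < al <= 1 -> expbound al (fun z => (f z)^-1)) ->
  forall al, 0 < al <= 1 -> decays n al (fun z => (f z)^-1).
Proof.
move=> f0 df bi; elim: n => [|n IH] al al01; first by split => //; exact: bi.
split; first exact: bi.
have [_ [f' f'E Hf']] := df n.+1.
exists (fun z => - f' z * (f z)^-1 * (f z)^-1).
  by move=> z sz; apply: cderV => //; exact: f'E.
have -> : al = 0 + al / 2 + al / 2 by lra.
by apply: decaysM; [apply: decaysM; [exact: decaysN|]|]; apply: IH; lra.
Qed.

Definition smooth_decay al f := forall n, decays n al f.

Lemma smooth_decay_der al f : smooth_decay al f ->
  exists f', (forall z, strip 1 z -> cder (strip 1) f z (f' z)) /\
    smooth_decay al f'.
Proof.
move=> sf; have [_ [f' df _]] := sf 1%N; exists f'; split => // n.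
have [_ [g dg Hg]] := sf n.+1; apply: decays_ext Hg => z sz.
exact: cder_uniq (dg z sz) (df z sz).
Qed.

(** Choosing a derivative at each step yields a whole sequence of successive
    derivatives; it is chosen among smooth_decay functions, so that the next
    step is possible. *)
Lemma smooth_decay_jet al f : smooth_decay al f ->
  exists F : nat -> R[i] -> R[i], [/\ F 0%N = f,
    forall d z, strip 1 z -> cder (strip 1) (F d) z (F d.+1 z) &
    forall d, expbound al (F d)].
Proof.
move=> sf.
have ex (g : {g | smooth_decay al g}) : exists g' : {g | smooth_decay al g},
    forall z, strip 1 z -> cder (strip 1) (sval g) z (sval g' z).
  by case: g => g sg /=; have [g' [dg sg']] := smooth_decay_der sg; exists (exist _ g' sg').
have [next Hnext] := choice ex.
exists (fun d => sval (iter d next (exist _ f sf))); split => //.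
  by move=> d z sz; exact: Hnext.
by move=> d; case: (iter d _ _) => g sg /=; exact: (decays_bound (sg 0%N)).
Qed.
End DecayClass.

(** * The function z / (exp z - 1) *)

Section Bernoulli.
Context {R : realType}.
Local Notation mu := (@lebesgue_measure R).
Implicit Types (z w : R[i]).

(** expmean k is the k-th derivative of expmean 0, and expmean 0 z is
    (1 - exp (- z)) / z written so as to make sense at z = 0. *)
Definition expmean_kernel k (y : R) z : R[i] := (- y%:C%C) ^+ k * cexp (- y%:C%C * z).
Definition expmean k z : R[i] := cintegral `[0, 1] (fun y => expmean_kernel k y z).

Lemma expmean_kernel_le k (y : R) z : `[0, 1]%classic y -> strip 1 z ->
  normc (expmean_kernel k y z) <= expR 1.
Proof.
rewrite /= in_itv/= => /andP[y0 y1] [z1 _].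
rewrite normcM normcX normc_opp normc_real normc_cexp ger0_norm//.
rewrite -[leRHS]mul1r ler_pM ?exprn_ge0 ?expR_ge0 ?exprn_ile1// ler_expR.
by rewrite reM reN imN re_real im_real oppr0 mul0r subr0; nra.
Qed.

Lemma expmean_kernel_cmeas D k z : measurable D ->
  cmeas D (fun y => expmean_kernel k y z).
Proof.
move=> mD; apply: (@cmeasS _ _ setT) => //; apply: seqcont_cmeas; first exact: openT.
move=> y u _ _ uy.
have uN : (fun n => - (u n)%:C%C) ~> (- y%:C%C) by apply: cvgCN; exact: cvgC_real.
apply: cvgCM; last by apply: cvgC_cexp; exact: cvgCM (cvgC_cst _).
elim: k => [|k IH]; first exact: cvgC_cst.
by under eq_fun do rewrite exprS; rewrite exprS; exact: cvgCM.
Qed.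

Lemma cder_expmean k z : strip 1 z -> cder (strip 1) (expmean k) z (expmean k.+1 z).
Proof.
move=> sz; apply: (@cder_cintegral _ _ 1 (fun y z => expmean_kernel k y z)
   (fun y z => expmean_kernel k.+1 y z) (cst (expR 1))) => //.
- move=> y w _ _; rewrite /expmean_kernel exprSr -mulrA.
  by apply: cderZ; exact: cder_cexpM.
- by move=> w _; exact: expmean_kernel_cmeas.
- by move=> w _; exact: expmean_kernel_cmeas.
- exact: integrable_cst_itv.
- by move=> y w; exact: expmean_kernel_le.
- by move=> y w; exact: expmean_kernel_le.
Qed.

Lemma decays_expmean n k : decays n 0 (@expmean k).
Proof.
elim: n k => [|n IH] k.
  split => //; eexists => z sz; rewrite mul0r expR0 mulr1.
  apply: (cintegral_le (k := cst (expR 1))) => //.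
  - exact: expmean_kernel_cmeas.
  - exact: integrable_cst_itv.
  - by move=> y y01; exact: expmean_kernel_le.
split; first exact: (decays_bound (IH k)).
by exists (@expmean k.+1) => // z; exact: cder_expmean.
Qed.

Lemma expmean0E z : 1 - cexp (- z) = expmean 0 z * z.
Proof.
rewrite -(mulrC z) /expmean -cintegralZl//; last first.
  apply: (cintg_dom (k := cst (expR `|re z|))) => //; last 2 first.
  - exact: integrable_cst_itv.
  - move=> y; rewrite /= in_itv/= => /andP[y0 y1].
    rewrite /expmean_kernel expr0 mul1r normc_cexp ler_expR.
    rewrite reM reN imN re_real im_real oppr0 mul0r subr0 (le_trans (ler_norm _))//.
    by rewrite normrM normrN (ger0_norm y0) ler_piMl.
  exact: expmean_kernel_cmeas.
rewrite (@cFTC _ setT (fun t => - cexp (0 + t%:C%C * - z)) _ 0 1) ?ltr01//.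
- by rewrite !add0r mul1r mul0r cexp0 opprK addrC.
- exact: openT.
- move=> x _; have H := cderR_cexp (cderR_affine 0 (- z) x).
  have := cderRM (cderR_affine (-1) 0 x) H.
  under eq_fun do rewrite mulr0 addr0 mulN1r.
  congr (cderR _ _ _); rewrite /expmean_kernel expr0 add0r mulrN [- z * _]mulNr.
  by rewrite [- _ * z]mulNr; ring.
- move=> y u _ _ uy; apply: cvgCM (cvgC_cst _) _.
  rewrite /expmean_kernel expr0 mul1r; under eq_fun do rewrite expr0 mul1r.
  by apply: cvgC_cexp; apply: cvgCM (cvgC_cst _); apply: cvgCN; exact: cvgC_real.
Qed.

Lemma cos_ge_cos1 (x : R) : `|x| <= 1 -> cos 1 <= cos x.
Proof.
have pos (y : R) : 0 <= y <= 1 -> cos 1 <= cos y.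
  move=> /andP[y0 y1]; rewrite leNgt; apply/negP => h.
  have p2 := pi_ge2 R.
  by move: h; rewrite ltr_cos ?in_itv/=; lra.
move=> x1; have [x0|x0] := leP 0 x.
  by apply: pos; rewrite x0/=; rewrite ger0_norm in x1.
by rewrite -(cosN x); apply: pos; rewrite ltr0_norm in x1 => //; lra.
Qed.

(** For 0 <= y <= 1 and |Im z| < 1 the kernel has positive real part, at least
    cos 1 * exp (- y Re z). Keeping only y <= al gives a lower bound that is
    exp (- al Re z) up to a constant, for al as small as desired. *)
Lemma re_expmean0_ge (al : R) z : 0 < al <= 1 -> strip 1 z ->
  cos 1 * expR (- 1 - al * re z) * al <= re (expmean 0 z).
Proof.
move=> /andP[a0 a1] [z1 z2].
pose c := cos 1 * expR (- 1 - al * re z).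
have [i1 _] : cintg `[0, 1] (fun y => expmean_kernel 0 y z).
  apply: (cintg_dom (k := cst (expR 1))) => //.
  - exact: expmean_kernel_cmeas.
  - exact: integrable_cst_itv.
  - by move=> y y01; exact: expmean_kernel_le.
have I2 : `[0, 1]%classic `&` `[0, al]%classic = (`[0, al]%classic : set R).
  apply/seteqP; split => y /=; rewrite !in_itv/=; first by move=> [].
  by move=> /andP[y0 ya]; split; lra.
have E : \int[mu]_(y in `[0, 1]) ((cst c) \_ `[0, al]) y = c * al.
  by rewrite -Rintegral_mkcondr I2 Rintegral_cst_itv// subr0.
rewrite -/c -E; apply: le_Rintegral => //.
  rewrite -restrict_EFin; apply/(@integrable_restrict _ _ _ mu) => //.
  by rewrite I2; exact: integrable_cst_itv.
move=> y yD; have /andP[y0 y1] : 0 <= y <= 1 by move: yD; rewrite /= in_itv.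
have rE : re (expmean_kernel 0 y z) = expR (- y * re z) * cos (y * im z).
  rewrite /expmean_kernel expr0 mul1r.
  transitivity (expR (re (- y%:C%C * z)) * cos (im (- y%:C%C * z))) => //.
  rewrite reM imM reN imN re_real im_real oppr0 !mul0r subr0 addr0.
  by rewrite -[cos (y * _)]cosN !mulNr.
have cy : cos 1 <= cos (y * im z).
  by apply: cos_ge_cos1; rewrite normrM (ger0_norm y0); nra.
have c1 := cos1_gt0 R.
rewrite rE patchE; case: ifPn => [|_]; last by rewrite mulr_ge0 ?expR_ge0//; lra.
rewrite inE /= in_itv/= => /andP[_ ya].
rewrite mulrC ler_pM ?expR_ge0//; first lra.
by rewrite ler_expR; have [h|h] := leP 0 (re z); nra.
Qed.

Lemma expmean0_neq0 z : strip 1 z -> expmean 0 z != 0.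
Proof.
move=> sz; have := @re_expmean0_ge 1 z; rewrite ltr01 lexx => /(_ isT sz).
apply: contraTneq => ->; rewrite -ltNge !mulr_gt0 ?expR_gt0//; exact: cos1_gt0.
Qed.

Lemma expbound_expmean0V al : 0 < al <= 1 -> expbound al (fun z => (expmean 0 z)^-1).
Proof.
move=> a01; have /andP[a0 a1] := a01.
have c1 := cos1_gt0 R.
exists ((cos 1 * expR (-1) * al)^-1) => z sz.
rewrite normcV -[expR (al * _)]invrK -expRN -invfM lef_pV2 ?posrE; last 2 first.
- by rewrite normc_gt0 expmean0_neq0.
- by rewrite !mulr_gt0// expR_gt0.
rewrite (le_trans _ (ger_re_normc _))// (le_trans _ (ler_norm _))//.
rewrite (le_trans _ (re_expmean0_ge a01 sz))// expRD.
by rewrite mulrAC -!mulrA.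
Qed.

(** The function z / (exp z - 1), as exp (- z) divided by
    (1 - exp (- z)) / z in order to be defined at 0. *)
Definition bernoulli z : R[i] := cexp (- z) * (expmean 0 z)^-1.

Lemma bernoulliE z : strip 1 z -> z != 0 -> (cexp z - 1)^-1 = bernoulli z / z.
Proof.
move=> sz z0; have e0 := expmean0_neq0 sz; have c0 := cexp_neq0 z.
have -> : cexp z - 1 = cexp z * (expmean 0 z * z).
  by rewrite -expmean0E mulrBr mulr1 -cexpD subrr cexp0.
by rewrite /bernoulli cexpN !invfM; ring.
Qed.

(** exp (- z) has exponent -1 and 1 / expmean 0 has every positive exponent;
    1/2 is used for the latter. *)
Lemma smooth_decay_bernoulli : smooth_decay (- 2^-1) bernoulli.
Proof.
have expd n (c : R[i]) : decays n (-1) (fun z => c * cexp (- z)).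
  elim: n c => [|n IH] c; (split; first
    by exists (normc c) => z _; rewrite normcM normc_cexp reN mulN1r) => //.
  exists (fun z => - c * cexp (- z)) => // z _.
  have := cderZ c (@cder_cexpM R (strip 1) (-1) z).
  by under eq_fun do rewrite mulN1r; rewrite !mulN1r mulrN mulNr.
move=> n; have -> : - 2^-1 = -1 + 2^-1 :> R by lra.
apply: (@decays_ext _ _ _ (fun z => 1 * cexp (- z) * (expmean 0 z)^-1)).
  by move=> z _; rewrite mul1r.
apply: decaysM; first exact: expd.
apply: decays_inv; last by lra.
- exact: expmean0_neq0.
- by move=> m; exact: decays_expmean.
- exact: expbound_expmean0V.
Qed.
End Bernoulli.

(** * Integrals along the Hankel contour *)

Section ContourPieces.
Context {R : realType}.
Local Notation mu := (@lebesgue_measure R).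
Implicit Types (psi phi : R[i] -> R[i]) (z t : R[i]) (e del M : R).

Definition cont_on (U : set R[i]) psi := forall (t : R[i]) (u : nat -> R[i]), U t ->
  (forall n, U (u n)) -> u ~> t -> (fun n => psi (u n)) ~> psi t.

Definition bounded_on (U : set R[i]) del M psi :=
  forall t, U t -> normc (psi t) <= M * expR (- del * re t).

(** What the rays and the circle of the contour have in common: D is the
    domain of the parameter, inside an open set O where everything is
    continuous, and k dominates the integrands of functions of decay del. *)
Record piece (G : set R[i]) del (D O : set R) (tau kap : R -> R[i]) (k : R -> R) : Prop := {
  piece_meas : measurable D;
  piece_open : open O;
  piece_sub : D `<=` O;
  piece_in : forall x, O x -> G (tau x);
  piece_tau : seqcont O tau;
  piece_kap : seqcont O kap;
  piece_intg : mu.-integrable D (EFin \o k);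
  piece_le : forall x, D x -> normc (kap x) * expR (- del * re (tau x)) <= k x }.

(** The contribution to a contour integral of a piece parametrized by tau,
    where kap carries both t^(s - 1) and dt. *)
Definition pint (D : set R) (tau kap : R -> R[i]) psi :=
  cintegral D (fun x => psi (tau x) * kap x).

Lemma integrableZ_le (D : set R) (k : R -> R) M : measurable D ->
  mu.-integrable D (EFin \o k) -> mu.-integrable D (EFin \o (fun x => M * k x)).
Proof.
move=> mD ik; rewrite (_ : EFin \o _ = (fun x => M%:E * (EFin \o k) x)%E)//.
exact: integrableZl.
Qed.

Section OnePiece.
Variables (G : set R[i]) (del : R) (D O : set R) (tau kap : R -> R[i]) (k : R -> R).
Hypothesis P : piece G del D O tau kap k.

Lemma piece_cmeas psi : cont_on G psi -> cmeas D (fun x => psi (tau x) * kap x).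
Proof.
move=> cp; apply: (@cmeasS _ D O).
  by apply: open_measurable; exact: (piece_open P).
  exact: (piece_sub P).
apply: seqcont_cmeas; first exact: (piece_open P).
move=> x u Ox Ou ux; apply: cvgCM; last exact: (piece_kap P).
by apply: cp; [exact: (piece_in P)|move=> n; exact: (piece_in P)|exact: (piece_tau P)].
Qed.

Lemma piece_dom psi M x : bounded_on G del M psi -> D x ->
  normc (psi (tau x) * kap x) <= M * k x.
Proof.
move=> bp Dx; have Gx := piece_in P (piece_sub P Dx).
have M0 : 0 <= M.
  by rewrite -(pmulr_lge0 (x := expR (- del * re (tau x)))) ?expR_gt0// (le_trans (normc_ge0 _) (bp _ Gx)).
rewrite normcM (le_trans (ler_wpM2r (normc_ge0 _) (bp _ Gx)))//.
by rewrite -mulrA ler_wpM2l// mulrC (piece_le P).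
Qed.

Lemma piece_cintg psi M : cont_on G psi -> bounded_on G del M psi ->
  cintg D (fun x => psi (tau x) * kap x).
Proof.
move=> cp bp; apply: (cintg_dom (k := fun x => M * k x)).
- exact: piece_meas P.
- exact: piece_cmeas.
- by apply: integrableZ_le; [exact: piece_meas P|exact: piece_intg P].
- by move=> x Dx; exact: piece_dom.
Qed.

Lemma pint_le psi M : cont_on G psi -> bounded_on G del M psi ->
  normc (pint D tau kap psi) <= M * (2 * \int[mu]_(x in D) k x).
Proof.
move=> cp bp; have mD := piece_meas P.
have := cintegral_le mD (piece_cmeas cp) (integrableZ_le M mD (piece_intg P))
  (fun x Dx => piece_dom bp Dx).
by rewrite RintegralZl//; [rewrite mulrCA|exact: piece_intg P].
Qed.

Lemma pint_dct (psi_ : nat -> R[i] -> R[i]) psi M :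
  (forall n, cont_on G (psi_ n)) -> (forall n, bounded_on G del M (psi_ n)) ->
  (forall t, G t -> (fun n => psi_ n t) ~> psi t) ->
  (fun n => pint D tau kap (psi_ n)) ~> pint D tau kap psi.
Proof.
move=> cp bp pp; have mD := piece_meas P.
apply: (cintegral_dct (k := fun x => M * k x)) => //.
- by move=> n; exact: piece_cmeas.
- exact: integrableZ_le (piece_intg P).
- move=> x Dx; apply: cvgCM (cvgC_cst _); apply: pp; exact: (piece_in P (piece_sub P Dx)).
- by move=> n x Dx; exact: piece_dom.
Qed.

Lemma pintZ psi M c : cont_on G psi -> bounded_on G del M psi ->
  pint D tau kap (fun t => c * psi t) = c * pint D tau kap psi.
Proof.
move=> cp bp; rewrite /pint -cintegralZl; [|exact: piece_meas P|exact: piece_cintg bp].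
by apply: eq_cintegral => x _; rewrite mulrA.
Qed.

Lemma pintD psi phi M N : cont_on G psi -> bounded_on G del M psi ->
  cont_on G phi -> bounded_on G del N phi ->
  pint D tau kap (fun t => psi t + phi t) = pint D tau kap psi + pint D tau kap phi.
Proof.
move=> cp bp cq bq.
rewrite /pint -cintegralD; [|exact: piece_meas P|exact: piece_cintg bp|exact: piece_cintg bq].
by apply: eq_cintegral => x _; rewrite mulrDl.
Qed.
End OnePiece.

Definition cont2_on (G : set R[i]) (Psi : R[i] -> R[i] -> R[i]) :=
  forall (t s : R[i]) (u v : nat -> R[i]), G t -> G s ->
  (forall n, G (u n)) -> (forall n, G (v n)) -> u ~> t -> v ~> s ->
  (fun n => Psi (u n) (v n)) ~> Psi t s.

Lemma pint_fubini (G : set R[i]) del D O tau kap k D' O' tau' kap' k'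
    (Psi : R[i] -> R[i] -> R[i]) M :
  piece G del D O tau kap k -> piece G del D' O' tau' kap' k' ->
  cont2_on G Psi ->
  (forall t s, G t -> G s ->
    normc (Psi t s) <= M * expR (- del * re t) * expR (- del * re s)) ->
  pint D tau kap (fun t => pint D' tau' kap' (Psi t)) =
  pint D' tau' kap' (fun s => pint D tau kap (Psi ^~ s)).
Proof.
move=> P P' cP bP.
have mD := piece_meas P; have mD' := piece_meas P'.
have oO := piece_open P; have oO' := piece_open P'.
pose f x y := Psi (tau x) (tau' y) * kap x * kap' y.
have inG x : D x -> G (tau x) by move=> Dx; exact: (piece_in P (piece_sub P Dx)).
have inG' x : D' x -> G (tau' x) by move=> Dx; exact: (piece_in P' (piece_sub P' Dx)).
have cP1 t : G t -> cont_on G (Psi t).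
  by move=> Gt s u Gs Gu us; apply: (cP t s (fun=> t) u) => //; exact: cvgC_cst.
have cP2 s : G s -> cont_on G (Psi ^~ s).
  by move=> Gs t u Gt Gu ut; apply: (cP t s u (fun=> s)) => //; exact: cvgC_cst.
have bP1 t : G t -> bounded_on G del (M * expR (- del * re t)) (Psi t).
  by move=> Gt s Gs; exact: bP.
have bP2 s : G s -> bounded_on G del (M * expR (- del * re s)) (Psi ^~ s).
  by move=> Gs t Gt; rewrite mulrAC; exact: bP.
have e1 : pint D tau kap (fun t => pint D' tau' kap' (Psi t)) =
    cintegral D (fun x => cintegral D' (f x)).
  apply: eq_cintegral => x Dx; rewrite mulrC -cintegralZl//.
    by apply: eq_cintegral => y _; rewrite /f mulrA; congr (_ * _); rewrite mulrC.
  by apply: (piece_cintg P' (cP1 _ _) (bP1 _ _)); exact: inG.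
have e2 : pint D' tau' kap' (fun s => pint D tau kap (Psi ^~ s)) =
    cintegral D' (fun y => cintegral D (f ^~ y)).
  apply: eq_cintegral => y Dy; rewrite mulrC -cintegralZl//.
    by apply: eq_cintegral => x _; rewrite /f mulrC.
  by apply: (piece_cintg P (cP2 _ _) (bP2 _ _)); exact: inG'.
rewrite e1 e2.
have sc : seqcont2 O O' f.
  move=> x y u v Ox Oy Ou Ov ux vy; apply: cvgCM; last exact: (piece_kap P').
  apply: cvgCM; last exact: (piece_kap P).
  apply: cP => //; try (by [exact: (piece_in P)|exact: (piece_in P')]);
    try by move=> n; first [exact: (piece_in P)|exact: (piece_in P')].
    exact: (piece_tau P).
  exact: (piece_tau P').
have [m1 m2] := seqcont2_measurable oO oO' sc.
have sub2 : D `*` D' `<=` O `*` O'.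
  by move=> [x y] [/= Dx Dy]; split => /=; [exact: (piece_sub P)|exact: (piece_sub P')].
have mOO : measurable (O `*` O') by apply: measurableX; exact: open_measurable.
apply: (cintegral_fubini (k1 := fun x => M * k x) (k2 := k')) => //.
- exact: measurable_funS mOO sub2 m1.
- exact: measurable_funS mOO sub2 m2.
- exact: integrableZ_le (piece_intg P).
- exact: piece_intg P'.
- move=> x y Dx Dy; rewrite /f normcM.
  have := piece_dom P' (bP1 _ (inG _ Dx)) Dy.
  rewrite normcM => h1.
  have M0 : 0 <= M.
    have := le_trans (normc_ge0 _) (bP _ _ (inG _ Dx) (inG' _ Dy)).
    by rewrite -mulrA pmulr_lge0// mulr_gt0 ?expR_gt0.
  have k'0 : 0 <= k' y.
    by rewrite (le_trans _ (piece_le P' Dy))// mulr_ge0 ?normc_ge0 ?expR_ge0.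
  rewrite normcM mulrAC (le_trans (ler_wpM2r (normc_ge0 _) h1))//.
  rewrite -!mulrA ler_wpM2l// mulrCA mulrC ler_wpM2r//.
  by rewrite mulrC (piece_le P).
- move=> x Dx; apply: (cmeasS (E := O')); first exact: open_measurable.
    exact: (piece_sub P').
  apply: seqcont_cmeas => // y u Oy Ou uy; apply: (sc x y (fun=> x) u) => //.
  + exact: (piece_sub P).
  + by move=> _; exact: (piece_sub P).
  + exact: cvg_cst.
- move=> y Dy; apply: (cmeasS (E := O)); first exact: open_measurable.
    exact: (piece_sub P).
  apply: seqcont_cmeas => // x u Ox Ou ux; apply: (sc x y u (fun=> y)) => //.
  + exact: (piece_sub P').
  + by move=> _; exact: (piece_sub P').
  + exact: cvg_cst.
Qed.
End ContourPieces.

Section Hankel.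
Context {R : realType}.
Local Notation mu := (@lebesgue_measure R).
Implicit Types (psi phi : R[i] -> R[i]) (z t s : R[i]) (e del M : R).

Lemma is_derive_scale (c x l : R) (f : R -> R) : is_derive x 1 f l ->
  is_derive x 1 (fun y => c * f y) (c * l).
Proof.
move=> df; apply: (is_derive_eq (is_deriveM (is_derive_cst c x 1) df)).
by rewrite /GRing.scale/= mulr0 addr0.
Qed.

Lemma is_derive_expR_scale (c x : R) :
  is_derive x 1 (fun x => expR (c * x)) (c * expR (c * x)).
Proof.
have d1 := is_derive_scale c (is_derive_id x (1 : R)).
apply: (is_derive_eq (is_derive1_comp (is_derive_expR (c * x)) d1)).
by rewrite mulr1 mulrC.
Qed.

Lemma integrable_expR_tail (c : R) : 0 < c ->
  mu.-integrable `]0, +oo[ (EFin \o (fun x => expR (- c * x))).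
Proof.
move=> c0.
have cE : continuous (fun x : R => expR (- c * x)).
  move=> x; apply: continuous_comp; last exact: continuous_expR.
  by apply: cvgM; [exact: cvg_cst|exact: cvg_id].
have dE (x : R) : is_derive x 1 (fun x : R => - c^-1 * expR (- c * x)) (expR (- c * x)).
  apply: (is_derive_eq (is_derive_scale (- c^-1) (is_derive_expR_scale (- c) x))).
  by field; rewrite lt0r_neq0.
apply/integrableP; split.
  apply/measurable_EFinP; apply: (@measurable_funS _ _ _ _ setT) => //.
  exact: continuous_measurable_fun.
under eq_integral do rewrite /= ger0_norm ?expR_ge0//.
rewrite integral_itv_obnd_cbnd; last first.
  apply/measurable_EFinP; apply: (@measurable_funS _ _ _ _ setT) => //.
  exact: continuous_measurable_fun.
rewrite (@ge0_continuous_FTC2y R _ (fun x => - c^-1 * expR (- c * x)) 0 0) ?ltry//.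
- exact: continuous_subspaceT.
- rewrite -[X in _ --> X](mulr0 (- c^-1)); apply: cvgM; first exact: cvg_cst.
  have -> : (fun x : R => expR (- c * x)) = (fun x => expR (- x)) \o (fun x => c * x).
    by apply/funext => x /=; rewrite mulNr.
  by apply: cvg_comp; [exact: gt0_cvgMry|exact: cvgr_expR].
- apply: cvg_at_right_filter; apply: cvgM; first exact: cvg_cst.
  exact: cE.
- by move=> x _; rewrite derive1E; have [] := dE x.
Qed.

Lemma integrable_expR_ray (c e : R) : 0 < c -> 0 < e ->
  mu.-integrable `]e, +oo[ (EFin \o (fun x => expR (- c * x))).
Proof.
move=> c0 e0.
apply: (@integrableS _ _ _ mu `]0, +oo[%classic) => //.
  by move=> x /=; rewrite !in_itv/= !andbT; exact: lt_trans.
exact: integrable_expR_tail.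
Qed.

(** From ln y <= y - 1 at y = eta x / p: a power of x is dominated by any
    exponential, uniformly down to x = 0 when p >= 0. *)
Lemma expR_ln_bound0 (p eta : R) : 0 <= p -> 0 < eta ->
  exists2 C : R, 0 <= C & forall x : R, 0 < x -> expR (p * ln x) <= C * expR (eta * x).
Proof.
move=> p0 eta0; have [->|pn0] := eqVneq p 0.
  exists 1 => // x x0; rewrite mul0r mul1r ler_expR mulr_ge0//; exact: ltW.
have pp : 0 < p by rewrite lt_neqAle eq_sym pn0.
exists (expR (- p - p * ln (eta / p))) => [|x x0]; first exact: expR_ge0.
have ep : 0 < eta / p by rewrite divr_gt0.
rewrite -expRD ler_expR.
have h : ln (eta / p * x) <= eta / p * x - 1.
  have y0 : 0 < eta / p * x by rewrite mulr_gt0.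
  have := expR_ge1Dx (ln (eta / p * x)); rewrite lnK ?posrE//; lra.
rewrite lnM ?posrE// in h.
have := ler_wpM2l p0 h; rewrite mulrBr mulrDr mulr1.
have -> : p * (eta / p * x) = eta * x by field.
lra.
Qed.

(** A negative power of x is bounded away from 0. *)
Lemma expR_ln_bound (p eta e : R) : 0 < e -> 0 < eta ->
  exists2 C : R, 0 <= C & forall x : R, e < x -> expR (p * ln x) <= C * expR (eta * x).
Proof.
move=> e0 eta0; have [p0|p0] := leP 0 p.
  have [C C0 HC] := expR_ln_bound0 p0 eta0; exists C => // x ex.
  by apply: HC; exact: lt_trans ex.
exists (expR (p * ln e)) => [|x ex]; first exact: expR_ge0.
have x0 : 0 < x by exact: lt_trans ex.
rewrite -[leLHS]mulr1 ler_pM ?expR_ge0//; last first.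
  by rewrite -expR0 ler_expR mulr_ge0// ltW.
rewrite ler_expR ler_wnM2l//; first exact: ltW.
by rewrite ler_ln ?posrE// ltW.
Qed.

Definition arc e (th : R) : R[i] := e%:C%C * cexp (0 +i* th)%C.

Definition contour e : set R[i] :=
  [set t | (exists2 x : R, e < x & t = x%:C%C) \/ exists th, t = arc e th].

(** t^(s - 1) on the positive axis, and t^(s - 1) dt on the circle of radius e,
    with arg t = th. *)
Definition ray_kernel s (x : R) : R[i] := cexp ((s - 1) * (ln x)%:C%C).
Definition arc_kernel e s (th : R) : R[i] :=
  cexp ((s - 1) * (ln e +i* th)%C) * ((0 +i* e)%C * cexp (0 +i* th)%C).

Lemma contour_ray e (x : R) : e < x -> contour e x%:C%C.
Proof. by move=> ex; left; exists x. Qed.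
Lemma contour_arc e (th : R) : contour e (arc e th).
Proof. by right; exists th. Qed.

Lemma normc_arc e th : 0 < e -> normc (arc e th) = e.
Proof. by move=> e0; rewrite normcM normc_real normc_cexp expR0 mulr1 gtr0_norm. Qed.

Lemma contour_re_im e t : 0 < e -> contour e t -> - e <= re t /\ `|im t| <= e.
Proof.
move=> e0 [[x ex ->]|[th ->]].
  by rewrite re_real im_real normr0; split; lra.
split; last by rewrite (le_trans (ger_im_normc _))// normc_arc.
by have := ger_re_normc (arc e th); rewrite normc_arc// ler_norml => /andP[].
Qed.

Lemma seqcont_cexp_im D (a : R) : seqcont D (fun th : R => cexp (a +i* th)%C).
Proof. by move=> x u _ _ ux; apply: cvgC_cexp; split => //; exact: cvg_cst. Qed.

Lemma normc_ray_kernel s (x : R) :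
  normc (ray_kernel s x) = expR ((re s - 1) * ln x).
Proof. by rewrite normc_cexp reM reB re_real im_real mulr0 subr0. Qed.

Lemma ray_kernel_seqcont e s : 0 <= e -> seqcont `]e, +oo[ (ray_kernel s).
Proof.
move=> e0 x u; rewrite /= in_itv/= andbT => ex Du ux.
apply: cvgC_cexp; apply: cvgCM (cvgC_cst _) _; apply: cvgC_real.
by apply: continuous_cvg ux; apply: continuous_ln; exact: le_lt_trans ex.
Qed.

Lemma ray_piece e del s : 0 < e -> 0 < del -> exists k,
  piece (contour e) del `]e, +oo[ `]e, +oo[ (fun x => x%:C%C) (ray_kernel s) k.
Proof.
move=> e0 d0.
have d20 : 0 < del / 2 by lra.
have [C C0 HC] := expR_ln_bound (re s - 1) e0 d20.
have inD (x : R) : `]e, +oo[%classic x -> e < x by rewrite /= in_itv/= andbT.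
exists (fun x => C * expR (- (del / 2) * x)); split => //.
- by move=> x /inD ex; exact: contour_ray.
- by move=> x u _ _; exact: cvgC_real.
- by apply: ray_kernel_seqcont; exact: ltW.
- by apply: integrableZ_le => //; exact: integrable_expR_ray.
- move=> x /inD ex; rewrite normc_ray_kernel re_real.
  rewrite (le_trans (ler_wpM2r (expR_ge0 _) (HC x ex)))// -(mulrA C) ler_wpM2l//.
  by rewrite -expRD ler_expR; lra.
Qed.

Lemma normc_arc_kernel_le e s th : 0 < e -> `[0, 2 * pi]%classic th ->
  normc (arc_kernel e s th) <= expR (re s * ln e) * expR (`|im s| * (2 * pi)).
Proof.
move=> e0; rewrite /= in_itv/= => /andP[t0 t1].
have -> : normc (arc_kernel e s th) = expR (re ((s - 1) * (ln e +i* th)%C)) * e.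
  rewrite /arc_kernel !normcM !normc_cexp [re (0 +i* th)%C]/= expR0 mulr1.
  by rewrite normcE0/= expr0n add0r sqrtr_sqr gtr0_norm.
rewrite -[X in _ * X <= _](@lnK R)// -!expRD ler_expR reM reB imB/= subr0.
have := ler_norm (- im s * th); rewrite normrM normrN (ger0_norm t0).
have := ler_wpM2l (normr_ge0 (im s)) t1.
lra.
Qed.

Lemma arc_piece e del s : 0 < e -> 0 < del ->
  piece (contour e) del `[0, 2 * pi] setT (arc e) (arc_kernel e s)
    (cst (expR (re s * ln e) * expR (`|im s| * (2 * pi)) * expR (del * e))).
Proof.
move=> e0 d0; split => //.
- exact: openT.
- by move=> x _; exact: contour_arc.
- move=> x u Dx Du ux; apply: cvgCM (cvgC_cst _) _; exact: seqcont_cexp_im ux.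
- move=> x u Dx Du ux; apply: cvgCM.
    apply: cvgC_cexp; apply: cvgCM (cvgC_cst _) _.
    by split => //; exact: cvg_cst.
  by apply: cvgCM (cvgC_cst _) _; exact: seqcont_cexp_im ux.
- exact: integrable_cst_itv.
- move=> th th0; rewrite ler_pM ?normc_ge0 ?expR_ge0 ?normc_arc_kernel_le// ler_expR.
  have : `|re (arc e th)| <= e by rewrite (le_trans (ger_re_normc _))// normc_arc.
  by rewrite ler_norml => /andP[h _]; nra.
Qed.

(** The Hankel integral of psi (t) t^(s - 1) dt. *)
Definition hkf e s psi : R[i] :=
  hankel e (fun w => psi (cexp w) * cexp ((s - 1) * w)).

(** Along the returning ray arg t = 2 pi, and t^(s - 1) is multiplied by
    exp (2 i pi s). *)
Definition monodromy s : R[i] := cexp ((0 +i* (2 * pi))%C * s) - 1.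

Lemma cexp_2pi : cexp (0 +i* (2 * pi))%C = 1 :> R[i].
Proof.
apply: complex_ext; rewrite /cexp/= expR0 mul1r mulr_natl.
  by rewrite cos2pi.
by rewrite sin2pi.
Qed.

Lemma cexp_lnC (x y : R) : 0 < x -> cexp (ln x +i* y)%C = x%:C%C * cexp (0 +i* y)%C.
Proof.
move=> x0; have -> : (ln x +i* y)%C = (ln x)%:C%C + (0 +i* y)%C.
  by apply: complex_ext; rewrite ?reD ?imD /= ?addr0 ?add0r.
by rewrite cexpD cexp_real lnK.
Qed.

(** The two rays carry the same function up to the monodromy factor, whence
    (exp (2 i pi s) - 1) times one ray, plus the circle. *)
Lemma hkfE e del s psi M : 0 < e -> 0 < del -> cont_on (contour e) psi ->
  bounded_on (contour e) del M psi ->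
  hkf e s psi = monodromy s * pint `]e, +oo[ (fun x => x%:C%C) (ray_kernel s) psi
    + pint `[0, 2 * pi] (arc e) (arc_kernel e s) psi.
Proof.
move=> e0 d0 cp bp.
have [k P] := ray_piece s e0 d0.
have inD (x : R) : `]e, +oo[%classic x -> 0 < x.
  by rewrite /= in_itv/= andbT; exact: lt_trans.
have e1 : cintegral `]e, +oo[ (fun x => psi (cexp (ln x +i* 0)%C) *
    cexp ((s - 1) * (ln x +i* 0)%C)) = pint `]e, +oo[ (fun x => x%:C%C) (ray_kernel s) psi.
  apply: eq_cintegral => x /inD x0.
  by rewrite cexp_lnC// complexr0 cexp0 mulr1.
have e2 : cintegral `[0, 2 * pi] (fun th => psi (cexp (ln e +i* th)%C) *
    cexp ((s - 1) * (ln e +i* th)%C) * ((0 +i* e)%C * cexp (0 +i* th)%C)) =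
    pint `[0, 2 * pi] (arc e) (arc_kernel e s) psi.
  by apply: eq_cintegral => th _; rewrite -mulrA cexp_lnC.
have e3 : cintegral `]e, +oo[ (fun x => psi (cexp (ln x +i* (2 * pi))%C) *
    cexp ((s - 1) * (ln x +i* (2 * pi))%C)) = cexp ((0 +i* (2 * pi))%C * s) *
    pint `]e, +oo[ (fun x => x%:C%C) (ray_kernel s) psi.
  rewrite -cintegralZl//; last exact: (piece_cintg P cp bp).
  apply: eq_cintegral => x /inD x0; rewrite cexp_lnC// cexp_2pi mulr1.
  rewrite mulrCA; congr (_ * _); rewrite /ray_kernel.
  have -> : (ln x +i* (2 * pi))%C = (ln x)%:C%C + (0 +i* (2 * pi))%C.
    by apply: complex_ext; rewrite ?reD ?imD /= ?addr0 ?add0r.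
  rewrite mulrDr cexpD mulrC; congr (_ * _).
  by rewrite mulrC mulrBr mulr1 cexpD cexpN cexp_2pi invr1 mulr1.
rewrite /hkf /hankel e1 e2 e3 /monodromy; ring.
Qed.
End Hankel.

Section HankelFunctional.
Context {R : realType}.
Local Notation mu := (@lebesgue_measure R).
Implicit Types (psi phi : R[i] -> R[i]) (z t s : R[i]) (e del M : R).

Lemma contour_gt0_ray e (x : R) : `]e, +oo[%classic x -> e < x.
Proof. by rewrite /= in_itv/= andbT. Qed.

Lemma hkf_ext e s psi phi : 0 < e -> (forall t, contour e t -> psi t = phi t) ->
  hkf e s psi = hkf e s phi.
Proof.
move=> e0 H; rewrite /hkf /hankel; congr (- _ + _ + _); apply: eq_cintegral.
- move=> x /contour_gt0_ray ex; rewrite H// cexp_lnC ?(lt_trans e0)//.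
  by rewrite complexr0 cexp0 mulr1; exact: contour_ray.
- by move=> th _; rewrite H// cexp_lnC//; exact: contour_arc.
- move=> x /contour_gt0_ray ex; rewrite H// cexp_lnC ?(lt_trans e0)//.
  by rewrite cexp_2pi mulr1; exact: contour_ray.
Qed.

Section FixedRadius.
Variables (e del : R).
Hypotheses (e0 : 0 < e) (d0 : 0 < del).

Lemma hkf_le s : exists2 C : R, 0 <= C & forall psi M, cont_on (contour e) psi ->
  bounded_on (contour e) del M psi -> normc (hkf e s psi) <= M * C.
Proof.
have [k P] := ray_piece s e0 d0; have P' := arc_piece s e0 d0.
set k' := cst _ in P'.
pose I1 := \int[mu]_(x in `]e, +oo[) k x; pose I2 := \int[mu]_(x in `[0, 2 * pi]) k' x.
have I10 : 0 <= I1.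
  by apply: Rintegral_ge0 => x /(piece_le P); apply: le_trans; rewrite mulr_ge0 ?normc_ge0 ?expR_ge0.
have I20 : 0 <= I2.
  by apply: Rintegral_ge0 => x /(piece_le P'); apply: le_trans; rewrite mulr_ge0 ?normc_ge0 ?expR_ge0.
exists (normc (monodromy s) * (2 * I1) + 2 * I2).
  by rewrite addr_ge0 ?mulr_ge0// normc_ge0.
move=> psi M cp bp; rewrite (hkfE s e0 d0 cp bp) (le_trans (ler_normcD _ _))//.
rewrite (mulrDr M) lerD//; last exact: (pint_le P' cp bp).
by rewrite normcM mulrCA ler_wpM2l ?normc_ge0//; exact: (pint_le P cp bp).
Qed.

Lemma hkf_dct s (psi_ : nat -> R[i] -> R[i]) psi M :
  (forall n, cont_on (contour e) (psi_ n)) ->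
  (forall n, bounded_on (contour e) del M (psi_ n)) ->
  cont_on (contour e) psi -> bounded_on (contour e) del M psi ->
  (forall t, contour e t -> (fun n => psi_ n t) ~> psi t) ->
  (fun n => hkf e s (psi_ n)) ~> hkf e s psi.
Proof.
move=> cp bp cpsi bpsi pp.
have [k P] := ray_piece s e0 d0; have P' := arc_piece s e0 d0.
under eq_fun do rewrite (hkfE s e0 d0 (cp _) (bp _)).
rewrite (hkfE s e0 d0 cpsi bpsi); apply: cvgCD; last exact: pint_dct P' _ _ _ cp bp pp.
by apply: cvgCM (cvgC_cst _) _; exact: (pint_dct P cp bp pp).
Qed.

Lemma cont_onZ (U : set R[i]) psi c : cont_on U psi -> cont_on U (fun t => c * psi t).
Proof. by move=> cp t u Ut Uu ut; apply: cvgCM (cvgC_cst _) _; exact: cp. Qed.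

Lemma cont_onD (U : set R[i]) psi phi : cont_on U psi -> cont_on U phi ->
  cont_on U (fun t => psi t + phi t).
Proof. by move=> cp cq t u Ut Uu ut; apply: cvgCD; [exact: cp|exact: cq]. Qed.

Lemma cont_onM (U : set R[i]) psi phi : cont_on U psi -> cont_on U phi ->
  cont_on U (fun t => psi t * phi t).
Proof. by move=> cp cq t u Ut Uu ut; apply: cvgCM; [exact: cp|exact: cq]. Qed.

Lemma bounded_onZ (U : set R[i]) M psi c : bounded_on U del M psi ->
  bounded_on U del (normc c * M) (fun t => c * psi t).
Proof. by move=> bp t Ut; rewrite normcM -mulrA ler_wpM2l ?normc_ge0// bp. Qed.

Lemma bounded_onD (U : set R[i]) M N psi phi : bounded_on U del M psi ->
  bounded_on U del N phi -> bounded_on U del (M + N) (fun t => psi t + phi t).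
Proof.
by move=> bp bq t Ut; rewrite (le_trans (ler_normcD _ _))// mulrDl lerD ?bp ?bq.
Qed.

Lemma hkfZ s psi M c : cont_on (contour e) psi -> bounded_on (contour e) del M psi ->
  hkf e s (fun t => c * psi t) = c * hkf e s psi.
Proof.
move=> cp bp.
have [k P] := ray_piece s e0 d0; have P' := arc_piece s e0 d0.
rewrite (hkfE s e0 d0 cp bp) (hkfE s e0 d0 (cont_onZ c cp) (bounded_onZ c bp)).
by rewrite (pintZ P _ cp bp) (pintZ P' _ cp bp); ring.
Qed.

(** Expanding both Hankel integrals by hkfE gives four double integrals over
    pairs of pieces, to each of which Fubini applies. *)
Lemma hkf_fubini s s' (Psi : R[i] -> R[i] -> R[i]) M :
  cont2_on (contour e) Psi ->
  (forall t t', contour e t -> contour e t' ->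
    normc (Psi t t') <= M * expR (- del * re t) * expR (- del * re t')) ->
  hkf e s (fun t => hkf e s' (Psi t)) = hkf e s' (fun t' => hkf e s (Psi ^~ t')).
Proof.
have main a b Psi' N : cont2_on (contour e) Psi' ->
  (forall t t', contour e t -> contour e t' ->
    normc (Psi' t t') <= N * expR (- del * re t) * expR (- del * re t')) ->
   hkf e a (fun t => hkf e b (Psi' t)) =
   monodromy a * monodromy b * pint `]e, +oo[ (fun x => x%:C%C) (ray_kernel a)
     (fun t => pint `]e, +oo[ (fun x => x%:C%C) (ray_kernel b) (Psi' t))
   + monodromy a * pint `]e, +oo[ (fun x => x%:C%C) (ray_kernel a)
     (fun t => pint `[0, 2 * pi] (arc e) (arc_kernel e b) (Psi' t))
   + monodromy b * pint `[0, 2 * pi] (arc e) (arc_kernel e a)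
     (fun t => pint `]e, +oo[ (fun x => x%:C%C) (ray_kernel b) (Psi' t))
   + pint `[0, 2 * pi] (arc e) (arc_kernel e a)
     (fun t => pint `[0, 2 * pi] (arc e) (arc_kernel e b) (Psi' t)).
  move=> cP bP.
  have c1 t : contour e t -> cont_on (contour e) (Psi' t).
    by move=> Gt t' u Gt' Gu ut; apply: (cP t t' (fun=> t) u) => //; exact: cvgC_cst.
  have b1 t : contour e t -> bounded_on (contour e) del (N * expR (- del * re t)) (Psi' t).
    by move=> Gt t' Gt'; exact: bP.
  have bexp (t : R[i]) : contour e t -> N * expR (- del * re t) <= `|N| * expR (del * e).
    move=> Gt; rewrite (le_trans (ler_wpM2r (expR_ge0 _) (ler_norm N)))//.
    rewrite ler_wpM2l// ler_expR.
    have [h _] := contour_re_im e0 Gt.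
    by have d0' : 0 < del by []; nra.
  have bU t : contour e t -> bounded_on (contour e) del (`|N| * expR (del * e)) (Psi' t).
    by move=> Gt t' Gt'; rewrite (le_trans (b1 t Gt t' Gt'))// ler_wpM2r ?expR_ge0// bexp.
  have [k P] := ray_piece b e0 d0; have P' := arc_piece b e0 d0.
  have gen D O tau kap k0 : piece (contour e) del D O tau kap k0 ->
      cont_on (contour e) (fun t => pint D tau kap (Psi' t)) /\
      exists N', bounded_on (contour e) del N' (fun t => pint D tau kap (Psi' t)).
    move=> P0; split.
      move=> t u Gt Gu ut; apply: (pint_dct P0) => //.
      - by move=> n; apply: c1.
      - by move=> n; apply: bU.
      - move=> t' Gt'; apply: (cP t t' u (fun=> t')) => //; exact: cvgC_cst.
    exists (N * (2 * \int[mu]_(x in D) k0 x)) => t Gt.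
    rewrite (le_trans (pint_le P0 (c1 t Gt) (b1 t Gt)))//.
    by rewrite le_eqVlt; apply/orP; left; apply/eqP; ring.
  have [cr [Nr br]] := gen _ _ _ _ _ P; have [ca [Na ba]] := gen _ _ _ _ _ P'.
  have inner t : contour e t -> hkf e b (Psi' t) =
      monodromy b * pint `]e, +oo[ (fun x => x%:C%C) (ray_kernel b) (Psi' t)
      + pint `[0, 2 * pi] (arc e) (arc_kernel e b) (Psi' t).
    by move=> Gt; rewrite (hkfE b e0 d0 (c1 t Gt) (b1 t Gt)).
  have cS := cont_onD (cont_onZ (monodromy b) cr) ca.
  have bS := bounded_onD (bounded_onZ (monodromy b) br) ba.
  rewrite (hkf_ext a e0 inner) (hkfE a e0 d0 cS bS).
  have [ka Pa] := ray_piece a e0 d0; have Pa' := arc_piece a e0 d0.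
  rewrite (pintD Pa (cont_onZ _ cr) (bounded_onZ (monodromy b) br) ca ba).
  rewrite (pintD Pa' (cont_onZ _ cr) (bounded_onZ (monodromy b) br) ca ba).
  by rewrite (pintZ Pa _ cr br) (pintZ Pa' _ cr br) (mulrDr (monodromy a)) mulrA !addrA.
move=> cP bP.
have cP' : cont2_on (contour e) (fun t t' => Psi t' t).
  by move=> t t' u v Gt Gt' Gu Gv ut vt'; exact: cP.
have bP' t t' : contour e t -> contour e t' ->
    normc (Psi t' t) <= M * expR (- del * re t) * expR (- del * re t').
  by move=> Gt Gt'; rewrite mulrAC; exact: bP.
rewrite (main s s' _ _ cP bP) (main s' s _ _ cP' bP').
have [k P] := ray_piece s e0 d0; have Pa := arc_piece s e0 d0.
have [k' P'] := ray_piece s' e0 d0; have Pa' := arc_piece s' e0 d0.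
rewrite (pint_fubini P P' cP bP) (pint_fubini P Pa' cP bP).
rewrite (pint_fubini Pa P' cP bP) (pint_fubini Pa Pa' cP bP).
by congr (_ + _); rewrite addrAC (mulrC (monodromy s)).
Qed.
End FixedRadius.
End HankelFunctional.

(** * Finite exceptional sets *)

Section NullSets.
Context {R : realType}.
Local Notation mu := (@lebesgue_measure R).

(** Remove the points of F one at a time; each is a null set. *)
Lemma finite_change (D : set R) (f g : R -> R) (F : seq R) :
  measurable D -> measurable_fun D g ->
  (forall x, D x -> x \notin F -> f x = g x) ->
  measurable_fun D f /\ \int[mu]_(x in D) f x = \int[mu]_(x in D) g x.
Proof.
elim: F D => [|a F IH] D mD mg fg.
  split; last by apply: eq_Rintegral => x /set_mem Dx; exact: fg.
  by apply: eq_measurable_fun mg => x /set_mem Dx; rewrite fg.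
have mDa : measurable (D `\ a) by exact: measurableD.
have mga : measurable_fun (D `\ a) g.
  by apply: measurable_funS mD _ mg; exact: subDsetl.
have fga x : (D `\ a) x -> x \notin F -> f x = g x.
  by move=> [Dx /eqP xa] xF; apply: fg => //; rewrite inE negb_or xa.
have [mf intf] := IH _ mDa mga fga.
split.
  have [Da|nDa] := pselect (D a); last first.
    suff -> : D = D `\ a by [].
    by apply/seteqP; split => [x Dx|x []//]; split => // xa; apply: nDa; rewrite -xa.
  have -> : D = (D `\ a) `|` [set a].
    apply/seteqP; split => [x Dx|x [[]//|->//]].
    by have [->|xa] := eqVneq x a; [right|left; split => //; exact/eqP].
  by apply/measurable_funU => //; split => //; exact: measurable_fun_set1.
have mf' : measurable_fun (D `\ a) (EFin \o f) by exact/measurable_EFinP.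
have mg' : measurable_fun (D `\ a) (EFin \o g) by exact/measurable_EFinP.
move: intf; rewrite /Rintegral.
by rewrite (integral_setD1 mDa mf') (integral_setD1 mDa mg').
Qed.

Lemma cintegral_finite_change (D : set R) (f g : R -> R[i]) (F : seq R) :
  measurable D -> cmeas D g -> (forall x, D x -> x \notin F -> f x = g x) ->
  cintegral D f = cintegral D g.
Proof.
move=> mD [mr mi] fg.
have fr x : D x -> x \notin F -> re (f x) = re (g x) by move=> *; rewrite fg.
have fi x : D x -> x \notin F -> im (f x) = im (g x) by move=> *; rewrite fg.
apply: complex_ext; first exact: (proj2 (finite_change mD mr fr)).
exact: (proj2 (finite_change mD mi fi)).
Qed.

(** A point of the circle is reached by at most two angles in [0, 2 pi]. *)
Lemma arc_finite (e : R) (S : seq R[i]) : 0 < e -> exists F : seq R,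
  forall th, `[0, 2 * pi]%classic th -> th \notin F -> arc e th \notin S.
Proof.
move=> e0; pose c t : R := re t / e.
exists (flatten [seq [:: acos (c t); 2 * pi - acos (c t)] | t <- S]) => th.
rewrite /= in_itv/= => /andP[t0 t1]; apply: contra => tS.
apply/flattenP; exists [:: acos (c (arc e th)); 2 * pi - acos (c (arc e th))].
  by apply/mapP; exists (arc e th).
have -> : c (arc e th) = cos th.
  have -> : c (arc e th) = re (arc e th) / e by [].
  rewrite reM re_real im_real mul0r subr0 /cexp /= expR0 mul1r.
  by rewrite mulrC mulKf ?lt0r_neq0.
rewrite !inE; have [tp|tp] := leP th pi.
  by rewrite cosK ?t0 ?tp ?eqxx// in_itv/= t0 tp.
have -> : cos th = cos (2 * pi - th).
  by rewrite mulr_natl addrC cosD2pi cosN.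
rewrite cosK ?subKr ?eqxx ?orbT// in_itv/=.
by apply/andP; split; [rewrite subr_ge0|rewrite lerBlDl; lra].
Qed.

(** frakH has removable singularities at T_j = 0, which the contour meets for
    finitely many t only. The integrand g is a function of w = log t, since at
    an exceptional t it may differ on the two rays. *)
Lemma hankel_finite_change (e del : R) (s0 : R[i]) (g phi : R[i] -> R[i]) (M : R)
    (S : seq R[i]) : 0 < e -> 0 < del ->
  cont_on (contour e) phi -> bounded_on (contour e) del M phi ->
  (forall w, contour e (cexp w) -> cexp w \notin S ->
     g w = phi (cexp w) * cexp ((s0 - 1) * w)) ->
  hankel e g = hkf e s0 phi.
Proof.
move=> e0 d0 cp bp H.
have [k P] := ray_piece s0 e0 d0; have P' := arc_piece s0 e0 d0.
have cr := piece_cmeas P cp; have ca := piece_cmeas P' cp.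
have ray_eq (y : R) : cexp (0 +i* y)%C = 1 ->
    cintegral `]e, +oo[ (fun x => g (ln x +i* y)%C) =
    cintegral `]e, +oo[ (fun x => phi (cexp (ln x +i* y)%C) * cexp ((s0 - 1) * (ln x +i* y)%C)).
  move=> y1.
  have cE x : `]e, +oo[%classic x -> cexp (ln x +i* y)%C = x%:C%C.
    by move=> /contour_gt0_ray ex; rewrite cexp_lnC ?(lt_trans e0)// y1 mulr1.
  have E x : `]e, +oo[%classic x -> phi (cexp (ln x +i* y)%C) * cexp ((s0 - 1) * (ln x +i* y)%C) =
      cexp ((s0 - 1) * (0 +i* y)%C) * (phi x%:C%C * ray_kernel s0 x) :> R[i].
    move=> ex; rewrite cE// mulrCA.
    have -> : (ln x +i* y)%C = (0 +i* y)%C + (ln x)%:C%C.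
      by apply: complex_ext; rewrite ?reD ?imD /= ?addr0 ?add0r.
    by rewrite mulrDr cexpD /ray_kernel; ring.
  rewrite (eq_cintegral E).
  apply: (cintegral_finite_change (F := [seq re t | t <- S])) => //.
    by apply: cmeasM (cmeas_cst _ _) _.
  move=> x ex xF; rewrite -E// H//; rewrite cE//.
    by apply: contour_ray; exact: contour_gt0_ray.
  by apply: contra xF => xS; apply/mapP; exists x%:C%C.
rewrite /hkf /hankel; congr (- _ + _ + _).
- by apply: ray_eq; rewrite complexr0 cexp0.
- have [F HF] := arc_finite S e0.
  have E th : phi (cexp (ln e +i* th)%C) * cexp ((s0 - 1) * (ln e +i* th)%C) *
      ((0 +i* e)%C * cexp (0 +i* th)%C) = phi (arc e th) * arc_kernel e s0 th :> R[i].
    by rewrite cexp_lnC// -mulrA.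
  rewrite (eq_cintegral (fun th _ => E th)).
  apply: (cintegral_finite_change (F := F)) => // th t01 tF.
  by rewrite -E H// cexp_lnC//; [exact: contour_arc|exact: HF].
- by apply: ray_eq; exact: cexp_2pi.
Qed.
End NullSets.

(** * The Hankel integral of a translated function *)

Section HankelConvolution.
Context {R : realType}.
Local Notation mu := (@lebesgue_measure R).
Implicit Types (psi phi : R[i] -> R[i]) (z t s : R[i]) (e del M rho : R).

(** These operators commute with differentiation (hk_cder), and the iterated
    integral is a composition of them (hankel_iter_fold). *)
Definition hk e s phi z : R[i] := hkf e s (fun t => phi (t + z)).

Lemma strip_shift e rho t z : 0 < e -> contour e t -> strip (rho - e) z ->
  strip rho (t + z).
Proof.
move=> e0 /(contour_re_im e0)[t1 t2] [z1 z2]; split; first by rewrite reD; lra.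
by rewrite imD (le_lt_trans (ler_normD _ _))//; lra.
Qed.

Section Fixed.
Variables (e del rho : R).
Hypotheses (e0 : 0 < e) (d0 : 0 < del).

Lemma cont_on_shift phi z : strip (rho - e) z -> cont_on (strip rho) phi ->
  cont_on (contour e) (fun t => phi (t + z)).
Proof.
move=> sz cp t u Gt Gu ut; apply: cp; first exact: strip_shift sz.
  by move=> n; exact: strip_shift sz.
by apply: cvgCD => //; exact: cvgC_cst.
Qed.

Lemma bounded_on_shift phi M z : strip (rho - e) z -> bounded_on (strip rho) del M phi ->
  bounded_on (contour e) del (M * expR (- del * re z)) (fun t => phi (t + z)).
Proof.
move=> sz bp t Gt; rewrite (le_trans (bp _ _))//; first exact: strip_shift sz.
by rewrite reD mulrDr expRD mulrAC -mulrA.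
Qed.

Lemma hk_le s : exists2 C : R, 0 <= C & forall rho' phi M, cont_on (strip rho') phi ->
  bounded_on (strip rho') del M phi ->
  bounded_on (strip (rho' - e)) del (M * C) (hk e s phi).
Proof.
have [C C0 HC] := hkf_le e0 d0 s; exists C => // rho' phi M cp bp z sz.
have c1 : cont_on (contour e) (fun t => phi (t + z)).
  move=> t u Gt Gu ut; apply: cp; first exact: strip_shift sz.
    by move=> n; exact: strip_shift sz.
  by apply: cvgCD => //; exact: cvgC_cst.
have b1 : bounded_on (contour e) del (M * expR (- del * re z)) (fun t => phi (t + z)).
  move=> t Gt; rewrite (le_trans (bp _ _))//; first exact: strip_shift sz.
  by rewrite reD mulrDr expRD mulrAC -mulrA.
by rewrite (le_trans (HC _ _ c1 b1))// mulrAC.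
Qed.

Lemma bounded_on_ge0 phi M : 0 < rho -> bounded_on (strip rho) del M phi -> 0 <= M.
Proof.
move=> r0 bp; have s0 : strip rho 0 by split; rewrite /= ?normr0//; have r0' := r0; lra.
by have := le_trans (normc_ge0 _) (bp 0 s0); rewrite /= mulr0 expR0 mulr1.
Qed.

Lemma hk_cvg s (phi_ : nat -> R[i] -> R[i]) phi M (z : R[i]) (u : nat -> R[i]) :
  (forall n, cont_on (strip rho) (phi_ n)) -> cont_on (strip rho) phi ->
  (forall n, bounded_on (strip rho) del M (phi_ n)) -> bounded_on (strip rho) del M phi ->
  (forall z (u : nat -> R[i]), strip rho z -> (forall n, strip rho (u n)) -> u ~> z ->
     (fun n => phi_ n (u n)) ~> phi z) ->
  strip (rho - e) z -> (forall n, strip (rho - e) (u n)) -> u ~> z ->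
  (fun n => hk e s (phi_ n) (u n)) ~> hk e s phi z.
Proof.
move=> cn cp bn bp H sz su uz.
have rho0 : 0 < rho by case: sz => _ h; have := le_lt_trans (normr_ge0 _) h; have e0' := e0; lra.
have M0 := bounded_on_ge0 rho0 bp.
have be w : strip (rho - e) w -> M * expR (- del * re w) <= M * expR (del * (rho - e)).
  by move=> [w1 _]; rewrite ler_wpM2l// ler_expR; have d0' := d0; nra.
apply: (@hkf_dct _ e del e0 d0 s _ _ (M * expR (del * (rho - e)))).
- by move=> n; exact: cont_on_shift.
- move=> n t Gt; rewrite (le_trans (bounded_on_shift (su n) (bn n) Gt))//.
  by rewrite ler_wpM2r ?expR_ge0// be.
- exact: cont_on_shift.
- move=> t Gt; rewrite (le_trans (bounded_on_shift sz bp Gt))//.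
  by rewrite ler_wpM2r ?expR_ge0// be.
- move=> t Gt; apply: H; first exact: strip_shift sz.
    by move=> n; exact: strip_shift (su n).
  exact: cvgCD (cvgC_cst _) _.
Qed.

Lemma hk_cont s phi M : cont_on (strip rho) phi -> bounded_on (strip rho) del M phi ->
  cont_on (strip (rho - e)) (hk e s phi).
Proof.
by move=> cp bp z u sz su uz; apply: (hk_cvg s (M := M) (phi_ := fun=> phi)).
Qed.

Lemma hkZ s phi M c z : cont_on (strip rho) phi -> bounded_on (strip rho) del M phi ->
  strip (rho - e) z -> hk e s (fun w => c * phi w) z = c * hk e s phi z.
Proof.
move=> cp bp sz.
exact: (hkfZ e0 d0 s c (cont_on_shift sz cp) (bounded_on_shift sz bp)).
Qed.

Lemma hk_ext s phi phi' z : (forall w, strip rho w -> phi w = phi' w) ->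
  strip (rho - e) z -> hk e s phi z = hk e s phi' z.
Proof. by move=> H sz; apply: hkf_ext => // t Gt; apply: H; exact: strip_shift sz. Qed.

(** Differentiate under each of the two integrals of hkfE. *)
Lemma hk_cder s phi phi' M M' :
  (forall z, strip rho z -> cder (strip rho) phi z (phi' z)) ->
  cont_on (strip rho) phi' ->
  bounded_on (strip rho) del M phi -> bounded_on (strip rho) del M' phi' ->
  forall z, strip (rho - e) z -> cder (strip (rho - e)) (hk e s phi) z (hk e s phi' z).
Proof.
move=> dp cp' bp bp' z sz.
have rho0 : 0 < rho by case: sz => _ h; have := le_lt_trans (normr_ge0 _) h; have e0' := e0; lra.
have cp : cont_on (strip rho) phi.
  by move=> w u sw su uw; exact: cder_cont (dp w sw) su uw.
have M0 := bounded_on_ge0 rho0 bp; have M'0 := bounded_on_ge0 rho0 bp'.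
pose N := (M + M') * expR (del * (rho - e)).
have bN f L w t : 0 <= L -> L <= M + M' -> bounded_on (strip rho) del L f -> strip (rho - e) w ->
    contour e t -> normc (f (t + w)) <= N * expR (- del * re t).
  move=> L0 LM bf sw Gt; rewrite (le_trans (bounded_on_shift sw bf Gt))//.
  rewrite ler_wpM2r ?expR_ge0// ler_pM ?expR_ge0// ler_expR.
  by case: sw => w1 _; have d0' := d0; nra.
have gen D O tau kap k : piece (contour e) del D O tau kap k ->
    cder (strip (rho - e)) (fun w => pint D tau kap (fun t => phi (t + w))) z
      (pint D tau kap (fun t => phi' (t + z))).
  move=> P; have inG x : D x -> contour e (tau x).
    by move=> Dx; exact: (piece_in P (piece_sub P Dx)).
  apply: (@cder_cintegral _ D (rho - e) (fun x w => phi (tau x + w) * kap x)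
     (fun x w => phi' (tau x + w) * kap x) (fun x => N * k x)) => //.
  - exact: piece_meas P.
  - move=> x w Dx sw.
    have h := cder_shift (V := strip (rho - e)) (F := phi) (t := tau x) (z := w)
      (fun v sv => strip_shift e0 (inG x Dx) sv) (dp _ (strip_shift e0 (inG x Dx) sw)).
    have := cderZ (kap x) h; rewrite (mulrC (kap x)).
    by apply: cder_ext => // v _; rewrite mulrC.
  - by move=> w sw; exact: (piece_cmeas P (cont_on_shift sw cp)).
  - by move=> w sw; exact: (piece_cmeas P (cont_on_shift sw cp')).
  - apply: integrableZ_le; [exact: piece_meas P|exact: piece_intg P].
  - move=> x w Dx sw; apply: (piece_dom P (psi := fun t => phi (t + w))) => // t Gt.
    by apply: bN bp sw Gt => //; lra.
  - move=> x w Dx sw; apply: (piece_dom P (psi := fun t => phi' (t + w))) => // t Gt.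
    by apply: bN bp' sw Gt => //; lra.
have [k P] := ray_piece s e0 d0; have P' := arc_piece s e0 d0.
rewrite /hk (hkfE s e0 d0 (cont_on_shift sz cp') (bounded_on_shift sz bp')).
have := cderD (cderZ (monodromy s) (gen _ _ _ _ _ P)) (gen _ _ _ _ _ P').
apply: cder_ext => // w sw.
by rewrite (hkfE s e0 d0 (cont_on_shift sw cp) (bounded_on_shift sw bp)).
Qed.
End Fixed.
End HankelConvolution.

(** * Integration by parts along the contour *)

Section ByParts.
Context {R : realType}.
Local Notation mu := (@lebesgue_measure R).
Implicit Types (psi phi : R[i] -> R[i]) (z t s : R[i]) (e del M rho : R).

Lemma integrableD_fun (D : set R) (f g : R -> R) : measurable D ->
  mu.-integrable D (EFin \o f) -> mu.-integrable D (EFin \o g) ->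
  mu.-integrable D (EFin \o (fun x => f x + g x)).
Proof.
move=> mD intf intg; rewrite (_ : EFin \o _ = ((EFin \o f) \+ (EFin \o g))%E)//.
exact: integrableD.
Qed.

Lemma ray_kernel_pred s (x : R) : 0 < x ->
  ray_kernel (s - 1) x = ray_kernel s x / x%:C%C.
Proof.
move=> x0; have -> : x%:C%C = cexp (ln x)%:C%C :> R[i] by rewrite cexp_real lnK.
rewrite /ray_kernel -cexpN -cexpD; congr cexp; ring.
Qed.

Lemma cderR_ray_kernel s (x : R) : 0 < x ->
  cderR (ray_kernel s) x ((s - 1) * ray_kernel (s - 1) x).
Proof.
move=> x0.
have dln : cderR (fun y : R => (s - 1) * (ln y)%:C%C) x ((s - 1) * (x^-1)%:C%C).
  have d := is_derive1_ln x0.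
  split.
    have := is_derive_scale (re (s - 1)) d.
    by congr (is_derive _ _ _ _); [apply/funext => y|];
      rewrite reM re_real im_real mulr0 subr0.
  have := is_derive_scale (im (s - 1)) d.
  by congr (is_derive _ _ _ _); [apply/funext => y|];
    rewrite imM re_real im_real mulr0 add0r.
have := cderR_cexp dln; rewrite -/(ray_kernel s x).
have -> : (s - 1) * (x^-1)%:C%C * ray_kernel s x = (s - 1) * ray_kernel (s - 1) x.
  by rewrite ray_kernel_pred// fmorphV -mulrA; congr (_ * _); rewrite mulrC.
by [].
Qed.

Lemma monodromy_pred s : monodromy (s - 1) = monodromy s :> R[i].
Proof. by rewrite /monodromy mulrBr mulr1 cexpD cexpN cexp_2pi invr1 mulr1. Qed.

Lemma cderR_real_shift z (x : R) : cderR (fun y : R => y%:C%C + z) x 1.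
Proof.
have := cderR_affine z 1 x; congr (cderR _ _ _); apply/funext => y.
by rewrite mulr1 addrC.
Qed.

Definition arc_power e s (th : R) : R[i] := cexp ((s - 1) * (ln e +i* th)%C).

Lemma cderR_im_line (a x : R) : cderR (fun th : R => (a +i* th)%C) x (0 +i* 1)%C.
Proof. by split => /=; [exact: is_derive_cst|exact: is_derive_id]. Qed.

Lemma cderR_arc e (th : R) : cderR (arc e) th ((0 +i* e)%C * cexp (0 +i* th)%C).
Proof.
have d := cderR_cexp (cderR_im_line 0 th).
have := cderRM (cderR_affine (e%:C%C) 0 th) d.
congr (cderR _ _ _); first by apply/funext => y; rewrite mulr0 addr0.
rewrite mul0r add0r mulr0 addr0 mulrA; congr (_ * _).
by apply: complex_ext; rewrite ?reM ?imM /=; ring.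
Qed.

Lemma cderR_arc_power e s (th : R) : 0 < e ->
  cderR (arc_power e s) th ((s - 1) * arc_kernel e (s - 1) th).
Proof.
move=> e0.
have d1 := cderRM (cderR_affine (s - 1) 0 th) (cderR_im_line (ln e) th).
have := cderR_cexp d1; congr (cderR _ _ _).
  by apply/funext => y; rewrite mulr0 addr0.
rewrite mul0r add0r mulr0 addr0 /arc_kernel -mulrA; congr (_ * _).
have -> : (0 +i* e)%C * cexp (0 +i* th)%C = (0 +i* 1)%C * cexp (ln e +i* th)%C.
  rewrite cexp_lnC// mulrA; congr (_ * _).
  by apply: complex_ext; rewrite ?reM ?imM /=; ring.
rewrite mulrCA -cexpD; congr (_ * cexp _); ring.
Qed.

(** On each piece, (phi (t + z) t^(s - 1))' is integrated by the fundamental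
    theorem of calculus. The boundary terms of the ray and of the circle at
    t = e are opposite, because the circle gains the monodromy factor. *)
Lemma hk_parts e del rho s phi phi' M M' z : 0 < e -> 0 < del ->
  (forall z, strip rho z -> cder (strip rho) phi z (phi' z)) ->
  cont_on (strip rho) phi' ->
  bounded_on (strip rho) del M phi -> bounded_on (strip rho) del M' phi' ->
  strip (rho - e) z -> hk e s phi' z = - (s - 1) * hk e (s - 1) phi z.
Proof.
move=> e0 d0 dp cp' bp bp' sz.
have cp : cont_on (strip rho) phi.
  by move=> w u sw su uw; exact: cder_cont (dp w sw) su uw.
have [z1 z2] := sz.
have c1 := cont_on_shift e0 sz cp; have b1 := bounded_on_shift e0 sz bp.
have c2 := cont_on_shift e0 sz cp'; have b2 := bounded_on_shift e0 sz bp'.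
rewrite /hk (hkfE s e0 d0 c2 b2) (hkfE (s - 1) e0 d0 c1 b1) monodromy_pred.
have [k P] := ray_piece s e0 d0; have P' := arc_piece s e0 d0.
have [k1 P1] := ray_piece (s - 1) e0 d0; have P1' := arc_piece (s - 1) e0 d0.
have d20 : 0 < del / 2 by lra.
set I1 := pint _ _ (ray_kernel s) _; set I2 := pint _ _ (arc_kernel e s) _.
set J1 := pint _ _ (ray_kernel (s - 1)) _; set J2 := pint _ _ (arc_kernel e (s - 1)) _.
have sx (x : R) : 0 < x -> strip rho (x%:C%C + z).
  by move=> x0; split; [rewrite reD re_real; lra|rewrite imD im_real add0r; lra].
(* K1 and K2 are the boundary terms of the ray and of the circle. *)
have K1 : I1 + (s - 1) * J1 = - (phi (e%:C%C + z) * ray_kernel s e).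
  rewrite /J1 -(pintZ P1 _ c1 b1) /I1 /pint -cintegralD//; last 2 first.
    exact: (piece_cintg P c2 b2).
    exact: (piece_cintg P1 (cont_onZ _ c1) (bounded_onZ _ b1)).
  apply: (@cFTCy _ `]0, +oo[ (fun x => phi (x%:C%C + z) * ray_kernel s x) _ _
    (fun x => M' * expR (- del * re z) * k x + normc (s - 1) * (M * expR (- del * re z)) * k1 x)) => //.
  - by move=> x /=; rewrite !in_itv/= !andbT; exact: lt_le_trans.
  - move=> x /contour_gt0_ray x0.
    have := cderRM (cderR_comp (fun u => strip_open (sx x x0)) (dp _ (sx x x0))
        (cderR_real_shift z x)) (cderR_ray_kernel s x0).
    by rewrite mulr1 mulrCA mulrA.
  - move=> x u /contour_gt0_ray x0 Du ux.
    have Du' n : 0 < u n by exact: contour_gt0_ray.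
    have uz : (fun n => (u n)%:C%C + z) ~> (x%:C%C + z).
      by apply: cvgCD (cvgC_cst _); exact: cvgC_real.
    have sun n : strip rho ((u n)%:C%C + z) by exact: sx.
    have x0' : `]0, +oo[%classic x by rewrite /= in_itv/= x0.
    apply: cvgCD; apply: cvgCM.
    + by apply: cp' => //; exact: sx.
    + exact: (ray_kernel_seqcont _ (lexx 0) x0' Du ux).
    + by apply: cvgCM (cvgC_cst _) _; apply: cp => //; exact: sx.
    + exact: (ray_kernel_seqcont _ (lexx 0) x0' Du ux).
  - apply: integrableD_fun => //; apply: integrableZ_le => //.
      exact: piece_intg P.
    exact: piece_intg P1.
  - move=> x ex; have Dx : `]e, +oo[%classic x by rewrite /= in_itv/= ex.
    rewrite (le_trans (ler_normcD _ _))// lerD//; first exact: (piece_dom P b2).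
    exact: (piece_dom P1 (bounded_onZ _ b1)).
  - have [C C0 HC] := expR_ln_bound (re s - 1) e0 d20.
    apply: (@cvgC_squeeze _ _ _ (fun n => M * expR (- del * re z) * C *
       (expR (- (del / 2) * (e + n.+1%:R))))).
      move=> n; rewrite subr0 normcM normc_ray_kernel.
      have en : e < e + n.+1%:R by rewrite ltrDl.
      have h := b1 _ (contour_ray en); rewrite re_real in h.
      rewrite (le_trans (ler_pM (normc_ge0 _) (expR_ge0 _) h (HC _ en)))//.
      rewrite le_eqVlt; apply/orP; left; apply/eqP.
      rewrite -!mulrA; congr (_ * (_ * _)); rewrite mulrCA; congr (_ * _).
      by rewrite -expRD; congr expR; field.
    rewrite -[X in _ --> X](mulr0 (M * expR (- del * re z) * C)).
    apply: cvgM; first exact: cvg_cst.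
    apply: (@squeeze_cvgr _ _ _ _ (cst 0) (fun n => (del / 2)^-1 * n.+1%:R^-1)).
    + apply: nearW => n; rewrite expR_ge0/= mulNr expRN -invfM lef_pV2 ?posrE ?expR_gt0 ?mulr_gt0//.
      rewrite (le_trans _ (expR_ge1Dx _))// mulrDr.
      have : 0 <= del / 2 * e by rewrite mulr_ge0// ltW.
      lra.
    + exact: cvg_cst.
    + exact: cvg_harmonicZ.
have K2 : I2 + (s - 1) * J2 = phi (e%:C%C + z) * ray_kernel s e * monodromy s.
  rewrite /J2 -(pintZ P1' _ c1 b1) /I2 /pint -cintegralD//; last 2 first.
    exact: (piece_cintg P' c2 b2).
    exact: (piece_cintg P1' (cont_onZ _ c1) (bounded_onZ _ b1)).
  have sa th : strip rho (arc e th + z) by exact: strip_shift e0 (contour_arc e th) sz.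
  rewrite (@cFTC _ setT (fun th => phi (arc e th + z) * arc_power e s th) _ 0 (2 * pi)).
  - have a0 : arc e 0 = e%:C%C :> R[i] by rewrite /arc complexr0 cexp0 mulr1.
    have a2 : arc e (2 * pi) = e%:C%C :> R[i] by rewrite /arc cexp_2pi mulr1.
    rewrite a0 a2 -mulrBr -mulrA; congr (_ * _).
    have p0 : arc_power e s 0 = ray_kernel s e by rewrite /arc_power complexr0.
    have -> : arc_power e s (2 * pi) = ray_kernel s e * cexp ((0 +i* (2 * pi))%C * (s - 1)).
      rewrite /arc_power; have -> : (ln e +i* (2 * pi))%C = (ln e)%:C%C + (0 +i* (2 * pi))%C.
        by apply: complex_ext; rewrite ?reD ?imD /= ?addr0 ?add0r.
      by rewrite mulrDr cexpD [X in cexp X * _ = _]mulrC -/(ray_kernel s e) mulrC [X in _ * cexp X]mulrC.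
    by rewrite p0 -monodromy_pred /monodromy (mulrBr (ray_kernel s e)) mulr1.
  - by rewrite mulr_gt0// pi_gt0.
  - exact: openT.
  - by [].
  - move=> th _.
    have dc : cderR (fun y : R => arc e y + z) th ((0 +i* e)%C * cexp (0 +i* th)%C).
      have := cderR_arc e th; move=> [dr di]; split.
        have := is_deriveD dr (is_derive_cst (re z) th 1); rewrite addr0.
        by congr (is_derive _ _ _ _); apply/funext => y; rewrite reD.
      have := is_deriveD di (is_derive_cst (im z) th 1); rewrite addr0.
      by congr (is_derive _ _ _ _); apply/funext => y; rewrite imD.
    have := cderRM (cderR_comp (fun u => strip_open (sa th)) (dp _ (sa th)) dc)
       (cderR_arc_power s th e0).
    by congr (cderR _ _ (_ + _)); rewrite /arc_kernel /arc_power; ring.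
  - move=> x u _ _ ux.
    have ua : (fun n => arc e (u n)) ~> arc e x.
      by apply: cvgCM (cvgC_cst _) _; exact: (@seqcont_cexp_im _ setT).
    have uz : (fun n => arc e (u n) + z) ~> (arc e x + z) by apply: cvgCD => //; exact: cvgC_cst.
    apply: cvgCD; apply: cvgCM.
    + by apply: cp'.
    + by apply: (piece_kap P').
    + by apply: cvgCM (cvgC_cst _) _; apply: cp.
    + by apply: (piece_kap P1').
have -> : I1 = - (phi (e%:C%C + z) * ray_kernel s e) - (s - 1) * J1 by rewrite -K1 addrK.
have -> : I2 = phi (e%:C%C + z) * ray_kernel s e * monodromy s - (s - 1) * J2 by rewrite -K2 addrK.
clear; move: J1 J2 (phi _) (ray_kernel _ _) (monodromy _) => a b c d f.
by ring.
Qed.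
End ByParts.

(** * Shrinking the contour *)

Section SmallRadius.
Context {R : realType}.
Local Notation mu := (@lebesgue_measure R).
Implicit Types (psi phi : R[i] -> R[i]) (z t s : R[i]) (del M rho : R).

Lemma cvg0_lt_near (u : nat -> R) (a : R) : u n @[n --> \oo] --> 0 -> 0 < a ->
  exists N, forall n, u (n + N)%N < a.
Proof. exact: cvg_lt_near. Qed.

Section UniformBounds.
Variables (del : R) (s : R[i]).
Hypotheses (d0 : 0 < del) (s1 : 1 < re s).

(** The ray integrand extended by 0, to integrate over a fixed domain as e varies. *)
Definition ray_patch e psi (x : R) : R[i] :=
  if x \in `]e, +oo[%classic then psi x%:C%C * ray_kernel s x else 0.

Lemma pint_ray_patch e psi : 0 < e ->
  pint `]e, +oo[ (fun x => x%:C%C) (ray_kernel s) psi = cintegral `]0, +oo[ (ray_patch e psi).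
Proof.
move=> e0; rewrite -cintegral_mkcondr; congr (cintegral _ _).
apply/seteqP; split => x /=; rewrite !in_itv/= !andbT; last by move=> [].
by move=> ex; split => //; exact: lt_trans ex.
Qed.

Lemma cmeas_ray_patch e psi : 0 < e -> cont_on (contour e) psi ->
  cmeas `]0, +oo[ (ray_patch e psi).
Proof.
move=> e0 cp; apply: cmeas_patch; [exact: measurable_itv|exact: measurable_itv|].
have [k P] := ray_piece s e0 d0.
apply: (cmeasS (E := `]e, +oo[%classic)) => //; last exact: (piece_cmeas P cp).
Qed.

Lemma ray_patch_le : exists2 C : R, 0 <= C & forall e psi M, 0 < e -> 0 <= M ->
  bounded_on (contour e) del M psi -> forall x : R, 0 < x ->
  normc (ray_patch e psi x) <= M * C * expR (- (del / 2) * x).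
Proof.
have d20 : 0 < del / 2 by have d0' := d0; lra.
have [C C0 HC] : exists2 C : R, 0 <= C & forall x : R, 0 < x ->
    expR ((re s - 1) * ln x) <= C * expR (del / 2 * x).
  by apply: expR_ln_bound0 => //; have s1' := s1; lra.
exists C => // e psi M e0 M0 bp x x0; rewrite /ray_patch; case: ifPn => [|_]; last first.
  by rewrite normc0 !mulr_ge0// expR_ge0.
rewrite inE => /contour_gt0_ray ex; rewrite normcM normc_ray_kernel.
have := bp _ (contour_ray ex); rewrite re_real => h.
rewrite (le_trans (ler_pM (normc_ge0 _) (expR_ge0 _) h (HC x x0)))//.
rewrite le_eqVlt; apply/orP; left; apply/eqP.
rewrite -!(mulrA M); congr (_ * _); rewrite mulrCA; congr (_ * _).
by rewrite -expRD; congr expR; field.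
Qed.

(** The circle has length 2 pi e and |t^(s - 1)| is bounded when Re s > 1. *)
Lemma pint_arc_le : exists2 c : R, 0 <= c & forall e psi M, 0 < e <= 1 -> 0 <= M ->
  cont_on (contour e) psi -> bounded_on (contour e) del M psi ->
  normc (pint `[0, 2 * pi] (arc e) (arc_kernel e s) psi) <= M * c * e.
Proof.
have d0' := d0; have s1' := s1; set I := expR (`|im s| * (2 * pi)).
have pi0 : 0 < 2 * pi :> R by rewrite mulr_gt0// pi_gt0.
exists (2 * (I * expR del * (2 * pi))) => [|e psi M /andP[e0 e1] M0 cp bp].
  by rewrite !mulr_ge0// ?expR_ge0// ltW// pi_gt0.
rewrite (le_trans (pint_le (arc_piece s e0 d0) cp bp))//.
rewrite Rintegral_cst_itv// subr0 -!(mulrA M) ler_wpM2l// -!(mulrA 2) ler_wpM2l//.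
rewrite [leRHS]mulrAC ler_wpM2r//; first exact: ltW.
have h1 : expR (re s * ln e) <= e.
  rewrite -[leRHS](@lnK R) ?posrE// ler_expR.
  have : ln e <= 0 by rewrite ln_le0.
  by move=> ?; nra.
have h2 : expR (del * e) <= expR del by rewrite ler_expR ler_piMr// ltW.
have h3 := ler_wpM2r (expR_ge0 (`|im s| * (2 * pi)) : 0 <= I) (ler_pM (expR_ge0 _) (expR_ge0 _) h1 h2).
by rewrite mulrAC (le_trans h3)// -/I (mulrC e) mulrAC (mulrC (expR del)).
Qed.

(** Unlike hkf_le, the constant does not depend on the radius; this requires
    Re s > 1. *)
Lemma hkf_le_unif : exists2 C : R, 0 <= C & forall e psi M, 0 < e <= 1 -> 0 <= M ->
  cont_on (contour e) psi -> bounded_on (contour e) del M psi ->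
  normc (hkf e s psi) <= M * C.
Proof.
have d20 : 0 < del / 2 by have d0' := d0; lra.
have [C C0 HC] := ray_patch_le; have [c c0 Hc] := pint_arc_le.
have J0 : 0 <= \int[mu]_(x in `]0, +oo[) expR (- (del / 2) * x).
  by apply: Rintegral_ge0 => x _; exact: expR_ge0.
exists (normc (monodromy s) * (2 * (C * \int[mu]_(x in `]0, +oo[) expR (- (del / 2) * x))) + c).
  by rewrite addr_ge0// !mulr_ge0// normc_ge0.
move=> e psi M e01 M0 cp bp; have /andP[e0 e1] := e01.
rewrite (hkfE s e0 d0 cp bp); apply: (le_trans (ler_normcD _ _)); rewrite (mulrDr M); apply: lerD.
  rewrite normcM [leRHS]mulrCA ler_wpM2l ?normc_ge0// pint_ray_patch//.
  rewrite mulrCA (mulrA M) -RintegralZl//; last exact: integrable_expR_tail.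
  apply: cintegral_le.
  - exact: measurable_itv.
  - exact: cmeas_ray_patch.
  - by apply: integrableZ_le; [exact: measurable_itv|exact: integrable_expR_tail].
  - by move=> x /contour_gt0_ray x0; exact: HC bp _ _.
rewrite (le_trans (Hc _ _ _ e01 M0 cp bp))// ler_piMr// mulr_ge0//.
Qed.

(** The circle disappears in the limit, and the ray integral converges to the
    one over the whole positive axis, dominated as in ray_patch_le. *)
Lemma hkf_small (e : nat -> R) (psi_ : nat -> R[i] -> R[i]) psi M :
  (forall n, 0 < e n <= 1) -> e n @[n --> \oo] --> 0 ->
  (forall n, cont_on (contour (e n)) (psi_ n)) ->
  (forall n, bounded_on (contour (e n)) del M (psi_ n)) ->
  (forall x : R, 0 < x -> (fun n => psi_ n x%:C%C) ~> psi x%:C%C) ->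
  (fun n => hkf (e n) s (psi_ n)) ~>
    monodromy s * cintegral `]0, +oo[ (fun x => psi x%:C%C * ray_kernel s x).
Proof.
move=> e01 e_0 cp bp pp.
have e0 n : 0 < e n by case/andP: (e01 n).
have M0 : 0 <= M.
  have := le_trans (normc_ge0 _) (bp 0%N _ (contour_arc (e 0%N) 0)).
  by rewrite pmulr_lge0// expR_gt0.
have d20 : 0 < del / 2 by have d0' := d0; lra.
have [C C0 HC] := ray_patch_le; have [c c0 Hc] := pint_arc_le.
under eq_fun do rewrite (hkfE s (e0 _) d0 (cp _) (bp _)).
rewrite -[X in _ ~> X]addr0; apply: cvgCD.
  apply: cvgCM (cvgC_cst _) _.
  under eq_fun do rewrite pint_ray_patch//.
  apply: (cintegral_dct (k := fun x => M * C * expR (- (del / 2) * x))).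
  - exact: measurable_itv.
  - by move=> n; exact: cmeas_ray_patch.
  - by apply: integrableZ_le; [exact: measurable_itv|exact: integrable_expR_tail].
  - move=> x /contour_gt0_ray x0.
    have [N HN] := cvg0_lt_near e_0 x0.
    apply/(cvgC_shift N).
    apply: (cvgC_ext (u := fun n => psi_ (n + N)%N x%:C%C * ray_kernel s x)).
      by move=> n; rewrite /ray_patch mem_set//= in_itv/= andbT.
    apply: cvgCM (cvgC_cst _).
    exact: (proj2 (cvgC_shift N (fun n => psi_ n x%:C%C) _)) (pp x x0).
  - by move=> n x /contour_gt0_ray x0; exact: HC (bp n) _ _.
apply: (@cvgC_squeeze _ _ _ (fun n => M * c * e n)); last first.
  by rewrite -[X in _ --> X](mulr0 (M * c)); apply: cvgM => //; exact: cvg_cst.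
by move=> n; rewrite subr0; exact: Hc.
Qed.
End UniformBounds.

(** The limit of the operators hk as the contour shrinks to the positive axis,
    up to the factor monodromy s (hk_small). *)
Definition mellin_shift s phi (x : R) : R[i] :=
  cintegral `]0, +oo[ (fun t : R => phi (t + x)%:C%C * ray_kernel s t).

Lemma hk_small (e : nat -> R) del rho s (phi_ : nat -> R[i] -> R[i]) phi M (x : R) :
  (forall n, 0 < e n <= 1) -> (forall n, e n < rho) -> e n @[n --> \oo] --> 0 ->
  0 < del -> 1 < re s ->
  (forall n, cont_on (strip rho) (phi_ n)) ->
  (forall n, bounded_on (strip rho) del M (phi_ n)) ->
  (forall y : R, 0 < y -> (fun n => phi_ n y%:C%C) ~> phi y%:C%C) ->
  0 <= x ->
  (fun n => hk (e n) s (phi_ n) x%:C%C) ~> monodromy s * mellin_shift s phi x.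
Proof.
move=> e01 er e_0 d0 s1 cp bp pp x0.
have e0 n : 0 < e n by case/andP: (e01 n).
have sx n : strip (rho - e n) x%:C%C.
  by split; rewrite ?re_real ?im_real ?normr0; have := er n; lra.
have -> : mellin_shift s phi x =
    cintegral `]0, +oo[ (fun t : R => (fun w => phi (w + x%:C%C)) t%:C%C * ray_kernel s t).
  by apply: eq_cintegral => t _; rewrite rmorphD.
have H1 n := cont_on_shift (e0 n) (sx n) (cp n).
have H2 n := bounded_on_shift (e0 n) (sx n) (bp n).
apply: (hkf_small d0 s1 (psi := fun w => phi (w + x%:C%C)) e01 e_0 H1 H2) => y y0.
by under eq_fun do rewrite -rmorphD; rewrite -rmorphD; apply: pp; lra.
Qed.
End SmallRadius.

(** * The functional equation of Gamma *)

Section GammaFunction.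
Context {R : realType}.
Implicit Types (s w : R[i]).

Definition gauss_term s n : R[i] :=
  n`!%:R * cexp (s * (ln n%:R)%:C%C) / \prod_(k < n.+1) (s + k%:R).

Lemma cGammaE s l : gauss_term s ~> l -> cGamma s = l.
Proof.
move=> /cvgC_topP H; apply: cvg_lim H; exact: norm_hausdorff.
Qed.

Lemma cGamma_dvg s : ~ (exists l, gauss_term s ~> l) -> cGamma s = 0.
Proof.
move=> dv; have -> : cGamma s = point; last by [].
apply: dvgP => /cvg_ex[l /= Hl]; apply: dv; exists l; exact/cvgC_topP.
Qed.

(** The (n + 1)-st terms for s + 1 and for s differ by a factor tending to s, so
    that the two sequences converge simultaneously. If they do not, both
    values of cGamma are the default value 0 of a limit, and the equation
    still holds. *)
Lemma cGammaS s : (forall k : nat, s + k%:R != 0) -> cGamma (s + 1) = s * cGamma s.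
Proof.
move=> sk; have s0 : s != 0 by have := sk 0%N; rewrite addr0.
pose r n : R[i] := 1 + (s + 1) * n.+1%:R^-1.
have nz n : (n.+1%:R : R[i]) != 0 by rewrite pnatr_eq0.
have rE n : r n = (s + n.+2%:R) / n.+1%:R.
  by have := nz n; rewrite /r -[n.+2]addn1 natrD => n0; field.
have r0 n : r n != 0 by rewrite rE mulf_neq0 ?invr_eq0.
have r1 : r ~> 1.
  rewrite -[X in _ ~> X]addr0; apply: cvgCD (cvgC_cst _) _.
  rewrite -(mulr0 (s + 1)); apply: cvgCM (cvgC_cst _) _.
  have := cvgC_real (@cvg_harmonicZ R 1); apply: cvgC_ext => n.
  by rewrite mul1r fmorphV/= (rmorph_nat (real_complex R)).
have step n : gauss_term (s + 1) n.+1 = s * gauss_term s n.+1 * (r n)^-1.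
  have P : s * \prod_(k < n.+2) (s + 1 + k%:R) = (\prod_(k < n.+2) (s + k%:R)) * (s + n.+2%:R).
    have <- : \prod_(k < n.+3) (s + k%:R) = (\prod_(k < n.+2) (s + k%:R)) * (s + n.+2%:R).
      by rewrite big_ord_recr.
    rewrite [RHS]big_ord_recl/= addr0.
    congr (_ * _); apply: eq_bigr => k _; rewrite /bump/= add1n -natr1.
    by rewrite -addrA (addrC 1).
  have P0 : \prod_(k < n.+2) (s + k%:R) != 0 by apply/prodf_neq0 => k _; exact: sk.
  have P1 : \prod_(k < n.+2) (s + 1 + k%:R) = (\prod_(k < n.+2) (s + k%:R)) * (s + n.+2%:R) / s.
    by rewrite -P mulrC mulKf.
  have E : cexp ((s + 1) * (ln n.+1%:R)%:C%C) = cexp (s * (ln n.+1%:R)%:C%C) * n.+1%:R.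
    rewrite mulrDl mul1r cexpD cexp_real lnK ?posrE ?ltr0n//.
    by rewrite (rmorph_nat (real_complex R)).
  have gen (K : fieldType) (b c u p v w : K) : p != 0 -> v != 0 -> u != 0 -> v + w != 0 ->
      b * (c * u) / (p * (v + w) / v) = v * (b * c / p) / ((v + w) / u).
    by move=> h1 h2 h3 h4; field; rewrite h1 h2 h3 h4.
  by rewrite /gauss_term P1 E rE; exact: gen.
have [[l Hl]|dv] := pselect (exists l, gauss_term s ~> l).
  rewrite (cGammaE Hl); apply: cGammaE; apply/(cvgC_shift 1).
  apply: (cvgC_ext (u := fun n => s * gauss_term s (n + 1)%N * (r n)^-1)).
    by move=> n; rewrite addn1 step.
  rewrite -[s * l]mulr1 -[X in _ ~> s * l * X]invr1; apply: cvgCM.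
    by apply: cvgCM (cvgC_cst _) _; apply/(cvgC_shift 1).
  by apply: cvgCV r1; exact: oner_neq0.
rewrite (cGamma_dvg dv) mulr0; apply: cGamma_dvg => -[l Hl]; apply: dv.
exists (s^-1 * l * 1); apply/(cvgC_shift 1).
apply: (cvgC_ext (u := fun n => s^-1 * gauss_term (s + 1) (n + 1)%N * r n)).
  by move=> n; rewrite addn1 step mulrA mulKf// mulfVK.
by apply: cvgCM r1; apply: cvgCM (cvgC_cst _) _; apply/(cvgC_shift 1).
Qed.
End GammaFunction.

(** * Separation of the iterated integral *)

Section HankelFold.
Context {R : realType}.
Implicit Types (phi h : R[i] -> R[i]) (z t w : R[i]) (M rho : R).

(** Successive Hankel integrations against h: the first element of ss is
    integrated first, that is, innermost. *)
Definition hkfold e h (ss : seq R[i]) phi :=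
  foldl (fun phi s => hk e s (fun t => h t * phi t)) phi ss.

Variables (e del rho0 H : R) (h : R[i] -> R[i]).
Hypotheses (e0 : 0 < e) (d0 : 0 < del) (ch : cont_on (strip rho0) h)
  (bh : bounded_on (strip rho0) del H h).

Lemma hkfold_ext ss phi phi' rho z : (forall w, strip rho w -> phi w = phi' w) ->
  strip (rho - (size ss)%:R * e) z -> hkfold e h ss phi z = hkfold e h ss phi' z.
Proof.
elim: ss phi phi' rho z => [|s ss IH] phi phi' rho z E sz.
  by apply: E; move: sz; rewrite mul0r subr0.
apply: (IH _ _ (rho - e)); last by move: sz; rewrite /= -natr1 mulrDl mul1r opprD addrCA addrC.
move=> w sw; apply: (hk_ext e0 _ _ sw) => v sv; by rewrite E.
Qed.

(** Functions of z depending on a parameter t of the contour: jointly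
    continuous, and decaying in t and in z as required by Fubini. *)
Definition family_on rho M (Psi : R[i] -> R[i] -> R[i]) :=
  (forall t z (u v : nat -> R[i]), contour e t -> strip rho z ->
    (forall n, contour e (u n)) -> (forall n, strip rho (v n)) ->
    u ~> t -> v ~> z -> (fun n => Psi (u n) (v n)) ~> Psi t z) /\
  (forall t z, contour e t -> strip rho z ->
    normc (Psi t z) <= M * expR (- del * re t) * expR (- del * re z)).

Lemma bounded_strip rho z : strip rho z -> expR (- del * re z) <= expR (del * rho).
Proof. by move=> [z1 _]; rewrite ler_expR; have d0' := d0; nra. Qed.

Section Step.
Variables (rho M : R) (Psi : R[i] -> R[i] -> R[i]) (s : R[i]).
Hypotheses (rr : rho <= rho0) (fP : family_on rho M Psi).

Let H0 t z : contour e t -> strip rho z -> normc (h z * Psi t z) <=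
  H * expR (del * rho) * M * expR (- del * re t) * expR (- del * re z).
Proof.
move=> Gt sz; have [_ bP] := fP; rewrite normcM -2!mulrA.
have b1 := bh (stripS rr sz).
have Hge : 0 <= H.
  by rewrite -(pmulr_lge0 _ (expR_gt0 (- del * re z))); exact: le_trans (normc_ge0 _) b1.
rewrite (le_trans (ler_pM (normc_ge0 _) (normc_ge0 _) b1 (bP _ _ Gt sz)))//.
rewrite -!mulrA ler_wpM2l//.
have b2 := bP _ _ Gt sz; have pos := le_trans (normc_ge0 _) b2.
by apply: ler_wpM2r (bounded_strip sz); rewrite mulrA.
Qed.

Let cont1 t : contour e t -> cont_on (strip rho) (fun z => h z * Psi t z).
Proof.
move=> Gt z v sz sv vz; apply: cvgCM; last by have [cP _] := fP; apply: cP => //; exact: cvgC_cst.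
by apply: ch => // [|n]; apply: stripS rr _ _.
Qed.

Lemma family_hk : exists M', family_on (rho - e) M' (fun t => hk e s (fun w => h w * Psi t w)).
Proof.
have [C C0 HC] := hk_le e0 d0 s; have [cP bP] := fP.
exists (H * expR (del * rho) * M * C); split.
  move=> t z u v Gt sz Gu sv ut vz.
  have Mu : forall t, contour e t -> normc (expR (- del * re t))%:C%C <= expR (del * e).
    move=> t' /(contour_re_im e0)[t1 _]; rewrite normc_real ger0_norm ?expR_ge0// ler_expR.
    by have d0' := d0; nra.
  have bb t' : contour e t' -> bounded_on (strip rho) del
      (`|H * expR (del * rho) * M| * expR (del * e)) (fun w => h w * Psi t' w).
    move=> Gt' w sw; rewrite (le_trans (H0 Gt' sw))// ler_wpM2r ?expR_ge0//.
    rewrite (le_trans (ler_norm _))// normrM ler_wpM2l//.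
    by have := Mu t' Gt'; rewrite normc_real.
  apply: (hk_cvg (rho := rho) e0 d0 s (phi_ := fun n w => h w * Psi (u n) w) (phi := fun w => h w * Psi t w)) => //.
  - by move=> n; exact: cont1.
  - exact: cont1.
  - by move=> n; apply: bb.
  - exact: bb.
  - move=> w x sw sx xw; apply: cvgCM; last exact: cP.
    by apply: ch => // [|n]; apply: stripS rr _ _.
move=> t z Gt sz.
have b1 : bounded_on (strip rho) del (H * expR (del * rho) * M * expR (- del * re t))
    (fun w => h w * Psi t w) by move=> w sw; exact: H0.
rewrite (le_trans (HC _ _ _ (cont1 Gt) b1 z sz))//.
by rewrite [in leRHS](mulrAC _ C).
Qed.

Lemma hkf_hk_swap s0 z : strip (rho - e) z ->
  hkf e s0 (fun t => hk e s (fun w => h w * Psi t w) z) =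
  hk e s (fun w => h w * hkf e s0 (Psi ^~ w)) z.
Proof.
move=> sz; have [cP bP] := fP.
rewrite /hk (@hkf_fubini _ e del e0 d0 s0 s (fun t t' => h (t' + z) * Psi t (t' + z))
   (H * expR (del * rho) * M * expR (- del * re z))); first last.
- move=> t t' Gt Gt'; rewrite (le_trans (H0 Gt (strip_shift e0 Gt' sz)))//.
  by rewrite reD mulrDr expRD le_eqVlt; apply/orP; left; apply/eqP; ring.
- move=> t t' u v Gt Gt' Gu Gv ut vt.
  have vz : (fun n => v n + z) ~> (t' + z) by apply: cvgCD => //; exact: cvgC_cst.
  apply: cvgCM; last first.
    apply: (cP t (t' + z) u (fun n => v n + z)) => //; first exact: strip_shift sz.
    by move=> n; exact: strip_shift sz.
  apply: ch => // [|n]; apply: (stripS rr); first exact: strip_shift sz.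
  exact: strip_shift sz.
apply: hkf_ext => // t' Gt'; have sw := strip_shift e0 Gt' sz.
apply: (@hkfZ _ e del e0 d0 s0 _ (M * expR (- del * re (t' + z)))).
  by move=> t u Gt Gu ut; apply: cP => //; exact: cvgC_cst.
by move=> t Gt; rewrite mulrAC; exact: bP.
Qed.
End Step.

(** A Hankel integration in the parameter commutes with the fold: at each step
    of the fold it is exchanged with one integration by hkf_hk_swap. *)
Lemma hkfold_family ss : forall rho M Psi, rho <= rho0 -> family_on rho M Psi ->
  (exists M', family_on (rho - (size ss)%:R * e) M' (fun t => hkfold e h ss (Psi t))) /\
  forall s0 z, strip (rho - (size ss)%:R * e) z ->
    hkf e s0 (fun t => hkfold e h ss (Psi t) z) =
    hkfold e h ss (fun w => hkf e s0 (Psi ^~ w)) z.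
Proof.
elim: ss => [|s ss IH] rho M Psi rr fP.
  by rewrite /= mul0r subr0; split; [exists M|].
have [M' fM'] := family_hk s rr fP.
have re' : rho - e <= rho0 by have e0' := e0; lra.
have -> : rho - (size (s :: ss))%:R * e = rho - e - (size ss)%:R * e.
  by rewrite /= -natr1 mulrDl mul1r opprD addrA addrAC.
have [F1 F2] := IH _ _ _ re' fM'; split; first exact: F1.
move=> s0 z sz; rewrite /= F2//; apply: (hkfold_ext (rho := rho - e)) => // w sw.
exact: hkf_hk_swap fP _ _ _.
Qed.

Definition entries r (s : 'rV[R[i]]_r) : seq R[i] := [seq s 0 k | k <- enum 'I_r].

Lemma size_entries r (s : 'rV[R[i]]_r) : size (entries s) = r.
Proof. by rewrite size_map size_enum_ord. Qed.

Lemma entriesS r (s : 'rV[R[i]]_r.+1) :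
  entries s = s 0 ord0 :: entries (\row_k s 0 (lift ord0 k)).
Proof.
rewrite /entries enum_ordSl /= -map_comp; congr (_ :: _).
by apply: eq_map => k; rewrite /= mxE.
Qed.

Lemma strip0 rho : 0 < rho -> strip rho (0 : R[i]).
Proof. by move=> r0; split; rewrite /= ?normr0// oppr_lt0. Qed.

(** The outermost variable t = t_1 is peeled off: the remaining integrand is of
    the same form, with phi replaced by z |-> h (t + z) phi (t + z), since only
    T_1 involves t_1. The integration over t_1 is then moved inside by
    hkfold_family and becomes the innermost one.

    The functions hraw and phi agree with h and phi' outside finitely many
    points, which contribute nothing to the integrals; they must agree at 0 for
    phi, which is evaluated there when r = 0. The constant C collects the
    powers of the variables peeled off before, which cannot simply be moved out
    of hankel_iter: it is linear on integrable functions only. *)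
Lemma hankel_iter_fold (hraw : R[i] -> R[i]) r :
  (forall z, strip rho0 z -> z != 0 -> hraw z = h z) ->
  forall (s : 'rV[R[i]]_r) C phi phi' rho M (S : seq R[i]),
  rho <= rho0 -> 0 < rho - r%:R * e -> cont_on (strip rho) phi' ->
  (forall z, strip rho z -> normc (phi' z) <= M) ->
  (forall z, strip rho z -> z \notin S -> phi z = phi' z) -> 0 \notin S ->
  hankel_iter e (fun w : 'rV_r => C * (phi (\sum_k cexp (w 0 k)) *
      \prod_(j < r) hraw (\sum_(k < r | (j <= k)%N) cexp (w 0 k)) *
      \prod_(k < r) cexp ((s 0 k - 1) * w 0 k))) =
  C * hkfold e h (entries s) phi' 0.
Proof.
move=> hE; elim: r => [|r IH] s C phi phi' rho M S rr r0 cp bp pE S0.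
  have -> : entries s = [::] by apply: size0nil; rewrite size_entries.
  rewrite /= !big_ord0 !mulr1 pE//; apply: strip0; move: r0; lra.
rewrite entriesS; set s0 : R[i] := s 0 ord0; set s' : 'rV[R[i]]_r := \row_k _.
have e0' := e0; have d0' := d0.
have Mge : 0 <= M.
  apply: (le_trans (normc_ge0 _) (bp 0 _)); apply: strip0.
  have re0 : 0 <= r%:R * e by rewrite mulr_ge0// ltW.
  by move: r0; rewrite -natr1; lra.
pose Psi t z := h (t + z) * phi' (t + z).
have fP : family_on (rho - e) (H * M) Psi.
  split.
    move=> t z u v Gt sz Gu sv ut vz.
    have uv : (fun n => u n + v n) ~> (t + z) by exact: cvgCD.
    have s1 := strip_shift e0 Gt sz; have s2 n := strip_shift e0 (Gu n) (sv n).
    apply: cvgCM; last exact: cp s1 s2 uv.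
    by apply: ch uv; [exact: (stripS rr)|move=> n; exact: (stripS rr)].
  move=> t z Gt sz; have sw := strip_shift e0 Gt sz.
  rewrite normcM (le_trans (ler_pM (normc_ge0 _) (normc_ge0 _) (bh (stripS rr sw)) (bp _ sw)))//.
  by rewrite reD mulrDr expRD le_eqVlt; apply/orP; left; apply/eqP; ring.
have rr' : rho - e <= rho0 by lra.
have [[N [cN bN]] swap] := hkfold_family (entries s') rr' fP.
rewrite size_entries in cN bN swap.
have sz0 : strip (rho - e - r%:R * e) 0.
  by apply: strip0; move: r0; rewrite -natr1; lra.
have c1 : cont_on (contour e) (fun t => hkfold e h (entries s') (Psi t) 0).
  by move=> t u Gt Gu ut; apply: cN => //; exact: cvgC_cst.
have b1 : bounded_on (contour e) del N (fun t => hkfold e h (entries s') (Psi t) 0).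
  by move=> t Gt; rewrite (le_trans (bN t 0 Gt sz0))// mulr0 expR0 mulr1.
have -> : hkfold e h (s0 :: entries s') phi' 0 =
    hkf e s0 (fun t => hkfold e h (entries s') (Psi t) 0) by rewrite swap.
rewrite -(hkfZ e0 d0 s0 C c1 b1).
(* At t = 0 the functions hraw and h may differ, besides the points of S. *)
apply: (hankel_finite_change e0 d0 (S := 0 :: S) (cont_onZ C c1) (bounded_onZ C b1)).
move=> w Gw wS.
rewrite -[RHS]mulrAC; set C' := C * _.
rewrite -(IH s' C' (fun z => hraw (cexp w + z) * phi (cexp w + z)) (Psi (cexp w))
  (rho - e) (H * expR (del * rho) * M) [seq v - cexp w | v <- 0 :: S])//.
- congr hankel_iter; apply/funext => v.
  have w0 : row_mx (w%:M : 'rV_1) v 0 ord0 = w.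
    have -> : (ord0 : 'I_r.+1) = lshift r (ord0 : 'I_1) by exact: val_inj.
    by rewrite row_mxEl mxE eqxx mulr1n.
  have wS' (k : 'I_r) : row_mx (w%:M : 'rV_1) v 0 (lift ord0 k) = v 0 k.
    have -> : lift (ord0 : 'I_r.+1) k = rshift 1 k by exact: val_inj.
    by rewrite row_mxEr.
  rewrite [X in phi X]big_ord_recl w0.
  under [X in phi (_ + X)]eq_bigr do rewrite wS'.
  have -> : \prod_(j < r.+1) hraw (\sum_(k < r.+1 | (j <= k)%N) cexp (row_mx (w%:M : 'rV_1) v 0 k)) =
      hraw (cexp w + \sum_k cexp (v 0 k)) *
      \prod_(j < r) hraw (\sum_(k < r | (j <= k)%N) cexp (v 0 k)).
    rewrite big_ord_recl; congr (_ * _).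
      rewrite [X in hraw X]big_ord_recl w0; congr (hraw (_ + _)).
      by apply: eq_bigr => k _; rewrite wS'.
    apply: eq_bigr => j _; congr hraw; rewrite big_mkcond [RHS]big_mkcond/=.
    rewrite big_ord_recl/= add0r; apply: eq_bigr => k _; rewrite wS'.
    by rewrite /bump/= !add1n ltnS.
  have -> : \prod_(k < r.+1) cexp ((s 0 k - 1) * row_mx (w%:M : 'rV_1) v 0 k) =
      cexp ((s0 - 1) * w) * \prod_(k < r) cexp ((s' 0 k - 1) * v 0 k).
    rewrite big_ord_recl w0; congr (_ * _).
    by apply: eq_bigr => k _; rewrite wS' mxE.
  have gen (K : comPzRingType) (c a b x u y : K) :
    c * (a * (b * x) * (u * y)) = c * u * (b * a * x * y) by ring.
  exact: gen.
- by move: r0; rewrite -natr1; lra.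
- by case: fP => cP _; move=> z v sz sv vz; apply: cP => //; exact: cvgC_cst.
- move=> z sz; have sw := strip_shift e0 Gw sz.
  rewrite normcM; apply: ler_pM (normc_ge0 _) (normc_ge0 _) _ (bp _ sw).
  have Hge : 0 <= H.
    rewrite -(pmulr_lge0 _ (expR_gt0 (- del * re (cexp w + z)))).
    exact: le_trans (normc_ge0 _) (bh (stripS rr sw)).
  rewrite (le_trans (bh (stripS rr sw)))// ler_wpM2l//.
  by apply: le_trans (bounded_strip sw) _; rewrite ler_expR.
- move=> z sz zS; have sw := strip_shift e0 Gw sz.
  have zS' : cexp w + z \notin 0 :: S.
    apply: contra zS => h1; apply/mapP; exists (cexp w + z) => //.
    by rewrite addrAC subrr add0r.
  move: zS'; rewrite inE negb_or => /andP[n0 nS].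
  by rewrite hE// ?pE//; exact: stripS rr _ sw.
- apply/mapP => -[v vS /esym/eqP]; rewrite subr_eq0 => /eqP vw.
  by move: wS; rewrite -vw vS.
Qed.
End HankelFold.

(** * The limit c -> 1 *)

Section FoldLimit.
Context {R : realType}.
Implicit Types (phi h : R[i] -> R[i]) (z t w : R[i]) (M rho : R).
Variables (e del rho0 H : R).
Hypotheses (e0 : 0 < e) (d0 : 0 < del).

Definition jointly_cvg rho (phi_ : nat -> R[i] -> R[i]) phi :=
  forall z (u : nat -> R[i]), strip rho z -> (forall n, strip rho (u n)) -> u ~> z ->
     (fun n => phi_ n (u n)) ~> phi z.

Lemma jointly_cvgS rho rho' (phi_ : nat -> R[i] -> R[i]) phi : rho' <= rho -> jointly_cvg rho phi_ phi ->
  jointly_cvg rho' phi_ phi.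
Proof. by move=> rr J z u sz su; apply: J => [|n]; apply: stripS rr _ _. Qed.

Variables (h_ : nat -> R[i] -> R[i]) (h : R[i] -> R[i]).
Hypotheses (ch_ : forall n, cont_on (strip rho0) (h_ n)) (ch : cont_on (strip rho0) h)
  (bh_ : forall n, bounded_on (strip rho0) del H (h_ n)) (bh : bounded_on (strip rho0) del H h)
  (jh : jointly_cvg rho0 h_ h).

Lemma cont_onS U V phi : V `<=` U -> cont_on U phi -> cont_on V phi.
Proof. by move=> VU cp t u Vt Vu ut; apply: cp => // [|n]; exact: VU. Qed.

Lemma bounded_onS U V M phi : V `<=` U -> bounded_on U del M phi -> bounded_on V del M phi.
Proof. by move=> VU bp t Vt; exact: bp (VU _ Vt). Qed.

Lemma bounded_onM U M phi psi N : bounded_on U del M phi ->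
  (forall z, U z -> normc (psi z) <= N) ->
  bounded_on U del (M * N) (fun z => phi z * psi z).
Proof.
move=> bp bq z Uz; rewrite normcM.
rewrite (le_trans (ler_pM (normc_ge0 _) (normc_ge0 _) (bp _ Uz) (bq _ Uz)))//.
by rewrite mulrAC.
Qed.

Lemma bounded_on_strip rho M phi : bounded_on (strip rho) del M phi ->
  exists N, forall z, strip rho z -> normc (phi z) <= N.
Proof.
move=> bp; exists (M * expR (del * rho)) => z sz.
have Mge : 0 <= M.
  by rewrite -(pmulr_lge0 _ (expR_gt0 (- del * re z))); exact: le_trans (normc_ge0 _) (bp _ sz).
by rewrite (le_trans (bp _ sz))// ler_wpM2l//; exact: bounded_strip.
Qed.

Lemma hkfold_cvg ss : forall rho M (phi_ : nat -> R[i] -> R[i]) phi z, rho <= rho0 ->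
  (forall n, cont_on (strip rho) (phi_ n)) -> cont_on (strip rho) phi ->
  (forall n z, strip rho z -> normc (phi_ n z) <= M) ->
  (forall z, strip rho z -> normc (phi z) <= M) -> jointly_cvg rho phi_ phi ->
  strip (rho - (size ss)%:R * e) z ->
  (fun n => hkfold e (h_ n) ss (phi_ n) z) ~> hkfold e h ss phi z.
Proof.
elim: ss => [|s ss IH] rho M phi_ phi z rr cn cp bn bp jp sz.
  by apply: jp; [|move=> n|exact: cvgC_cst]; move: sz; rewrite mul0r subr0.
have SS := stripS rr.
have cn' n := cont_onM (cont_onS SS (@ch_ n)) (cn n).
have cp' := cont_onM (cont_onS SS ch) cp.
have bn' n := bounded_onM (bounded_onS SS (@bh_ n)) (bn n).
have bp' := bounded_onM (bounded_onS SS bh) bp.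
have jp' : jointly_cvg rho (fun n z => h_ n z * phi_ n z) (fun z => h z * phi z).
  by move=> w u sw su uw; apply: cvgCM; [exact: (jointly_cvgS rr jh)|exact: jp].
have [C C0 HC] := hk_le e0 d0 s.
have re' : rho - e <= rho0 by have e0' := e0; lra.
have b1 n := HC _ _ _ (cn' n) (bn' n); have b2 := HC _ _ _ cp' bp'.
have bdd phi1 : bounded_on (strip (rho - e)) del (H * M * C) phi1 ->
    forall z, strip (rho - e) z -> normc (phi1 z) <= `|H * M * C| * expR (del * (rho - e)).
  move=> bp1 w sw; rewrite (le_trans (bp1 _ sw))// (le_trans (ler_norm _))// normrM.
  by rewrite (ger0_norm (expR_ge0 _)) ler_wpM2l//; exact: bounded_strip.
apply: (IH (rho - e) (`|H * M * C| * expR (del * (rho - e)))) => //.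
- by move=> n; exact: hk_cont (cn' n) (bn' n).
- exact: hk_cont cp' bp'.
- by move=> n; exact: bdd.
- exact: bdd.
- by move=> w u sw su uw; apply: (hk_cvg e0 d0 s cn' cp' bn' bp').
- by move: sz; rewrite /= -natr1 mulrDl mul1r opprD addrCA addrC.
Qed.
End FoldLimit.

Section Secant.
Context {R : realType}.
Local Notation mu := (@lebesgue_measure R).
Implicit Types (z w : R[i]).
Variables (b g : R[i] -> R[i]).
Hypotheses (db : forall z, strip 1 z -> cder (strip 1) b z (g z))
  (cg : cont_on (strip 1) g) (bg : expbound (- 2^-1) g).

(** The slope of b between z and c z is an average of its derivative g, which
    makes sense at z = 0 and at c = 1. *)
Definition secant (c : R) z : R[i] :=
  cintegral `[0, 1] (fun x => g (z + x%:C%C * ((c - 1)%:C%C * z))).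

(** The point is (1 + x (c - 1)) z with a factor between 1/4 and 7/4. The
    range of x is a neighbourhood of [0, 1], as cFTC requires. *)
Lemma strip_dilate (c : R) (x : R) z : 2^-1 <= c <= 3 / 2 -> - 2^-1 < x < 3 / 2 ->
  strip 2^-1 z -> strip 1 (z + x%:C%C * ((c - 1)%:C%C * z)).
Proof.
move=> /andP[c0 c1] /andP[x0 x1] [z1 z2].
have -> : z + x%:C%C * ((c - 1)%:C%C * z) = (1 + x * (c - 1))%:C%C * z.
  by rewrite [in RHS]rmorphD [in RHS]rmorphM/= rmorph1; ring.
have k0 : 1 / 4 <= 1 + x * (c - 1) <= 7 / 4 by apply/andP; split; nra.
have /andP[k1 k2] := k0.
split; rewrite ?reM ?imM re_real im_real mul0r ?subr0 ?addr0; first nra.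
by rewrite normrM ger0_norm; nra.
Qed.

Lemma cmeas_secant (c : R) z : 2^-1 <= c <= 3 / 2 -> strip 2^-1 z ->
  seqcont `]- 2^-1, (3 / 2)[ (fun x => g (z + x%:C%C * ((c - 1)%:C%C * z))) /\
  cmeas `[0, 1] (fun x => g (z + x%:C%C * ((c - 1)%:C%C * z))).
Proof.
move=> c01 sz; pose f (x : R) := g (z + x%:C%C * ((c - 1)%:C%C * z)); rewrite -/f.
have cf : seqcont `]- 2^-1, (3 / 2)[ f.
  move=> x u; rewrite /= in_itv/= => xD uD ux.
  apply: cg; first exact: strip_dilate.
    by move=> n; apply: strip_dilate => //; have := uD n; rewrite /= in_itv.
  exact: cvgC_comp_line.
split => //; apply: (@cmeasS _ _ `]- 2^-1, (3 / 2)[) => //; last exact: seqcont_cmeas.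
by move=> x; rewrite /= !in_itv/= => /andP[x0 x1]; apply/andP; split; lra.
Qed.

(** Shrinking the decay from 1/2 to 1/4 absorbs the dilation by a factor that
    is at least 1/2; where Re z < 0 everything is bounded. *)
Lemma secant_le : exists H, forall c, 2^-1 <= c <= 3 / 2 ->
  bounded_on (strip 2^-1) 4^-1 H (secant c) /\
  forall x z, 0 <= x <= 1 -> strip 2^-1 z ->
    normc (g (z + x%:C%C * ((c - 1)%:C%C * z))) <= H * expR (- 4^-1 * re z).
Proof.
have [M HM] := bg.
have Mge : 0 <= M.
  have s0 : strip 1 (0 : R[i]) by exact: strip0.
  by have := le_trans (normc_ge0 _) (HM _ s0); rewrite mulr0 expR0 mulr1.
have key (c x : R) z : 2^-1 <= c <= 3 / 2 -> 0 <= x <= 1 -> strip 2^-1 z ->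
    normc (g (z + x%:C%C * ((c - 1)%:C%C * z))) <= M * expR 1 * expR (- 4^-1 * re z).
  move=> c01 x01 sz.
  have x01' : - 2^-1 < x < 3 / 2 by lra.
  rewrite (le_trans (HM _ (strip_dilate c01 x01' sz)))//.
  rewrite -mulrA ler_wpM2l// -expRD ler_expR.
  rewrite reD !reM !re_real !im_real !mul0r !subr0.
  case: sz => z1 z2; move: c01 x01 => /andP[c0 c1] /andP[x0 x1].
  have k0 : 1 / 2 <= 1 + x * (c - 1) <= 3 / 2 by apply/andP; split; nra.
  have /andP[k1 k2] := k0.
  have -> : - 2^-1 * (re z + x * ((c - 1) * re z)) = - 2^-1 * ((1 + x * (c - 1)) * re z) by ring.
  have [z0|z0] := leP 0 (re z); nra.
exists (2 * (M * expR 1)) => c c01; split.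
  move=> z sz.
  have -> : 2 * (M * expR 1) * expR (- 4^-1 * re z) =
      2 * \int[mu]_(x in `[0, 1]) (cst (M * expR 1 * expR (- 4^-1 * re z)) x).
    by rewrite Rintegral_cst_itv// subr0 mulr1 !mulrA.
  apply: cintegral_le => //.
  - by have [] := cmeas_secant c01 sz.
  - exact: integrable_cst_itv.
  - by move=> x; rewrite /= in_itv/= => x01; exact: key.
move=> x z x01 sz; rewrite (le_trans (key _ _ _ c01 x01 sz))// ler_wpM2r ?expR_ge0//.
by rewrite ler_peMl ?mulr_ge0 ?expR_ge0//; lra.
Qed.

Lemma secant_cvg (c_ : nat -> R) (c : R) z (u : nat -> R[i]) :
  (forall n, 2^-1 <= c_ n <= 3 / 2) -> 2^-1 <= c <= 3 / 2 -> c_ n @[n --> \oo] --> c ->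
  strip 2^-1 z -> (forall n, strip 2^-1 (u n)) -> u ~> z ->
  (fun n => secant (c_ n) (u n)) ~> secant c z.
Proof.
move=> cn01 c01 cc sz su uz; have [H HH] := secant_le.
have H0 : 0 <= H.
  have [_ /(_ 0 _ _ sz)] := HH _ c01; rewrite lexx ler01 => /(_ isT).
  by move/(le_trans (normc_ge0 _)); rewrite pmulr_lge0// expR_gt0.
apply: (cintegral_dct (k := cst (H * expR (4^-1 * 2^-1)))) => //.
- by move=> n; have [] := cmeas_secant (cn01 n) (su n).
- exact: integrable_cst_itv.
- move=> x; rewrite /= in_itv/= => /andP[x0 x1].
  have x01 : - 2^-1 < x < 3 / 2 by lra.
  apply: cg; first exact: strip_dilate.
    by move=> n; exact: strip_dilate.
  apply: cvgCD => //; apply: cvgCM (cvgC_cst _) _; apply: cvgCM => //.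
  by apply: cvgC_real; apply: cvgB => //; exact: cvg_cst.
- move=> n x; rewrite /= in_itv/= => x01; have [_ h] := HH _ (cn01 n).
  rewrite (le_trans (h _ _ x01 (su n)))// ler_wpM2l// bounded_strip ?invr_gt0//.
Qed.

Lemma secant1 z : secant 1 z = g z.
Proof.
have -> : secant 1 z = cintegral `[0, 1] (fun=> g z).
  by apply: eq_cintegral => x _; rewrite subrr mul0r mulr0 addr0.
by apply: complex_ext; rewrite /= Rintegral_cst_itv// subr0 mulr1.
Qed.

(** The fundamental theorem of calculus along the segment from z to c z. *)
Lemma secantE (c : R) z : 2^-1 <= c <= 3 / 2 -> strip 2^-1 z ->
  b (c%:C%C * z) - b z = secant c z * ((c - 1)%:C%C * z).
Proof.
move=> c01 sz.
have -> : c%:C%C * z = z + 1%:C%C * ((c - 1)%:C%C * z) by rewrite rmorphB/=; ring.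
have E0 : b z = b (z + 0%:C%C * ((c - 1)%:C%C * z)) by rewrite mul0r addr0.
have [cm mg] := cmeas_secant c01 sz.
have OO (x : R) : `]- 2^-1, (3 / 2)[%classic x -> - 2^-1 < x < 3 / 2 by rewrite /= in_itv.
have sub : `[0, 1] `<=` `]- 2^-1, (3 / 2 : R)[%classic.
  by move=> x; rewrite /= !in_itv/= => /andP[x0 x1]; apply/andP; split; lra.
have ci : cintg `[0, 1] (fun x => g (z + x%:C%C * ((c - 1)%:C%C * z))).
  have [H HH] := secant_le; have [_ h] := HH _ c01.
  apply: (cintg_dom (k := cst (H * expR (- 4^-1 * re z)))) => //.
  - exact: integrable_cst_itv.
  - by move=> x; rewrite /= in_itv/= => x01; exact: h.
rewrite E0 [RHS]mulrC /secant -cintegralZl//.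
rewrite -(@cFTC _ `]- 2^-1, (3 / 2)[ (fun x => b (z + x%:C%C * ((c - 1)%:C%C * z)))
  (fun x => (c - 1)%:C%C * z * g (z + x%:C%C * ((c - 1)%:C%C * z))) 0 1)//.
- move=> x xO; have sx := strip_dilate c01 (OO x xO) sz.
  have := cderR_comp (fun u => @strip_open _ _ _ u sx) (db sx)
    (cderR_affine z ((c - 1)%:C%C * z) x).
  by rewrite [X in cderR _ _ X]mulrC.
- move=> x v xD vD vx; by apply: cvgCM (cvgC_cst _) _; exact: cm.
Qed.
End Secant.

Section DesingularizedFold.
Context {R : realType}.
Variables (g : R[i] -> R[i]).
Hypotheses (db : forall z, strip 1 z -> cder (strip 1) bernoulli z (g z))
  (cg : cont_on (strip 1) g) (bg : expbound (- 2^-1) g).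

Definition hankel_factor (s : R[i]) : R[i] := (monodromy s * cGamma s)^-1.

(** By bernoulliE the bracket is (b (T) - b (c T)) / T, that is, 1 - c times
    the slope of b between T and c T. *)
Lemma frakH_factorE (c : R) z : 2^-1 <= c <= 3 / 2 -> c != 1 -> strip 2^-1 z -> z != 0 ->
  (1 - c)^-1%:C%C * ((cexp z - 1)^-1 - c%:C%C / (cexp (c%:C%C * z) - 1)) = secant g c z.
Proof.
move=> c01 c1 sz z0.
have sz1 : strip 1 z by apply: stripS sz; lra.
have x01 : - 2^-1 < (1 : R) < 3 / 2 by lra.
have scz : strip 1 (c%:C%C * z).
  have := strip_dilate c01 x01 sz.
  by congr (strip _ _); rewrite rmorphB/=; ring.
have /andP[c0 _] := c01.
have cn0 : c%:C%C != 0 :> R[i] by rewrite -normc_gt0 normc_real normr_gt0; lra.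
have cn1 : (1 - c)%:C%C != 0 :> R[i].
  by rewrite -normc_gt0 normc_real normr_gt0 subr_eq0 eq_sym.
rewrite (bernoulliE sz1 z0) (bernoulliE scz) ?mulf_neq0//.
have E := secantE db cg bg c01 sz.
have E1 : bernoulli z = bernoulli (c%:C%C * z) - secant g c z * ((c - 1)%:C%C * z).
  by rewrite -E subKr.
rewrite E1; move: cn1; rewrite fmorphV/= !rmorphB/= rmorph1.
have gen (K : fieldType) (p q k v : K) : k != 0 -> 1 - k != 0 -> v != 0 ->
    (1 - k)^-1 * ((p - q * ((k - 1) * v)) / v - k * (p / (k * v))) = q.
  by move=> h1 h2 h3; field; rewrite h1 h2 h3.
by move=> cn1; exact: gen.
Qed.

Lemma zeta_des_approxE r e c (s : 'rV[R[i]]_r) : 0 < e -> 0 < 2^-1 - r%:R * e ->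
  2^-1 <= c <= 3 / 2 -> c != 1 ->
  zeta_des_approx e c s =
  (\prod_(k < r) hankel_factor (s 0 k)) * hkfold e (secant g c) (entries s) (fun=> 1) 0.
Proof.
move=> e0 r0 c01 c1.
have [H HH] := secant_le cg bg; have [bs _] := HH _ c01.
have cs : cont_on (strip 2^-1) (secant g c).
  move=> z u sz su uz; apply: (secant_cvg cg bg) => //; exact: cvg_cst.
have cn1 : (1 - c)%:C%C != 0 :> R[i].
  by rewrite -normc_gt0 normc_real normr_gt0 subr_eq0 eq_sym.
have d0 : 0 < 4^-1 :> R by rewrite invr_gt0.
have := @hankel_iter_fold _ e 4^-1 2^-1 H _ e0 d0 cs bs
  (fun z => (1 - c)^-1%:C%C * ((cexp z - 1)^-1 - c%:C%C / (cexp (c%:C%C * z) - 1))) r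
  (fun z sz z0 => frakH_factorE c01 c1 sz z0) s ((1 - c)%:C%C ^+ r) (fun=> 1) (fun=> 1) 2^-1 1 [::]
  (lexx _) r0.
move=> /(_ _ _ _ _)/= E.
rewrite /zeta_des_approx.
have -> : hankel_iter e (fun w => frakH c (map_mx cexp w) * \prod_(k < r) cexp ((s 0 k - 1) * w 0 k)) =
   (1 - c)%:C%C ^+ r * hkfold e (secant g c) (entries s) (fun=> 1) 0.
  rewrite -E//; last 2 first.
  - by move=> z u _ _ _; exact: cvgC_cst.
  - by move=> z _; rewrite normc1.
  congr hankel_iter; apply/funext => w.
  rewrite mul1r mulrA; congr (_ * _).
  rewrite big_split/= prodr_const card_ord mulrA -exprMn fmorphV/= mulfV// expr1n mul1r.
  apply: eq_bigr => j _; rewrite /=.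
  have -> : \sum_(k < r | (j <= k)%N) map_mx cexp w 0 k = \sum_(k < r | (j <= k)%N) cexp (w 0 k).
    by apply: eq_bigr => k _; rewrite mxE.
  by [].
have X0 : (1 - c)%:C%C ^+ r != 0 :> R[i] by exact: expf_neq0.
by rewrite fmorphV/= rmorphXn/= mulrACA mulVf// mul1r.
Qed.

Lemma hkfold_secant_cvg r e (c_ : nat -> R) (s : 'rV[R[i]]_r) : 0 < e -> 0 < 2^-1 - r%:R * e ->
  (forall n, 2^-1 <= c_ n <= 3 / 2) -> c_ n @[n --> \oo] --> (1 : R) ->
  (fun n => hkfold e (secant g (c_ n)) (entries s) (fun=> 1) 0) ~>
    hkfold e g (entries s) (fun=> 1) 0.
Proof.
move=> e0 r0 c01 cc.
have c1 : 2^-1 <= (1 : R) <= 3 / 2 by lra.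
have [H HH] := secant_le cg bg.
have Eg : secant g 1 = g by apply/funext => z; rewrite secant1.
suff : (fun n => hkfold e (secant g (c_ n)) (entries s) (fun=> 1) 0) ~>
    hkfold e (secant g 1) (entries s) (fun=> 1) 0 by rewrite Eg.
have d0 : 0 < 4^-1 :> R by rewrite invr_gt0.
have cs c : 2^-1 <= c <= 3 / 2 -> cont_on (strip 2^-1) (secant g c).
  by move=> c' z u sz su uz; apply: (secant_cvg cg bg) => //; exact: cvg_cst.
apply: (@hkfold_cvg _ e 4^-1 2^-1 H e0 d0 (fun n => secant g (c_ n)) (secant g 1)
  (fun n => cs _ (c01 n)) (cs _ c1) (fun n => proj1 (HH _ (c01 n))) (proj1 (HH _ c1)) _
  (entries s) 2^-1 1 (fun _ => fun=> 1) (fun=> 1) 0) => //.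
- by move=> z u sz su uz; exact: (secant_cvg cg bg).
- by move=> n z u _ _ _; exact: cvgC_cst.
- by move=> z u _ _ _; exact: cvgC_cst.
- by move=> n z _; rewrite normc1.
- by move=> z _; rewrite normc1.
- by move=> z u _ _ _; exact: cvgC_cst.
- by apply: strip0; rewrite size_entries.
Qed.

(** Along any sequence tending to 1, the approximations converge both to Z s, by
    definition, and to the fold with the function g. *)
Lemma is_zeta_desE r (Z : 'rV[R[i]]_r -> R[i]) (s : 'rV[R[i]]_r) :
  is_zeta_des Z -> nonintegral s -> exists2 eta : R, 0 < eta & forall e, 0 < e < eta ->
  Z s = (\prod_(k < r) hankel_factor (s 0 k)) * hkfold e g (entries s) (fun=> 1) 0.
Proof.
move=> [_ HZ] /HZ [eta /= eta0 Heta].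
exists (Num.min eta (2^-1 / r.+1%:R)) => [|e /andP[e0]].
  by rewrite lt_min eta0 divr_gt0.
rewrite lt_min => /andP[e1 e2].
have ball_e : ball 0 eta e by rewrite /ball/= sub0r normrN gtr0_norm.
have Hz := Heta e ball_e e0.
have r0 : 0 < 2^-1 - r%:R * e.
  move: e2; rewrite ltr_pdivlMr ?ltr0n// -natr1; nra.
(* c_ n lies in ]1, 3/2], where the estimates on secant hold. *)
pose c_ n : R := 1 + 2^-1 * n.+1%:R^-1.
have c1 : c_ n @[n --> \oo] --> (1 : R).
  rewrite -[X in _ --> X]addr0; apply: cvgD; first exact: cvg_cst.
  exact: cvg_harmonicZ.
have pos n : 0 < (n.+1%:R^-1 : R) <= 1 by rewrite invr_gt0 ltr0n/= invf_le1// ler1n.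
have c01 n : 2^-1 <= c_ n <= 3 / 2.
  by have := pos n; rewrite /c_; move: (n.+1%:R^-1) => x; lra.
have cn1 n : c_ n != 1.
  by rewrite eq_sym lt_eqF// /c_; have := pos n; move: (n.+1%:R^-1) => x; lra.
have cf : c_ n @[n --> \oo] --> (1 : R)^'.
  move=> A HA; have h0 : \forall n \near \oo, (c_ n != 1 -> A (c_ n)) := c1 _ HA.
  change (\forall n \near \oo, A (c_ n)).
  by apply: (filterS _ h0) => n; apply.
apply: (@cvgC_unique _ (fun n => zeta_des_approx e (c_ n) s)).
  by apply/cvgC_topP; exact: cvg_comp cf Hz.
under eq_fun do rewrite zeta_des_approxE//.
by apply: cvgCM (cvgC_cst _) _; exact: hkfold_secant_cvg.
Qed.
End DesingularizedFold.

(** * Jets and their products *)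

Section Leibniz.
Variable (K : comPzRingType).
Implicit Types (a b : nat -> K).

(** The d-th derivative of a product at a point where a and b are the successive derivatives of the factors. *)
Definition leibniz a b d := \sum_(i < d.+1) 'C(d, i)%:R * (a i * b (d - i)%N).

Lemma leibnizS a b d :
  leibniz a b d.+1 = leibniz (fun i => a i.+1) b d + leibniz a (fun i => b i.+1) d.
Proof.
rewrite /leibniz big_ord_recl bin0 subn0 mul1r.
have -> : \sum_(i < d.+1) 'C(d.+1, bump 0 i)%:R * (a (bump 0 i) * b (d.+1 - bump 0 i)%N) =
    \sum_(i < d.+1) 'C(d, i)%:R * (a i.+1 * b (d - i)%N)
    + \sum_(i < d.+1) 'C(d, i.+1)%:R * (a i.+1 * b (d - i)%N).
  rewrite -big_split/=; apply: eq_bigr => i _.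
  by rewrite /bump/= add1n binS natrD subSS addrC mulrDl addrC.
rewrite addrCA; congr (_ + _).
rewrite [in RHS]big_ord_recl bin0 subn0 mul1r; congr (_ + _).
rewrite big_ord_recr/= bin_small// mul0r addr0; apply: eq_bigr => i _.
by rewrite /bump/= add1n -subSn// ltnW.
Qed.
End Leibniz.

(** * Raising the exponent *)

Section Parts.
Context {R : realType}.
Implicit Types (s : R[i]).

Definition nonint s := forall k : int, s <> k%:~R.

Lemma nonintD s (k : int) : nonint s -> nonint (s + k%:~R).
Proof. by move=> ns m E; apply: (ns (m - k)); rewrite rmorphB/= -E addrK. Qed.

Lemma nonintDn s (k : nat) : nonint s -> nonint (s + k%:R).
Proof. exact: (@nonintD s k). Qed.

Lemma nonint_nat s (k : nat) : nonint s -> s + k%:R != 0.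
Proof. by move=> ns; apply/eqP => E; apply: (@nonintDn s k ns 0); rewrite E mulr0z. Qed.

Lemma hankel_factorS s : nonint s -> hankel_factor s = s * hankel_factor (s + 1).
Proof.
move=> ns; rewrite /hankel_factor cGammaS; last by move=> k; exact: nonint_nat.
have s0 : s != 0 by have := nonint_nat 0 ns; rewrite addr0.
have -> : monodromy (s + 1) = monodromy s by rewrite -(monodromy_pred (s + 1)) addrK.
by rewrite (mulrCA (monodromy s)) [in RHS]invfM mulrA mulfV// mul1r.
Qed.

(** exp (2 i pi s) = 1 forces Im s = 0 and cos (2 pi f) = 1 for the fractional
    part f of Re s; but 1 - cos (2 pi f) = 2 sin (pi f)^2 is positive unless
    f = 0. *)
Lemma monodromy_neq0 s : nonint s -> monodromy s != 0.
Proof.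
move=> ns; apply/eqP => /eqP; rewrite subr_eq0 => /eqP E.
have E' : cexp ((0 +i* (2 * pi))%C * s) = ((expR (- (2 * pi * im s)) * cos (2 * pi * re s))
    +i* (expR (- (2 * pi * im s)) * sin (2 * pi * re s)))%C.
  by rewrite /cexp reM imM/= !mul0r sub0r add0r.
have im0 : im s = 0.
  have := normc_cexp ((0 +i* (2 * pi))%C * s); rewrite E normc1 reM/= mul0r sub0r.
  rewrite -[in LHS](@expR0 R) => /(@expR_inj R)/esym/eqP; rewrite oppr_eq0 mulf_eq0.
  by rewrite mulf_eq0 pnatr_eq0/= gt_eqF ?pi_gt0//= => /eqP.
have c1 : cos (2 * pi * re s) = 1.
  by move: E; rewrite E' im0 mulr0 oppr0 expR0 mul1r => -[].
pose k := Num.floor (re s); pose f := re s - k%:~R.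
have f0 : 0 <= f by rewrite subr_ge0 floor_le.
have f1 : f < 1 by have := lt_succ_floor (re s); rewrite intrD -/k /f; lra.
have per (n : nat) (x : R) : cos (x + 2 * pi * n%:R) = cos x.
  elim: n => [|n IH]; first by rewrite mulr0 addr0.
  have -> : x + 2 * pi * n.+1%:R = x + 2 * pi * n%:R + pi *+ 2 by rewrite -natr1; ring.
  by rewrite cosD2pi.
have perz (x : R) : cos (x + 2 * pi * k%:~R) = cos x.
  case: (k) => n; first exact: per.
  by rewrite NegzE mulrNz mulrN -[in RHS](subrK (2 * pi * n.+1%:R) x) per.
have cf : cos (2 * pi * f) = 1.
  by rewrite -(perz (2 * pi * f)) -mulrDr subrK.
have fE : f = 0.
  apply/eqP; rewrite eq_le f0 andbT leNgt; apply/negP => f0'.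
  have pif : 0 < pi * f < pi by rewrite mulr_gt0 ?pi_gt0//= gtr_pMr ?pi_gt0.
  have sn := sin_gt0_pi pif.
  have : cos (2 * pi * f) = 1 - 2 * sin (pi * f) ^+ 2.
    have -> : 2 * pi * f = pi * f + pi * f by ring.
    by rewrite cosD; have := cos2Dsin2 (pi * f); rewrite !expr2; lra.
  by rewrite cf; have := exprn_gt0 2 sn; lra.
apply: (ns k); apply: complex_ext.
  have -> : re (k%:~R : R[i]) = k%:~R.
    by case: (k) => n; rewrite ?NegzE ?mulrNz ?reN; rewrite re_nat.
  by move: fE => /eqP; rewrite subr_eq0 => /eqP.
by rewrite im0; case: (k) => n; rewrite ?NegzE ?mulrNz ?imN; rewrite im_nat ?oppr0.
Qed.

Lemma hankel_factorM s : nonint s -> hankel_factor s * monodromy s = (cGamma s)^-1.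
Proof.
by move=> /monodromy_neq0 m0; rewrite /hankel_factor invfM mulrAC mulVf// mul1r.
Qed.

Section StripParts.
Variables (e del rho : R).
Hypotheses (e0 : 0 < e) (d0 : 0 < del).
Variables (F : nat -> R[i] -> R[i]).
Hypotheses (dF : forall d z, strip rho z -> cder (strip rho) (F d) z (F d.+1 z))
  (bF : forall d, exists M, bounded_on (strip rho) del M (F d)).

Lemma cont_jet d : cont_on (strip rho) (F d).
Proof. by move=> w u sw su uw; exact: cder_cont (dF d sw) su uw. Qed.

(** hankel_factor absorbs the coefficient of each integration by parts, since
    hankel_factor s = s * hankel_factor (s + 1). *)
Lemma hankel_parts s d m z : nonint s -> strip (rho - e) z ->
  hankel_factor s * hk e s (F d) z =
  (-1) ^+ m * (hankel_factor (s + m%:R) * hk e (s + m%:R) (F (d + m)%N) z).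
Proof.
move=> ns sz; elim: m => [|m IH]; first by rewrite addr0 addn0 expr0 mul1r.
rewrite IH exprS -!mulrA mulN1r -mulrN; congr (_ * _).
have nsm : nonint (s + m%:R) by exact: nonintDn.
have [M bM] := bF (d + m); have [M' bM'] := bF (d + m).+1.
rewrite hankel_factorS// -[m.+1]addn1 natrD addrA addn1 addnS.
rewrite (@hk_parts _ e del rho (s + m%:R + 1) (F (d + m)%N) (F (d + m).+1) M M' z e0 d0
  (@dF _) (@cont_jet _) bM bM' sz) addrK.
by rewrite mulNr mulrN opprK mulrCA mulrA.
Qed.
End StripParts.
End Parts.

(** * From the contour to the positive axis *)

Section JetFamilies.
Context {R : realType}.
Implicit Types (s z : R[i]) (rho : R) (F : nat -> R[i] -> R[i]).
Variable G : nat -> R[i] -> R[i].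
Hypotheses (dG : forall d z, strip 1 z -> cder (strip 1) (G d) z (G d.+1 z))
  (bG : forall d, expbound (- 2^-1) (G d)).

Definition is_jet rho F := forall d z, strip rho z -> cder (strip rho) (F d) z (F d.+1 z).

Definition jet_mul F d z := leibniz (G ^~ z) (F ^~ z) d.

Lemma jet_mul_der rho F : rho <= 1 -> is_jet rho F -> is_jet rho (jet_mul F).
Proof.
move=> r1 jF d z sz; rewrite /jet_mul leibnizS /leibniz -big_split/=.
apply: cder_sum => i _; rewrite -mulrDr; apply: cderZ; apply: cderM; last exact: jF.
exact: cder_sub (stripS r1) (dG i (stripS r1 sz)).
Qed.

Lemma jet_mul_bound rho (F_ : nat -> nat -> R[i] -> R[i]) : rho <= 1 ->
  (forall d, exists M, forall n z, strip rho z -> normc (F_ n d z) <= M) ->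
  forall d, exists2 M, 0 <= M & forall n, bounded_on (strip rho) 2^-1 M (jet_mul (F_ n) d).
Proof.
move=> r1 /boolp.choice[N HN] d; have /boolp.choice[A HA] := bG.
exists (\sum_(i < d.+1) 'C(d, i)%:R * (`|A i| * `|N (d - i)%N|)).
  by apply: sumr_ge0 => i _; rewrite !mulr_ge0.
move=> n z sz; rewrite (le_trans (normc_sum _ _ _))// mulr_suml; apply: ler_sum => i _.
rewrite !normcM -(rmorph_nat (real_complex R)) normc_real ger0_norm//.
rewrite -mulrA ler_wpM2l// mulrAC; apply: ler_pM; rewrite ?normc_ge0//.
  rewrite (le_trans (HA i z (stripS r1 sz)))// ler_wpM2r ?expR_ge0// ler_norm//.
by rewrite (le_trans (HN _ n z sz))// ler_norm.
Qed.

Lemma jet_mul_lim (F_ : nat -> nat -> R[i] -> R[i]) F z :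
  (forall d, (fun n => F_ n d z) ~> F d z) ->
  forall d, (fun n => jet_mul (F_ n) d z) ~> jet_mul F d z.
Proof.
move=> FF d; apply: cvgC_sum => i _.
apply: cvgCM (cvgC_cst _) _; apply: cvgCM (cvgC_cst _) _; exact: FF.
Qed.

(** The class of sequences preserved by one Hankel integration as the radius
    tends to 0: the next integration takes place in a strip, but its limit
    involves the positive axis only. *)
Record jet_family rho (F_ : nat -> nat -> R[i] -> R[i]) F : Prop := {
  jf_jet : forall n, is_jet rho (F_ n);
  jf_bound : forall d, exists M, forall n z, strip rho z -> normc (F_ n d z) <= M;
  jf_lim : forall d (x : R), 0 <= x -> (fun n => F_ n d x%:C%C) ~> F d x%:C%C }.

(** The sequence of derivatives of the function K_s phi, where F holds the
    derivatives of phi. *)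
Definition mellin_jet s m F d z :=
  (-1) ^+ m * ((cGamma (s + m%:R))^-1 *
    mellin_shift (s + m%:R) (jet_mul F (d + m)) (re z)).

(** The uniform bound and the limit come from the formula raised to the
    exponent s + m, while the derivatives are taken in the original formula. *)
Lemma jet_family_step rho (eta : R) (e : nat -> R) s m (F_ : nat -> nat -> R[i] -> R[i]) F : 0 < eta <= 1 -> eta < rho -> rho <= 1 ->
  (forall n, 0 < e n <= eta) -> e n @[n --> \oo] --> 0 ->
  nonint s -> 1 < re (s + m%:R) -> jet_family rho F_ F ->
  jet_family (rho - eta)
    (fun n d z => hankel_factor s * hk (e n) s (jet_mul (F_ n) d) z) (mellin_jet s m F).
Proof.
move=> /andP[eta0 eta1] er r1 e01 e_0 ns s1 [jF bF lF].
have e0 n : 0 < e n by case/andP: (e01 n).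
have ee n : e n <= eta by case/andP: (e01 n).
have e1 n : 0 < e n <= 1 by rewrite e0 (le_trans (ee n)).
have d0 : 0 < 2^-1 :> R by rewrite invr_gt0.
have jJ n := jet_mul_der r1 (jF n).
have bJ := jet_mul_bound r1 bF.
have bJn n d : exists M, bounded_on (strip rho) 2^-1 M (jet_mul (F_ n) d).
  by have [M _ HM] := bJ d; exists M.
have cJ n d : cont_on (strip rho) (jet_mul (F_ n) d).
  by move=> w u sw su uw; exact: cder_cont (jJ n d w sw) su uw.
have sub n : strip (rho - eta) `<=` strip (rho - e n).
  by apply: stripS; have := ee n; lra.
split.
- move=> n d z sz; apply: cderZ; apply: cder_sub (sub n) _.
  have [M HM] := bJn n d; have [M' HM'] := bJn n d.+1.
  apply: (hk_cder (e0 n) d0 s (jJ n d) (cJ n d.+1) HM HM'); exact: sub.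
- move=> d; have [M M0 HM] := bJ (d + m)%N.
  have [C C0 HC] := hkf_le_unif d0 s1.
  exists (normc (hankel_factor (s + m%:R)) * (M * expR (2^-1 * rho) * C)) => n z sz.
  rewrite (hankel_parts (e0 n) d0 (jJ n) (bJn n) d m ns (sub n _ sz)).
  rewrite !normcM normcX normc_opp normc1 expr1n mul1r ler_wpM2l ?normc_ge0//.
  have b1 := bounded_on_shift (e0 n) (sub n _ sz) (HM n).
  have c1 := cont_on_shift (e0 n) (sub n _ sz) (cJ n (d + m)%N).
  rewrite (le_trans (HC _ _ _ (e1 n) _ c1 b1))//; first by rewrite mulr_ge0// expR_ge0.
  rewrite ler_wpM2r// ler_wpM2l// bounded_strip//.
  by apply: stripS sz; lra.
- move=> d x x0; have [M M0 HM] := bJ (d + m)%N.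
  apply: (cvgC_ext (u := fun n => (-1) ^+ m * (hankel_factor (s + m%:R) *
     hk (e n) (s + m%:R) (jet_mul (F_ n) (d + m)) x%:C%C))).
    move=> n; rewrite -(hankel_parts (e0 n) d0 (jJ n) (bJn n))//.
    by split; rewrite ?re_real ?im_real ?normr0; have := ee n; lra.
  rewrite /mellin_jet re_real -hankel_factorM; last exact: nonintDn.
  apply: cvgCM (cvgC_cst _) _; rewrite -mulrA; apply: cvgCM (cvgC_cst _) _.
  apply: (hk_small (rho := rho) (M := M) e1 _ e_0 d0 s1) => //.
    by move=> n; have := ee n; lra.
  by move=> y y0; apply: jet_mul_lim => d'; apply: lF; exact: ltW.
Qed.
End JetFamilies.

(** * A binomial identity *)

Section AlternatingLeibniz.
Variable (K : comPzRingType).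
Implicit Types (a b : nat -> K).

(** If X and Y shift a and b respectively, the sum is
    sum_i (-1)^i C(l, i) (X + Y)^(l - i) Y^i = X^l applied to a 0 * b 0. The
    induction on l uses X = (X + Y) - Y and Pascal's rule. *)
Lemma alternating_leibniz a b l :
  \sum_(i < l.+1) (-1) ^+ i * ('C(l, i)%:R * leibniz a (fun d => b (d + i)%N) (l - i)) =
  a l * b 0%N.
Proof.
elim: l a => [|l IH] a.
  by rewrite big_ord1 /leibniz big_ord1 !mul1r addn0.
rewrite -(IH (fun i => a i.+1)) big_ord_recl expr0 mul1r bin0 mul1r subn0.
set L := fun i => leibniz a (fun d => b (d + i)%N).
have LS i d : L i d.+1 = leibniz (fun i => a i.+1) (fun d => b (d + i)%N) d + L i.+1 d.
  rewrite /L leibnizS; congr (_ + _); apply: eq_bigr => k _.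
  by rewrite addSnnS.
have -> : \sum_(i < l.+1) (-1) ^+ bump 0 i * ('C(l.+1, bump 0 i)%:R *
      leibniz a (fun d => b (d + bump 0 i)%N) (l.+1 - bump 0 i)) =
    \sum_(i < l.+1) (-1) ^+ i.+1 * ('C(l, i.+1)%:R * L i.+1 (l - i)%N)
    - \sum_(i < l.+1) (-1) ^+ i * ('C(l, i)%:R * L i.+1 (l - i)%N).
  rewrite -sumrB; apply: eq_bigr => i _; rewrite /bump/= add1n binS natrD subSS -/(L i.+1) exprS.
  by ring.
rewrite addrA; apply/eqP; rewrite subr_eq -big_split/=; apply/eqP.
have -> : leibniz a (fun d => b (d + 0)%N) l.+1 +
    \sum_(i < l.+1) (-1) ^+ i.+1 * ('C(l, i.+1)%:R * L i.+1 (l - i)%N) =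
    \sum_(i < l.+1) (-1) ^+ i * ('C(l, i)%:R * L i (l - i).+1).
  rewrite [in RHS]big_ord_recl expr0 mul1r bin0 mul1r subn0; congr (_ + _).
  rewrite big_ord_recr/= bin_small// mul0r mulr0 addr0; apply: eq_bigr => i _.
  by rewrite /bump/= add1n -subSn.
by apply: eq_bigr => i _; rewrite LS; ring.
Qed.

Lemma alternating_leibniz_sum a b l :
  \sum_(i < l.+1) \sum_(j < l.+1 | (i + j == l)%N)
    (-1) ^+ i * 'C(l, i)%:R * ((-1) ^+ j * leibniz a (fun d => (-1) ^+ i * b (d + i)%N) j) =
  (-1) ^+ l * (a l * b 0%N).
Proof.
rewrite -alternating_leibniz mulr_sumr; apply: eq_bigr => i _.
have il : (i <= l)%N by rewrite -ltnS.
rewrite (big_pred1 (inord (l - i) : 'I_l.+1)); last first.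
  move=> j; rewrite /= -val_eqE/= inordK ?ltnS ?leq_subr//.
  by rewrite -[RHS](eqn_add2l i) subnKC.
rewrite inordK ?ltnS ?leq_subr//.
have -> : leibniz a (fun d => (-1) ^+ i * b (d + i)%N) (l - i) =
    (-1) ^+ i * leibniz a (fun d => b (d + i)%N) (l - i).
  by rewrite /leibniz mulr_sumr; apply: eq_bigr => k _; ring.
have -> : (-1) ^+ l = (-1) ^+ (l - i) * (-1) ^+ i :> K by rewrite -exprD subnK.
by move: ((-1) ^+ i) ((-1) ^+ (l - i)) => u v; ring.
Qed.
End AlternatingLeibniz.

(** * The zeta function as an iterated Mellin integral *)

Section FoldScaling.
Context {R : realType}.
Variables (e del rho0 H : R) (h : R[i] -> R[i]).
Hypotheses (e0 : 0 < e) (d0 : 0 < del) (ch : cont_on (strip rho0) h)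
  (bh : bounded_on (strip rho0) del H h).

Lemma hk_mul_nice rho M phi s : rho <= rho0 -> cont_on (strip rho) phi ->
  (forall z, strip rho z -> normc (phi z) <= M) ->
  [/\ cont_on (strip rho) (fun t => h t * phi t),
      bounded_on (strip rho) del (H * M) (fun t => h t * phi t),
      cont_on (strip (rho - e)) (hk e s (fun t => h t * phi t)) &
      exists N, forall z, strip (rho - e) z -> normc (hk e s (fun t => h t * phi t) z) <= N].
Proof.
move=> rr cp bp.
have c1 := cont_onM (cont_onS (stripS rr) ch) cp.
have b1 := bounded_onM (bounded_onS (stripS rr) bh) bp.
split => //; first exact: hk_cont c1 b1.
have [C C0 HC] := hk_le e0 d0 s.
by have [N HN] := bounded_on_strip d0 (HC _ _ _ c1 b1); exists N.
Qed.

Lemma hkfoldZ ss : forall rho M phi c z, rho <= rho0 -> cont_on (strip rho) phi ->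
  (forall z, strip rho z -> normc (phi z) <= M) -> strip (rho - (size ss)%:R * e) z ->
  hkfold e h ss (fun z => c * phi z) z = c * hkfold e h ss phi z.
Proof.
elim: ss => [|s ss IH] rho M phi c z rr cp bp sz //=.
have [c1 b1 c2 [N b2]] := hk_mul_nice s rr cp bp.
have re' : rho - e <= rho0 by have e0' := e0; lra.
have sz' : strip (rho - e - (size ss)%:R * e) z.
  by move: sz; rewrite /= -natr1 mulrDl mul1r opprD addrCA addrC.
rewrite -(IH (rho - e) N _ c z re' c2 b2 sz').
apply: (hkfold_ext h e0 _ sz') => w sw.
rewrite -(hkZ e0 d0 s c c1 b1 sw); apply: (hk_ext e0 _ _ sw) => v _; exact: mulrCA.
Qed.
End FoldScaling.

Section MellinFold.
Context {R : realType}.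
Variable G : nat -> R[i] -> R[i].
Hypotheses (dG : forall d z, strip 1 z -> cder (strip 1) (G d) z (G d.+1 z))
  (bG : forall d, expbound (- 2^-1) (G d)).

Definition hankel_jet e s (F : nat -> R[i] -> R[i]) d z :=
  hankel_factor s * hk e s (jet_mul G F d) z.

Definition unit_jet d (_ : R[i]) : R[i] := (d == 0%N)%:R.

(** Pairs (s, m): the exponents, and the numbers of integrations by parts used for them. *)
Definition mellin_fold (p : seq (R[i] * nat)) : nat -> R[i] -> R[i] :=
  foldl (fun F q => mellin_jet G q.1 q.2 F) unit_jet p.

Definition admissible (p : seq (R[i] * nat)) :=
  forall q, q \in p -> nonint q.1 /\ 1 < re (q.1 + q.2%:R).

Lemma small_radii n (eta0 : R) : 0 < eta0 -> exists (eta : R) (e : nat -> R),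
  [/\ 0 < eta <= 1, n%:R * eta < 1, forall k, 0 < e k <= eta, forall k, e k < eta0 &
      e k @[k --> \oo] --> 0].
Proof.
move=> eta00; pose eta : R := Num.min (eta0 / 2) (2^-1 / n.+1%:R).
have eta_gt : 0 < eta by rewrite lt_min !divr_gt0.
have eta1 : eta <= eta0 / 2 by rewrite ge_min lexx.
have eta2 : eta * n.+1%:R <= 2^-1 by rewrite -ler_pdivlMr ?ltr0n// ge_min lexx orbT.
have n0 : 0 <= n%:R :> R by [].
pose e (k : nat) : R := eta * k.+1%:R^-1.
have e01 k : 0 < e k <= eta.
  by rewrite mulr_gt0 ?invr_gt0//= ler_piMr ?(ltW eta_gt)// invf_le1// ler1n.
exists eta, e; split => //.
- by move: eta2; rewrite eta_gt -natr1; nra.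
- by move: eta2; rewrite -natr1; nra.
- by move=> k; have /andP[_] := e01 k; lra.
- exact: cvg_harmonicZ.
Qed.

Lemma unit_jet_family : jet_family 1 (fun=> unit_jet) unit_jet.
Proof.
split.
- by move=> _ d z sz; exact: cder_cst.
- move=> d; exists 1 => _ z _; rewrite /unit_jet; case: (d == _).
    by rewrite normc1.
  by rewrite normc0.
- by move=> d x _; exact: cvgC_cst.
Qed.

Lemma mellin_fold_family (p : seq (R[i] * nat)) (e : nat -> R) (eta : R) :
  0 < eta <= 1 -> (size p)%:R * eta < 1 ->
  (forall n, 0 < e n <= eta) -> e n @[n --> \oo] --> 0 -> admissible p ->
  jet_family (1 - (size p)%:R * eta)
    (fun n => foldl (fun F s => hankel_jet (e n) s F) unit_jet (unzip1 p)) (mellin_fold p).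
Proof.
move=> eta01 pe e01 e_0.
have /andP[eta0 eta1] := eta01.
elim/last_ind: p pe => [|p q IH] pe adm.
  by rewrite /= mul0r subr0; exact: unit_jet_family.
have pe' : (size p)%:R * eta < 1.
  by move: pe; rewrite size_rcons -natr1; lra.
have adm' : admissible p by move=> q' qp; apply: adm; rewrite mem_rcons inE qp orbT.
have [nq q1] : nonint q.1 /\ 1 < re (q.1 + q.2%:R).
  by apply: adm; rewrite mem_rcons inE eqxx.
have := jet_family_step dG bG eta01 _ _ e01 e_0 nq q1 (IH pe' adm').
rewrite /mellin_fold /unzip1 map_rcons foldl_rcons size_rcons.
under [in X in _ -> X]boolp.eq_fun do rewrite foldl_rcons.
have -> : 1 - (size p).+1%:R * eta = 1 - (size p)%:R * eta - eta by rewrite -natr1; ring.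
apply.
  by move: pe; rewrite size_rcons -natr1; lra.
by rewrite gerBl mulr_ge0// ltW.
Qed.

(** The factors hankel_factor are moved out by linearity. *)
Lemma hankel_jet_fold e ss : forall rho M F z, 0 < e -> rho <= 1 -> cont_on (strip rho) (F 0%N) ->
  (forall z, strip rho z -> normc (F 0%N z) <= M) -> strip (rho - (size ss)%:R * e) z ->
  foldl (fun F s => hankel_jet e s F) F ss 0%N z =
  (\prod_(s <- ss) hankel_factor s) * hkfold e (G 0%N) ss (F 0%N) z.
Proof.
elim: ss => [|s ss IH] rho M F z e0 r1 cF bF sz; first by rewrite /= big_nil mul1r.
have d0 : 0 < 2^-1 :> R by rewrite invr_gt0.
have [H HH] := bG 0.
have cG : cont_on (strip 1) (G 0%N).
  by move=> w u sw su uw; exact: cder_cont (dG 0 sw) su uw.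
have [c1 b1 c2 [N b2]] := hk_mul_nice e0 d0 cG HH s r1 cF bF.
have jE : hankel_jet e s F 0%N = fun z => hankel_factor s * hk e s (fun t => G 0%N t * F 0%N t) z.
  have j0 : jet_mul G F 0 = fun t => G 0%N t * F 0%N t.
    by apply/funext => t; rewrite /jet_mul /leibniz big_ord1 bin0 mul1r.
  by rewrite /hankel_jet j0.
have sz' : strip (rho - e - (size ss)%:R * e) z.
  by move: sz; rewrite /= -natr1 mulrDl mul1r opprD addrCA addrC.
have re' : rho - e <= 1 by lra.
rewrite /= (IH (rho - e) (normc (hankel_factor s) * N) (hankel_jet e s F))//.
- rewrite jE (hkfoldZ e0 d0 cG HH _ re' c2 b2 sz') big_cons.
  by rewrite mulrA (mulrC (hankel_factor s)).
- by rewrite jE; exact: cont_onZ.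
- by move=> w sw; rewrite jE normcM ler_wpM2l ?normc_ge0// b2.
Qed.
End MellinFold.

(** * A variable at a negative integer *)

Section MellinLimit.
Context {R : realType}.
Local Notation mu := (@lebesgue_measure R).

Lemma cvgC_expR_tail (F : R -> R[i]) (M : R) : 
  (forall x, 0 <= x -> normc (F x) <= M * expR (- 2^-1 * x)) ->
  (fun n => F (0 + n.+1%:R)) ~> 0.
Proof.
move=> HF; apply: (@cvgC_squeeze _ _ _ (fun n => (`|M| * 2) * n.+1%:R^-1)); last exact: cvg_harmonicZ.
move=> n; rewrite subr0 add0r (le_trans (HF _ _))// (le_trans (ler_norm _))//.
rewrite normrM (ger0_norm (expR_ge0 _)) -mulrA ler_wpM2l// mulNr expRN.
have -> : 2 * n.+1%:R^-1 = (2^-1 * n.+1%:R)^-1 :> R by rewrite invfM invrK.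
rewrite lef_pV2 ?posrE ?expR_gt0 ?mulr_gt0//.
by have := expR_ge1Dx (2^-1 * n.+1%:R : R); lra.
Qed.

(** t^x <= max (1, t) <= 1 + t <= 4 exp (t / 4) for 0 < x <= 1. *)
Lemma ray_kernel_near1 (x t : R) : 0 < x <= 1 -> 0 < t ->
  normc (ray_kernel (1 + x%:C%C) t) <= 4 * expR (4^-1 * t).
Proof.
move=> /andP[x0 x1] t0; rewrite normc_ray_kernel reD re_real/= addrAC subrr add0r.
have h : expR (x * ln t) <= 1 + t.
  have [l0|l0] := leP (ln t) 0.
    rewrite (@le_trans _ _ 1)//; last by lra.
    by rewrite -expR0 ler_expR; nra.
  rewrite (@le_trans _ _ t)//; last by lra.
  by rewrite -[leRHS](@lnK R) ?posrE// ler_expR; nra.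
by have := expR_ge1Dx (4^-1 * t); lra.
Qed.

(** As x tends to 0 the integral of psi' t^x tends to that of psi', by dominated
    convergence. The latter is - psi 0; since psi' is the derivative of psi only
    through the approximations psi_ n, the fundamental theorem is applied to
    these before passing to the limit. *)
Lemma mellin_limit (rho M : R) (psi_ psi'_ : nat -> R[i] -> R[i]) (psi psi' : R[i] -> R[i])
    (x : nat -> R) : 0 < rho ->
  (forall n z, strip rho z -> cder (strip rho) (psi_ n) z (psi'_ n z)) ->
  (forall n, cont_on (strip rho) (psi'_ n)) ->
  (forall n, bounded_on (strip rho) 2^-1 M (psi_ n)) ->
  (forall n, bounded_on (strip rho) 2^-1 M (psi'_ n)) ->
  (forall t : R, 0 <= t -> (fun n => psi_ n t%:C%C) ~> psi t%:C%C) ->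
  (forall t : R, 0 <= t -> (fun n => psi'_ n t%:C%C) ~> psi' t%:C%C) ->
  (forall n, 0 < x n <= 1) -> x n @[n --> \oo] --> 0 ->
  (fun n => mellin_shift (1 + (x n)%:C%C) psi' 0) ~> - psi 0.
Proof.
move=> r0 dp cp' bp bp' lp lp' x01 x0.
have mD : measurable (`]0, +oo[%classic : set R) by exact: measurable_itv.
have sR (t : R) : - rho < t -> strip rho t%:C%C.
  by move=> t0; split; rewrite ?re_real ?im_real ?normr0.
have s0 : strip rho 0 by exact: strip0.
have M0 : 0 <= M.
  by have := le_trans (normc_ge0 _) (bp 0%N _ s0); rewrite mulr0 expR0 mulr1.
have sqn n : seqcont `](- rho), +oo[ (fun t : R => psi'_ n t%:C%C).
  move=> t u; rewrite /= in_itv/= andbT => tr ur ut; apply: cp'.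
  - exact: sR.
  - by move=> k; apply: sR; have := ur k; rewrite /= in_itv/= andbT.
  - exact: cvgC_real.
have sub0 : `]0, +oo[ `<=` `](- rho), +oo[%classic.
  by move=> t; rewrite /= !in_itv/= !andbT => t0; lra.
have cmn n : cmeas `]0, +oo[ (fun t : R => psi'_ n t%:C%C).
  by apply: (cmeasS _ sub0); [exact: measurable_itv|apply: seqcont_cmeas].
have cm' : cmeas `]0, +oo[ (fun t : R => psi' t%:C%C).
  by apply: (cmeas_cvg cmn) => t /contour_gt0_ray t0; apply: lp'; exact: ltW.
have bn n (t : R) : 0 <= t -> normc (psi'_ n t%:C%C) <= M * expR (- 2^-1 * t).
  by move=> t0; have := bp' n t%:C%C; rewrite re_real; apply; apply: sR; lra.
have bl (t : R) : 0 <= t -> normc (psi' t%:C%C) <= M * expR (- 2^-1 * t).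
  move=> t0; apply/ler_addgt0Pr => eps eps0.
  have /cvgC_normP/cvg0_lt_near/(_ eps0)[N HN] := lp' t t0.
  have -> : psi' t%:C%C = psi'_ (0 + N)%N t%:C%C - (psi'_ (0 + N)%N t%:C%C - psi' t%:C%C).
    by rewrite subKr.
  by rewrite (le_trans (ler_normcB _ _))// lerD// ?bn// ltW.
have int0 : cintegral `]0, +oo[ (fun t : R => psi' t%:C%C) = - psi 0.
  have ie : mu.-integrable `]0, +oo[ (EFin \o (fun t => M * expR (- 2^-1 * t))).
    by apply: integrableZ_le => //; apply: integrable_expR_tail; rewrite invr_gt0.
  have H1 : (fun n => cintegral `]0, +oo[ (fun t : R => psi'_ n t%:C%C)) ~>
      cintegral `]0, +oo[ (fun t : R => psi' t%:C%C).
    apply: (cintegral_dct mD cmn ie).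
      by move=> t /contour_gt0_ray t0; apply: lp'; exact: ltW.
    by move=> n t /contour_gt0_ray t0; apply: bn; exact: ltW.
  apply: cvgC_unique H1 _.
  have E n : cintegral `]0, +oo[ (fun t : R => psi'_ n t%:C%C) = - psi_ n 0%:C%C.
    rewrite (@cFTCy _ `](- rho), +oo[ (fun t : R => psi_ n t%:C%C)
      (fun t : R => psi'_ n t%:C%C) 0 (fun t => M * expR (- 2^-1 * t)))//.
    - by move=> t; rewrite /= !in_itv/= !andbT => t0; lra.
    - move=> t; rewrite /= in_itv/= andbT => tr.
      have d1 : cderR (fun t : R => t%:C%C) t (1 : R[i]).
        have := cderR_real_shift 0 t; congr (cderR _ _ _).
        by apply/funext => y; rewrite addr0.
      have := cderR_comp (fun u => @strip_open _ _ _ u (sR _ tr)) (dp n _ (sR _ tr)) d1.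
      by rewrite mulr1.
    - by move=> t t0; apply: bn; exact: ltW.
    - apply: (@cvgC_expR_tail (fun t => psi_ n t%:C%C) M) => t t0.
      by have := bp n t%:C%C; rewrite re_real; apply; apply: sR; lra.
  under eq_fun do rewrite E; apply: cvgCN.
  exact: lp.
rewrite -int0.
have ME y : mellin_shift y psi' 0 = cintegral `]0, +oo[ (fun t : R => psi' t%:C%C * ray_kernel y t).
  by apply: eq_cintegral => t _; rewrite addr0.
under eq_fun do rewrite ME.
apply: (cintegral_dct (k := fun t => M * 4 * expR (- 4^-1 * t))) => //.
- move=> n; apply: cmeasM => //.
  have d0 : 0 < 2^-1 :> R by rewrite invr_gt0.
  apply: seqcont_cmeas => //; exact: ray_kernel_seqcont.
- by apply: integrableZ_le => //; apply: integrable_expR_tail; rewrite invr_gt0.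
- move=> t /contour_gt0_ray t0; rewrite -[X in _ ~> X]mulr1; apply: cvgCM.
    exact: cvgC_cst.
  rewrite /ray_kernel -[X in _ ~> X]cexp0; apply: cvgC_cexp.
  rewrite -(mul0r (ln t)%:C%C); apply: cvgCM (cvgC_cst _).
  have := cvgC_real x0; apply: cvgC_ext => n; by rewrite addrAC subrr add0r.
- move=> n t /contour_gt0_ray t0; rewrite normcM.
  rewrite (le_trans (ler_pM (normc_ge0 _) (normc_ge0 _) (bl _ (ltW t0)) (ray_kernel_near1 (x01 n) t0)))//.
  rewrite le_eqVlt; apply/orP; left; apply/eqP.
  have -> : - 4^-1 * t = - 2^-1 * t + 4^-1 * t by field.
  by rewrite expRD; ring.
Qed.
End MellinLimit.

Section ZetaMellin.
Context {R : realType}.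
Variable G : nat -> R[i] -> R[i].
Hypotheses (dB : forall z, strip 1 z -> cder (strip 1) bernoulli z (G 0%N z))
  (dG : forall d z, strip 1 z -> cder (strip 1) (G d) z (G d.+1 z))
  (bG : forall d, expbound (- 2^-1) (G d)).

(** For small e the value of the fold does not depend on e, as it is Z s. Hence
    it equals its limit when e tends to 0. *)
Lemma zeta_mellin r (Z : 'rV[R[i]]_r -> R[i]) (s : 'rV[R[i]]_r) (ms : seq nat) :
  is_zeta_des Z -> nonintegral s -> size ms = r -> admissible (zip (entries s) ms) ->
  Z s = mellin_fold G (zip (entries s) ms) 0 0.
Proof.
move=> HZ ns sms adm; set p := zip _ _.
have sp : size p = r by rewrite size_zip size_entries sms minnn.
have up : unzip1 p = entries s by rewrite unzip1_zip// size_entries sms.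
have cG : cont_on (strip 1) (G 0%N).
  by move=> w u sw su uw; exact: cder_cont (dG 0 sw) su uw.
have [eta0 eta00 Heta] := is_zeta_desE dB cG (bG 0) HZ ns.
have [eta [e [eta01 re1 e01 e_lt e_0]]] := small_radii (size p) eta00.
have F := mellin_fold_family dG bG eta01 re1 e01 e_0 adm.
apply: cvgC_unique (jf_lim F 0 (lexx 0)).
apply: (cvgC_ext (u := fun=> Z s)); last exact: cvgC_cst.
move=> n /=; have /andP[en0 ene] := e01 n.
rewrite -/p up (hankel_jet_fold dG bG (rho := 1) (M := 1))//.
- rewrite (Heta (e n)); last by rewrite en0/=.
  by rewrite /entries big_map big_enum.
- by move=> z u _ _ _; exact: cvgC_cst.
- by move=> z _; rewrite /unit_jet eqxx normc1.
- apply: strip0; rewrite size_entries; have : 0 <= r%:R * (eta - e n) by rewrite mulr_ge0// subr_ge0.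
  by move: re1; rewrite sp; lra.
Qed.
End ZetaMellin.

Section Entries.
Context {R : realType}.

Lemma nth_entries r (s : 'rV[R[i]]_r) (k : 'I_r) : nth 0 (entries s) k = s 0 k.
Proof. by rewrite /entries (nth_map k) ?size_enum_ord// nth_ord_enum. Qed.

Lemma entries_rcons r (s : 'rV[R[i]]_r) (a : R[i]) :
  entries (row_mx s (a%:M : 'rV_1)) = rcons (entries s) a.
Proof.
apply: (@eq_from_nth _ 0) => [|k]; first by rewrite size_rcons !size_entries addn1.
rewrite size_entries => kr; rewrite (nth_entries _ (Ordinal kr)) nth_rcons size_entries.
case: ltngtP => [kr'|rk|kr'].
- have -> : Ordinal kr = lshift 1 (Ordinal kr') by exact: val_inj.
  by rewrite row_mxEl -(nth_entries _ (Ordinal kr')).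
- have kr' : (k < r.+1)%N by rewrite -(addn1 r).
  by move: kr'; rewrite ltnS leqNgt rk.
- have -> : Ordinal kr = rshift r (ord0 : 'I_1) by apply: val_inj; rewrite /= addn0.
  by rewrite row_mxEr mxE eqxx mulr1n.
Qed.

Lemma entries_scalar (a : R[i]) : entries (a%:M : 'rV_1) = [:: a].
Proof.
apply: (@eq_from_nth _ 0); rewrite size_entries// => -[]// _.
by rewrite (nth_entries _ ord0) mxE eqxx mulr1n.
Qed.

Lemma nonintegral_entries r (s : 'rV[R[i]]_r) :
  (forall q, q \in entries s -> nonint q) -> nonintegral s.
Proof.
move=> H k; apply: H; rewrite -(nth_entries s k) mem_nth// size_entries//.
Qed.

Lemma nonint_im (q : R[i]) : im q != 0 -> nonint q.
Proof.
move=> q0 k E; move: q0; rewrite E.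
by case: k {E} => n; rewrite ?NegzE ?mulrNz ?imN; rewrite im_nat ?oppr0 eqxx.
Qed.

Lemma nonint_frac (x : R) (k : int) : 0 < x < 1 -> nonint (x%:C%C + k%:~R).
Proof.
move=> /andP[x0 x1] m E.
have rz (p : int) : re (p%:~R : R[i]) = p%:~R.
  by case: p => n; rewrite ?NegzE ?mulrNz ?reN; rewrite re_nat.
have : x = (m - k)%:~R :> R.
  by have /(congr1 (@complex.Re R)) := E; rewrite reD re_real !rz rmorphB/= => <-; rewrite addrK.
move=> xE; move: x0 x1; rewrite xE -[1]/(1%:~R) ltr0z ltr_int.
by move: (m - k) => [[|n]|n].
Qed.

(** Entire functions are continuous along lines. *)
Lemma entire_cvg r (Z : 'rV[R[i]]_r -> R[i]) (S D : 'rV[R[i]]_r) (c : nat -> R[i]) :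
  entire Z -> c ~> 0 -> (fun n => Z (S + c n *: D)) ~> Z S.
Proof.
move=> eZ /cvgC_topP c0; apply/cvgC_topP.
have cZ := differentiable_continuous (eZ S).
have h : (S + c n *: D) @[n --> \oo] --> S.
  rewrite -[X in _ --> X]addr0 -(scale0r D); apply: cvgD; first exact: cvg_cst.
  have h := @cvgZr_tmp R[i] 'rV[R[i]]_r _ _ _ c 0 D c0.
  exact: h.
exact: cvg_comp h cZ.
Qed.
End Entries.

Section NegativeIntegers.
Context {R : realType}.
Variable G : nat -> R[i] -> R[i].
Hypotheses (dB : forall z, strip 1 z -> cder (strip 1) bernoulli z (G 0%N z))
  (dG : forall d z, strip 1 z -> cder (strip 1) (G d) z (G d.+1 z))
  (bG : forall d, expbound (- 2^-1) (G d)).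

(** The shifts x of the last variable; they are taken in ]0, 1[ to avoid integers. *)
Definition small_shift n : R := n.+2%:R^-1.

Lemma small_shift01 n : 0 < small_shift n < 1.
Proof. by rewrite /small_shift invr_gt0 ltr0n/= invf_lt1// ltr1n. Qed.

Lemma small_shift_cvg : small_shift n @[n --> \oo] --> 0.
Proof.
have := @cvg_harmonicZ R 1; under eq_fun do rewrite mul1r.
by rewrite -(cvg_shiftS (fun n => n.+1%:R^-1 : R)).
Qed.

Lemma mellin_fold_has_family (p : seq (R[i] * nat)) : admissible p ->
  exists2 rho, 0 < rho <= 1 & exists F_, jet_family rho F_ (mellin_fold G p).
Proof.
move=> adm; have [eta [e [eta1 pe e01 _ e_0]]] := @small_radii R (size p) 1 ltr01.
have /andP[eta0 _] := eta1.
exists (1 - (size p)%:R * eta).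
  by rewrite subr_gt0 pe/= gerBl mulr_ge0// ltW.
by have F := mellin_fold_family dG bG eta1 pe e01 e_0 adm; exact: (ex_intro _ _ F).
Qed.

Lemma mellin_fold_limit (p : seq (R[i] * nat)) j : admissible p ->
  (fun n => mellin_shift (1 + (small_shift n)%:C%C) (jet_mul G (mellin_fold G p) j.+1) 0) ~>
  - jet_mul G (mellin_fold G p) j 0.
Proof.
move=> /mellin_fold_has_family[rho /andP[r0 r1] [F_ [jF bF lF]]].
have jJ n := jet_mul_der dG r1 (jF n).
have bJ := jet_mul_bound bG r1 bF.
have [M M0 HM] := bJ j; have [M' M'0 HM'] := bJ j.+1.
have lJ d (t : R) : 0 <= t -> (fun n => jet_mul G (F_ n) d t%:C%C) ~> jet_mul G (mellin_fold G p) d t%:C%C.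
  by move=> t0; apply: jet_mul_lim => d'; exact: lF.
apply: (mellin_limit (rho := rho) (M := M + M') (psi_ := fun n => jet_mul G (F_ n) j)
  (psi'_ := fun n => jet_mul G (F_ n) j.+1)) => //.
- by move=> n z; exact: jJ.
- by move=> n w u sw su uw; exact: cder_cont (jJ n j.+1 w sw) su uw.
- by move=> n z sz; rewrite (le_trans (HM n z sz))// ler_wpM2r ?expR_ge0// lerDl.
- by move=> n z sz; rewrite (le_trans (HM' n z sz))// ler_wpM2r ?expR_ge0// lerDr.
- by move=> t; exact: lJ.
- by move=> t; exact: lJ.
- by move=> n; have /andP[-> /ltW] := small_shift01 n.
- exact: small_shift_cvg.
Qed.

Lemma bernoulli0_neq0 : bernoulli 0 != 0 :> R[i].
Proof.
have s0 : strip 1 (0 : R[i]) by exact: strip0.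
by rewrite mulf_neq0// ?invr_eq0; [exact: cexp_neq0|exact: expmean0_neq0].
Qed.

Lemma jet_mul_unit d z : jet_mul G unit_jet d z = G d z.
Proof.
rewrite /jet_mul /leibniz big_ord_recr/= subnn binn /unit_jet eqxx mul1r mulr1.
by rewrite big1 ?add0r// => i _; rewrite subn_eq0 leqNgt ltn_ord/= !mulr0.
Qed.

(** By zeta_mellin with m = 0, zeta_1^des (1 + x) is 1 / Gamma (1 + x) times an
    integral tending to that of g = b', which is - b 0 <> 0; and zeta_1^des is
    continuous at 1. *)
Lemma inv_gamma_limit (Z1 : 'rV[R[i]]_1 -> R[i]) : is_zeta_des Z1 ->
  exists lam, (fun n => (cGamma (1 + (small_shift n)%:C%C))^-1) ~> lam.
Proof.
move=> HZ; have [eZ _] := HZ.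
pose m n := mellin_shift (1 + (small_shift n)%:C%C) (G 0%N) 0.
have mlim : m ~> - bernoulli 0.
  have [M HM] := decays_bound (@smooth_decay_bernoulli R 0).
  have [M' HM'] := bG 0.
  apply: (mellin_limit (rho := 1) (M := `|M| + `|M'|) (psi_ := fun=> bernoulli)
    (psi'_ := fun=> G 0%N)) => //.
  - by move=> n w u sw su uw; exact: cder_cont (dG 0 sw) su uw.
  - move=> n z sz; rewrite (le_trans (HM z sz))// ler_wpM2r ?expR_ge0//.
    by rewrite (le_trans (ler_norm _))// lerDl.
  - move=> n z sz; rewrite (le_trans (HM' z sz))// ler_wpM2r ?expR_ge0//.
    by rewrite (le_trans (ler_norm _))// lerDr.
  - by move=> t _; exact: cvgC_cst.
  - by move=> t _; exact: cvgC_cst.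
  - by move=> n; have /andP[-> /ltW] := small_shift01 n.
  - exact: small_shift_cvg.
have ml0 : - bernoulli 0 != 0 :> R[i] by rewrite oppr_eq0 bernoulli0_neq0.
have ZE n : Z1 (1%:M + (small_shift n)%:C%C *: 1%:M) =
    (cGamma (1 + (small_shift n)%:C%C))^-1 * m n.
  have E : 1%:M + (small_shift n)%:C%C *: 1%:M = (1 + (small_shift n)%:C%C)%:M :> 'rV[R[i]]_1.
    by rewrite scale_scalar_mx mulr1 -raddfD.
  have ent : entries (1%:M + (small_shift n)%:C%C *: 1%:M : 'rV[R[i]]_1) =
      [:: 1 + (small_shift n)%:C%C] by rewrite E entries_scalar.
  have ni : nonint (1 + (small_shift n)%:C%C).
    by rewrite addrC; apply: (@nonint_frac _ _ 1); exact: small_shift01.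
  rewrite (zeta_mellin dB dG bG (ms := [:: 0%N]) HZ)//.
  - have jE : jet_mul G unit_jet 0 = G 0%N by apply/funext => z; rewrite jet_mul_unit.
    rewrite ent; change (mellin_fold _ _ _ _) with
      (mellin_jet G (1 + (small_shift n)%:C%C) 0 unit_jet 0 0).
    by rewrite /mellin_jet expr0 mul1r addr0 jE.
  - by apply: nonintegral_entries => q; rewrite ent inE => /eqP ->.
  - move=> q; rewrite ent/= inE => /eqP ->; split=> //=.
    by rewrite addr0 ltrDl; have /andP[] := small_shift01 n.
have Zlim : (fun n => (cGamma (1 + (small_shift n)%:C%C))^-1 * m n) ~> Z1 1%:M.
  apply: (cvgC_ext ZE); apply: entire_cvg => //; exact: cvgC_real small_shift_cvg.
exists (Z1 1%:M * (- bernoulli 0)^-1).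
have [N HN] : exists N, forall n, m (n + N)%N != 0.
  have /cvgC_normP/cvg0_lt_near := mlim.
  have b0 : 0 < normc (- bernoulli 0 : R[i]) by rewrite normc_gt0.
  move=> /(_ _ b0)[N HN]; exists N => n; apply/negP => /eqP mn.
  by have := HN n; rewrite mn sub0r !normc_opp ltxx.
have := cvgCM Zlim (cvgCV ml0 mlim).
move=> /(proj2 (cvgC_shift N _ _)) H; apply/(cvgC_shift N); apply: cvgC_ext H => n.
by rewrite /= mulfK.
Qed.

Variable lam : R[i].
Hypothesis lamP : (fun n => (cGamma (1 + (small_shift n)%:C%C))^-1) ~> lam.

(** Apply zeta_mellin at the shifted points S + x D with j + 1 integrations by
    parts in the last variable: the remaining exponent is 1 + x, so that
    mellin_limit gives the limit as x tends to 0. The vector D is the direction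
    of the last variable. *)
Lemma zeta_at_neg r (Z : 'rV[R[i]]_r -> R[i]) (S D : 'rV[R[i]]_r) (ss : seq R[i]) ms j :
  is_zeta_des Z -> size ms = size ss -> admissible (zip ss ms) ->
  (forall c : R[i], entries (S + c *: D) = rcons ss (c - j%:R)) ->
  Z S = (-1) ^+ j * (lam * jet_mul G (mellin_fold G (zip ss ms)) j 0).
Proof.
move=> HZ sms adm ent; have [eZ _] := HZ.
have H1 : (fun n => Z (S + (small_shift n)%:C%C *: D)) ~> Z S.
  by apply: entire_cvg => //; exact: cvgC_real small_shift_cvg.
apply: cvgC_unique H1 _.
have ni n : nonint ((small_shift n)%:C%C - j%:R).
  have := @nonint_frac _ _ (- j%:Z) (small_shift01 n).
  by rewrite mulrNz.
have E n : (small_shift n)%:C%C - j%:R + j.+1%:R = 1 + (small_shift n)%:C%C :> R[i].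
  by rewrite -[j.+1]addn1 natrD addrA subrK addrC.
have adm' n : admissible (zip (rcons ss ((small_shift n)%:C%C - j%:R)) (rcons ms j.+1)).
  move=> q; rewrite zip_rcons// mem_rcons inE => /orP[/eqP ->|]; last exact: adm.
  by split => //=; rewrite E reD re_real/= ltrDl; have /andP[] := small_shift01 n.
apply: (cvgC_ext (u := fun n => (-1) ^+ j.+1 * ((cGamma (1 + (small_shift n)%:C%C))^-1 *
   mellin_shift (1 + (small_shift n)%:C%C) (jet_mul G (mellin_fold G (zip ss ms)) j.+1) 0))).
  move=> n; rewrite (zeta_mellin dB dG bG (ms := rcons ms j.+1) HZ).
  - by rewrite ent zip_rcons// /mellin_fold foldl_rcons /mellin_jet/= E add0n.
  - apply: nonintegral_entries => q qe.
    have : q \in rcons ss ((small_shift n)%:C%C - j%:R) by rewrite -ent.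
    move=> /nthP - /(_ 0)[k]; rewrite size_rcons => ks <-.
    have := adm' n (nth (0, 0%N) (zip (rcons ss ((small_shift n)%:C%C - j%:R)) (rcons ms j.+1)) k).
    rewrite nth_zip ?size_rcons ?sms// => H; apply: (proj1 (H _)).
    by rewrite -nth_zip ?size_rcons ?sms// mem_nth// size_zip !size_rcons sms minnn.
  - by rewrite size_rcons sms -(size_rcons ss (0 - j%:R)) -ent size_entries.
  - by rewrite ent.
have -> : (-1) ^+ j * (lam * jet_mul G (mellin_fold G (zip ss ms)) j 0) =
    (-1) ^+ j.+1 * (lam * - jet_mul G (mellin_fold G (zip ss ms)) j 0).
  by rewrite exprS; ring.
apply: cvgCM (cvgC_cst _) _; apply: cvgCM => //; exact: mellin_fold_limit.
Qed.
End NegativeIntegers.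

(** * The identity *)

Section NonintegralCase.
Context {R : realType}.
Variable G : nat -> R[i] -> R[i].
Hypotheses (dB : forall z, strip 1 z -> cder (strip 1) bernoulli z (G 0%N z))
  (dG : forall d z, strip 1 z -> cder (strip 1) (G d) z (G d.+1 z))
  (bG : forall d, expbound (- 2^-1) (G d)).

Lemma mellin_jet_shift (a : R[i]) m i F d z :
  mellin_jet G (a - i%:R) (m + i) F d z = (-1) ^+ i * mellin_jet G a m F (d + i) z.
Proof.
rewrite /mellin_jet.
have -> : a - i%:R + (m + i)%:R = a + m%:R by rewrite natrD addrCA addrC subrK addrC.
have -> : (d + (m + i) = d + i + m)%N by rewrite -addnA (addnC i).
by rewrite exprD mulrA (mulrC ((-1) ^+ i)).
Qed.

Definition lift_exponent (q : R[i]) : nat := (Num.truncn `|re q|).+2.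

Lemma lift_exponentP q : 1 < re (q + (lift_exponent q)%:R).
Proof.
have h := truncnS_gt `|re q|.
have : - re q <= `|re q| by rewrite -normrN ler_norm.
by rewrite reD re_nat /lift_exponent -natr1; lra.
Qed.

Lemma admissible_lift (ss : seq R[i]) : (forall q, q \in ss -> nonint q) ->
  admissible (zip ss (map lift_exponent ss)).
Proof.
move=> H q qz; have {qz} : q \in [seq (x, lift_exponent x) | x <- ss].
  by move: qz; rewrite -[X in zip X]map_id zip_map.
move=> /mapP[x xs ->]; split; first exact: H.
exact: lift_exponentP.
Qed.

Lemma nonint_mem r (s : 'rV[R[i]]_r) q : nonintegral s -> q \in entries s -> nonint q.
Proof. by move=> ns /mapP[k _ ->] m; exact: ns. Qed.

Variable zeta_des : forall r : nat, 'rV[R[i]]_r -> R[i].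
Hypothesis zeta_desP : forall r : nat, (0 < r)%N -> is_zeta_des (zeta_des (r := r)).

Lemma product_formula_nonintegral n (s : 'rV[R[i]]_n) (a : R[i]) (l : nat) :
  nonintegral (row_mx s (a%:M : 'rV_1)) ->
  zeta_des (row_mx s (a%:M : 'rV_1)) * zeta_des ((- l%:R)%:M : 'rV_1)
  = \sum_(i < l.+1) \sum_(j < l.+1 | (i + j == l)%N)
      (-1) ^+ i * 'C(l, i)%:R *
      zeta_des (row_mx (row_mx s ((a - i%:R)%:M : 'rV_1)) ((- j%:R)%:M : 'rV_1)).
Proof.
move=> ns.
have [lam lamP] := inv_gamma_limit dB dG bG (zeta_desP (ltn0Sn 0)).
have n1 : (0 < n + 1)%N by rewrite addn1.
have n2 : (0 < n + 1 + 1)%N by rewrite addn1.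
pose ss := entries s; pose ms := map lift_exponent ss; pose m := lift_exponent a.
have sms : size ms = size ss by rewrite size_map.
have nss q : q \in ss -> nonint q.
  by move=> qs; apply: nonint_mem ns _; rewrite entries_rcons mem_rcons inE qs orbT.
have na : nonint a by apply: nonint_mem ns _; rewrite entries_rcons mem_rcons inE eqxx.
have adm := admissible_lift nss.
pose Phi := mellin_jet G a m (mellin_fold G (zip ss ms)).
have E1 : zeta_des (row_mx s (a%:M : 'rV_1)) = Phi 0%N 0.
  rewrite (zeta_mellin dB dG bG (ms := rcons ms m) (zeta_desP n1) ns).
  - by rewrite entries_rcons zip_rcons// /mellin_fold foldl_rcons.
  - by rewrite size_rcons sms size_entries addn1.
  - rewrite entries_rcons zip_rcons// => q; rewrite mem_rcons inE => /orP[/eqP ->|]; last exact: adm.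
    by split => //; exact: lift_exponentP.
have E2 : zeta_des ((- l%:R)%:M : 'rV_1) = (-1) ^+ l * (lam * G l 0).
  rewrite (zeta_at_neg dB dG bG lamP (D := 1%:M) (ss := [::]) (ms := [::]) (j := l) (zeta_desP (ltn0Sn 0)))//.
  - by rewrite /mellin_fold/= jet_mul_unit.
  - move=> c; rewrite scale_scalar_mx mulr1 -raddfD/= entries_scalar/= addrC//.
have E3 (i j : nat) : zeta_des (row_mx (row_mx s ((a - i%:R)%:M : 'rV_1)) ((- j%:R)%:M : 'rV_1)) =
    (-1) ^+ j * (lam * leibniz (G ^~ 0) (fun d => (-1) ^+ i * Phi (d + i)%N 0) j).
  rewrite (zeta_at_neg dB dG bG lamP (D := row_mx 0 1%:M) (ss := rcons ss (a - i%:R))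
    (ms := rcons ms (m + i)) (j := j) (zeta_desP n2)).
  - congr (_ * (_ * _)); rewrite zip_rcons// /mellin_fold foldl_rcons -/(mellin_fold _ _).
    by rewrite /jet_mul; congr leibniz; apply/funext => d; exact: mellin_jet_shift.
  - by rewrite !size_rcons sms.
  - rewrite zip_rcons// => q; rewrite mem_rcons inE => /orP[/eqP ->|]; last exact: adm.
    split => /=.
      by have := @nonintD _ a (- i%:Z) na; rewrite mulrNz.
    have -> : a - i%:R + (m + i)%:R = a + m%:R by rewrite natrD addrCA addrC subrK addrC.
    exact: lift_exponentP.
  - move=> c; rewrite scale_row_mx add_row_mx scaler0 addr0 scale_scalar_mx mulr1 -raddfD/=.
    by rewrite !entries_rcons; congr rcons; rewrite addrC.
rewrite E1 E2; have := alternating_leibniz_sum (G ^~ 0) (Phi ^~ 0) l => AL.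
have -> : Phi 0%N 0 * ((-1) ^+ l * (lam * G l 0)) = lam * ((-1) ^+ l * (G l 0 * Phi 0%N 0)) by ring.
rewrite -AL mulr_sumr; apply: eq_bigr => i _; rewrite mulr_sumr; apply: eq_bigr => j _.
by rewrite E3; ring.
Qed.
End NonintegralCase.

Section Density.
Context {R : realType}.

Definition im_shift n : R[i] := (0 +i* n.+1%:R^-1)%C.

Lemma im_shift_cvg : im_shift ~> 0.
Proof.
split => /=; first exact: cvg_cst.
by have := @cvg_harmonicZ R 1; under eq_fun do rewrite mul1r.
Qed.

(** All coordinates are moved by i / (n + N + 1), which is smaller than the
    nonzero imaginary parts among them, so none becomes real. *)
Lemma nonintegral_near r (S : 'rV[R[i]]_r) :
  exists N, forall n, nonintegral (S + im_shift (n + N)%N *: const_mx 1).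
Proof.
pose M (k : 'I_r) := (Num.truncn (`|im (S 0 k)|^-1)).+1.
exists (\max_k M k)%N => n k; apply: nonint_im; rewrite !mxE mulr1 imD /=.
apply/eqP => E.
have x0 : 0 < ((n + \max_k M k).+1%:R^-1 : R) by rewrite invr_gt0.
have imE : `|im (S 0 k)| = (n + \max_k M k).+1%:R^-1.
  by rewrite -(gtr0_norm x0) -normrN; congr `| _ |; move: E => /eqP; rewrite addr_eq0 => /eqP ->; rewrite opprK.
have h := truncnS_gt (`|im (S 0 k)|^-1).
have : (M k <= (n + \max_k M k).+1)%N by rewrite (leq_trans (leq_bigmax k))// leqW// leq_addl.
by rewrite -(ler_nat R) => /(lt_le_trans h); rewrite imE invrK ltxx.
Qed.
End Density.

(* r = n + 2, s = (s_1, ..., s_(r-2)) and a = s_(r-1). *)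
Theorem proposition4p10 (R : realType)
    (zeta_des : forall r : nat, 'rV[R[i]]_r -> R[i])
    (zeta_desP : forall r : nat, (0 < r)%N -> is_zeta_des (zeta_des r))
    (n : nat) (s : 'rV[R[i]]_n) (a : R[i]) (l : nat) :
  zeta_des (n + 1)%N (row_mx s (a%:M : 'rV_1))
    * zeta_des 1%N ((- l%:R)%:M : 'rV_1)
  = \sum_(i < l.+1) \sum_(j < l.+1 | (i + j == l)%N)
      (-1) ^+ i * 'C(l, i)%:R *
      zeta_des (n + 1 + 1)%N
        (row_mx (row_mx s ((a - i%:R)%:M : 'rV_1)) ((- j%:R)%:M : 'rV_1)).
Proof.
have [B [B0 dB bB]] := smooth_decay_jet (@smooth_decay_bernoulli R).
pose G d := B d.+1.
have dB0 z : strip 1 z -> cder (strip 1) bernoulli z (G 0%N z).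
  by move=> sz; rewrite -B0; exact: dB.
have key := product_formula_nonintegral dB0 (fun d => dB d.+1) (fun d => bB d.+1) zeta_desP.
have n1 : (0 < n + 1)%N by rewrite addn1.
have n2 : (0 < n + 1 + 1)%N by rewrite addn1.
have [N HN] := nonintegral_near (row_mx s (a%:M : 'rV_1)).
pose s' k := s + @im_shift R (k + N)%N *: const_mx 1.
pose a' k := a + @im_shift R (k + N)%N.
have cN : (fun k => @im_shift R (k + N)%N) ~> 0 by exact: (proj2 (cvgC_shift N _ _)) im_shift_cvg.
have sE k : row_mx (s' k) ((a' k)%:M : 'rV_1) =
    row_mx s (a%:M : 'rV_1) + @im_shift R (k + N)%N *: const_mx 1.
  have -> : const_mx 1 = row_mx (const_mx 1) (1%:M : 'rV_1) :> 'rV[R[i]]_(n + 1).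
    rewrite -[LHS]row_mx_const; congr row_mx; apply/rowP => i.
    by rewrite !mxE; case: eqP => // [[]]; rewrite !ord1.
  by rewrite scale_row_mx add_row_mx scale_scalar_mx mulr1 -raddfD.
have H1 : (fun k => zeta_des (n + 1)%N (row_mx (s' k) ((a' k)%:M : 'rV_1)) *
    zeta_des 1%N ((- l%:R)%:M : 'rV_1)) ~>
  zeta_des (n + 1)%N (row_mx s (a%:M : 'rV_1)) * zeta_des 1%N ((- l%:R)%:M : 'rV_1).
  apply: cvgCM (cvgC_cst _); under eq_fun do rewrite sE.
  by apply: entire_cvg cN; case: (zeta_desP _ n1).
apply: cvgC_unique H1 _.
have ns k : nonintegral (row_mx (s' k) ((a' k)%:M : 'rV_1)) by rewrite sE; exact: HN.
under eq_fun do rewrite key//.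
apply: cvgC_sum => i _; apply: cvgC_sum => j _; apply: cvgCM (cvgC_cst _) _.
have E k : row_mx (row_mx (s' k) ((a' k - i%:R)%:M : 'rV_1)) ((- j%:R)%:M : 'rV_1) =
    row_mx (row_mx s ((a - i%:R)%:M : 'rV_1)) ((- j%:R)%:M : 'rV_1)
    + @im_shift R (k + N)%N *: row_mx (row_mx (const_mx 1) 1%:M) 0.
  rewrite !scale_row_mx !add_row_mx scaler0 addr0 scale_scalar_mx mulr1 -raddfD/=.
  by rewrite /a' addrAC.
under eq_fun do rewrite E.
by apply: entire_cvg cN; case: (zeta_desP _ n2).
Qed.
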